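(* Assume that $X_0=(u_0,v_0)^\top\in\mathbb H^1$, $T>0$ and $\mathbf Q^{\frac12}\in\mathcal L_2(L^2)$. Then there exist a constant $\alpha\ge\mathrm{Tr}(\mathbf Q)$ and a positive constant $C=C(X_0,T,\mathbf Q,\alpha)$, not depending on $N$, such that for every $N\in\mathbb N^+$ the mild solution $(u^N,v^N)^\top$ of the spectral Galerkin discretization satisfies $$\sup_{s\in[0,T]}\mathbb E\Big[\exp\Big(\frac{V_1(u^N(s),v^N(s))}{\exp(\alpha s)}\Big)\Big]\le C.$$
   Context: Setting. $\mathcal O=(0,1)^d$ with $d\in\{1,2\}$, $L^p=L^p(\mathcal O;\mathbb R)$, and $\Lambda$ is the Laplacian on $\mathcal O$ with homogeneous Dirichlet boundary condition; $0<\lambda_1\le\lambda_2\le\cdots$ are the eigenvalues of $-\Lambda$ with eigenfunctions $\{e_i\}$ forming an orthonormal basis of $L^2$. $\dot{\mathbb H}^r=\mathcal D((-\Lambda)^{r/2})$ with $\|x\|_{\dot{\mathbb H}^r}^2=\sum_i\lambda_i^r\langle x,e_i\rangle_{L^2}^2$, $r\in\mathbb R$; $\mathbb H^r=\dot{\mathbb H}^r\times\dot{\mathbb H}^{r-1}$ with the product norm. $\mathcal L_2(L^2)$ denotes the Hilbert–Schmidt operators on $L^2$. $W$ is an $L^2$-valued $\mathbf Q$-Wiener process on a filtered probability space, where $\mathbf Q$ is a symmetric, positive definite operator of finite trace on $L^2$. $f(u)=c_3u^3+c_2u^2+c_1u+c_0$ with $c_3>0$ is a fixed real polynomial. The initial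 data $u_0,v_0$ are deterministic. Spectral Galerkin discretization. $P_N\zeta=\sum_{i=1}^N\langle\zeta,e_i\rangle_{L^2}e_i$, $U_N=\mathrm{span}\{e_1,\dots,e_N\}$, $\Lambda_N=\Lambda P_N$. $X^N=(u^N,v^N)^\top$ is the $U_N\times U_N$-valued mild solution of $du^N=v^Ndt$, $dv^N=\Lambda_Nu^Ndt-P_N(f(u^N))dt+P_NdW$, $u^N(0)=P_Nu_0$, $v^N(0)=P_Nv_0$. Energy. $F:L^4\to\mathbb R$ is a potential functional of $f$, i.e. $\frac{\partial F}{\partial u}(u)=f(u)$ (meaning $DF(u)w=\int_{\mathcal O}f(u)w\,dx$), chosen so that $a_1\|u\|_{L^4}^4-b_1\le F(u)\le a_2\|u\|_{L^4}^4+b_2$ for some positive constants $a_1,a_2,b_1,b_2$. $V_1:\mathbb H^1\to\mathbb R$, $V_1(u,v)=\frac12\|u\|_{\dot{\mathbb H}^1}^2+\frac12\|v\|_{L^2}^2+F(u)+C_1$ with a fixed constant $C_1\ge b_1$. Constants may depend on the fixed data $d$, $f$, $F$, $C_1$. *)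

(* Defs.v *)
From HB Require Import structures.
From mathcomp Require Import all_boot all_order all_algebra.
From mathcomp Require Import all_classical all_reals all_analysis.

Set Implicit Arguments.
Unset Strict Implicit.
Unset Printing Implicit Defensive.

Import Order.TTheory GRing.Theory Num.Theory.
Import numFieldNormedType.Exports.

Local Open Scope classical_set_scope.
Local Open Scope ring_scope.

(* The sigma-algebra on R^n generated by the coordinates, i.e. the Borel
   sigma-algebra. *)
Definition rV_display : measure_display. Proof. exact. Qed.

Section measurable_rV.
Context {R : realType} (n : nat).

Let coor (i : 'I_n) (x : 'rV[R]_n) : R := x ord0 i.

Let rV_set0 : g_sigma_preimage coor set0.
Proof. exact: sigma_algebra0. Qed.

Let rV_setC A : g_sigma_preimage coor A -> g_sigma_preimage coor (~` A).
Proof. exact: sigma_algebraC. Qed.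

Let rV_bigcup (F : _^nat) : (forall i, g_sigma_preimage coor (F i)) ->
  g_sigma_preimage coor (\bigcup_i (F i)).
Proof. exact: sigma_algebra_bigcup. Qed.

HB.instance Definition _ := @isMeasurable.Build rV_display
  'rV[R]_n (g_sigma_preimage coor) rV_set0 rV_setC rV_bigcup.

End measurable_rV.

Section cube.
Context {R : realType}.

Definition cube (d : nat) : set 'rV[R]_d :=
  [set x | forall i, 0 < x ord0 i < 1].

Definition cons_rV n (p : measurableTypeR R * 'rV[R]_n) : 'rV[R]_n.+1 :=
  \row_i if unlift ord0 i is Some j then p.2 ord0 j else p.1.

Lemma measurable_coor n (i : 'I_n) :
  measurable_fun [set: 'rV[R]_n] (fun x : 'rV[R]_n => x ord0 i).
Proof.
move=> _ Y mY; rewrite setTI; apply: sub_sigma_algebra => /=.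
rewrite -bigcup_seq/=; exists i => /=; first by rewrite mem_index_enum.
by exists Y => //; rewrite setTI.
Qed.

Lemma measurable_cons_rV n :
  measurable_fun [set: measurableTypeR R * 'rV[R]_n] (@cons_rV n).
Proof.
have mi (i : 'I_n.+1) : measurable_fun [set: measurableTypeR R * 'rV[R]_n]
    (fun p => if unlift ord0 i is Some j then p.2 ord0 j else p.1).
  case: (unlift ord0 i) => [j|]; last exact: measurable_fst.
  exact: (measurableT_comp (measurable_coor j)).
move=> _; apply: smallest_sub.
  split; first by rewrite preimage_set0 setI0; exact: measurable0.
  - move=> A mA; rewrite setTI setTD preimage_setC; apply: measurableC.
    by rewrite -[X in measurable X]setTI.
  - move=> F mF; rewrite setTI preimage_bigcup; apply: bigcup_measurable => k _.
    by rewrite -[X in measurable X]setTI; exact: mF.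
rewrite -bigcup_seq/=; apply: bigcup_sub => i _ _ [B mB <-].
rewrite !setTI.
rewrite (_ : _ @^-1` _ = (fun p : measurableTypeR R * 'rV[R]_n =>
  if unlift ord0 i is Some j then p.2 ord0 j else p.1) @^-1` B).
  by rewrite -[X in measurable X]setTI; exact: mi.
by apply/funext => p; rewrite /preimage/= /cons_rV mxE.
Qed.

Lemma lebesgue_interval_fin :
  ((@lebesgue_measure R) `]0%R, 1%R[%classic < +oo)%E.
Proof. by rewrite lebesgue_measure_itv /= lte01 oppr0 adde0 ltry. Qed.

Definition interval_measure :
    {finite_measure set (measurableTypeR R) -> \bar R} :=
  @mfrestr _ (measurableTypeR R) R _ (@lebesgue_measure R)
    (measurable_itv `]0%R, 1%R[) lebesgue_interval_fin.

Section cube_step.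
Variables (n : nat) (m : {finite_measure set 'rV[R]_n -> \bar R}).

Definition cube_step : set 'rV[R]_n.+1 -> \bar R :=
  pushforward (interval_measure \x m)%E (@cons_rV n).

Let cube_step0 : cube_step set0 = 0%E.
Proof. by rewrite /cube_step /pushforward preimage_set0 measure0. Qed.

Let cube_step_ge0 A : (0 <= cube_step A)%E.
Proof. by rewrite /cube_step /pushforward; apply: measure_ge0. Qed.

Let cube_step_sigma_additive : semi_sigma_additive cube_step.
Proof.
move=> F mF tF mUF.
rewrite /cube_step /pushforward preimage_bigcup.
have mc A : measurable A -> measurable (@cons_rV n @^-1` A).
  by move=> mA; rewrite -[X in measurable X]setTI; exact: measurable_cons_rV.
apply: measure_semi_sigma_additive.
- by move=> k; exact: mc.
- apply/trivIsetP => /= i j _ _ ij; rewrite -preimage_setI.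
  by move/trivIsetP : tF => /(_ _ _ _ _ ij) ->//; rewrite preimage_set0.
- by rewrite -preimage_bigcup; exact: mc.
Qed.

HB.instance Definition _ := isMeasure.Build _ _ _ cube_step
  cube_step0 cube_step_ge0 cube_step_sigma_additive.

Let cube_step_fin : fin_num_fun cube_step.
Proof.
apply: lty_fin_num_fun.
rewrite -[X in (X < _)%E]/((interval_measure \x m)%E (@cons_rV n @^-1` setT)).
rewrite preimage_setT -setXTT product_measure1E// lte_mul_pinfty//.
- by rewrite fin_num_measure.
- by rewrite -ge0_fin_numE// fin_num_measure.
Qed.

HB.instance Definition _ := @Measure_isFinite.Build _ _ _ cube_step
  cube_step_fin.

End cube_step.

(* The Lebesgue measure on the unit cube (0, 1)^d, as an iterated product,
   extended by 0 to a measure on R^d. *)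
Fixpoint cube_measure (d : nat) : {finite_measure set 'rV[R]_d -> \bar R} :=
  if d is n.+1 then cube_step (cube_measure n) else \d_(0 : 'rV[R]_0).

End cube.
Arguments cube {R} d _.

Section Lp_spaces.
Context {R : realType} {d : nat}.

(* Elements of L^p((0, 1)^d) are represented by real functions on R^d: only
   the values on the open cube matter, and they are identified when they are
   equal almost everywhere there. *)
Definition fn := 'rV[R]_d -> R.

Local Notation mu := (@cube_measure R d).

Definition in_Lp (p : R) (u : fn) : Prop := u \in Lfun mu p%:E.

Definition Lp_norm (p : R) (u : fn) : \bar R := 'N[mu]_(p%:E)[EFin \o u].

Definition L4_norm (u : fn) : R := fine (Lp_norm 4 u).

Definition inner (u v : fn) : R := \int[mu]_x (u x * v x).

Definition eq_L (u v : fn) : Prop := {ae mu, forall x, u x = v x}.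

End Lp_spaces.
Arguments fn R d : clear implicits.

Section dirichlet_laplacian.
Context {R : realType} {d : nat}.
Implicit Types (u w phi : fn R d) (G : 'I_d -> fn R d).

Definition partial (i : 'I_d) u : fn R d := 'D_(delta_mx ord0 i) u.

Definition iter_partial (s : seq 'I_d) u : fn R d := foldr partial u s.

(* C_c^oo((0, 1)^d) *)
Definition test_function phi : Prop :=
  (forall s : seq 'I_d, continuous (iter_partial s phi) /\
     forall i x, derivable (iter_partial s phi) x (delta_mx ord0 i)) /\
  exists2 K : set 'rV[R]_d, compact K /\ K `<=` cube d &
    forall x, ~ K x -> phi x = 0.

(* u is in H^1_0, the closure of C_c^oo for the H^1 norm, and its gradient
   is G *)
Definition H10_gradient u G : Prop :=
  [/\ in_Lp 2 u, forall i, in_Lp 2 (G i) &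
   exists phi : nat -> fn R d, [/\ forall n, test_function (phi n),
     Lp_norm 2 (phi n \- u) @[n --> \oo] --> 0%E &
     forall i, Lp_norm 2 (partial i (phi n) \- G i) @[n --> \oo] --> 0%E]].

(* the graph of Lambda: u is in the domain of Lambda, and Lambda u = w *)
Definition laplacian u w : Prop :=
  in_Lp 2 w /\ exists2 G, H10_gradient u G &
    forall phi, test_function phi ->
      \sum_(i < d) inner (G i) (partial i phi) = - inner w phi.

End dirichlet_laplacian.

Section spectral.
Context {R : realType} {d : nat}.
Variables (lam : nat -> R) (e : nat -> fn R d).
Implicit Types (u v : fn R d).

(* g(- Lambda_N) P_N; the indices of the eigenfunctions start at 0 *)
Definition spectral (g : R -> R) (N : nat) u : fn R d :=
  fun x => \sum_(i < N) g (lam i) * inner u (e i) * e i x.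

Definition galerkin_proj (N : nat) u : fn R d := spectral (fun=> 1) N u.

Record eigenbasis : Prop := {
  eigenbasis_L2 : forall i, in_Lp 2 (e i);
  eigenbasis_eq : forall i, laplacian (e i) (fun x => - lam i * e i x);
  eigenbasis_gt0 : 0 < lam 0;
  eigenbasis_le : forall i, lam i <= lam i.+1;
  eigenbasis_orthonormal : forall i j, inner (e i) (e j) = (i == j)%:R;
  eigenbasis_complete : forall u, in_Lp 2 u ->
    Lp_norm 2 (galerkin_proj N u \- u) @[N --> \oo] --> 0%E }.

(* U_N *)
Definition in_span (N : nat) u : Prop :=
  in_Lp 2 u /\
  exists a : 'I_N -> R, eq_L u (fun x => \sum_(i < N) a i * e i x).

(* squared norm of \dot H^r *)
Definition hdot_sqnorm (r : R) u : \bar R :=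
  (\sum_(0 <= i <oo) (lam i `^ r * inner u (e i) ^+ 2)%:E)%E.

(* \dot H^r, for r >= 0 *)
Definition in_hdot (r : R) u : Prop :=
  in_Lp 2 u /\ (hdot_sqnorm r u < +oo)%E.

(* H^r = \dot H^r * \dot H^(r - 1), for r >= 1 *)
Definition in_H (r : R) (z : fn R d * fn R d) : Prop :=
  in_hdot r z.1 /\ in_hdot (r - 1) z.2.

Definition V1 (F : fn R d -> R) (C1 : R) u v : R :=
  fine (hdot_sqnorm 1 u) / 2 + inner v v / 2 + F u + C1.

Definition wave_group (N : nat) (t : R) (z : fn R d * fn R d) :
    fn R d * fn R d :=
  let c := spectral (fun l => cos (t * Num.sqrt l)) N in
  (c z.1 \+ spectral (fun l => sin (t * Num.sqrt l) / Num.sqrt l) N z.2,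
   spectral (fun l => - (Num.sqrt l * sin (t * Num.sqrt l))) N z.1 \+ c z.2).

End spectral.

Section operators.
Context {R : realType} {d : nat}.
Implicit Types (A Q S : fn R d -> fn R d) (u v : fn R d).

Record bounded_operator A : Prop := {
  bounded_operator_L2 : forall u, in_Lp 2 u -> in_Lp 2 (A u);
  bounded_operator_linear : forall (a : R) u v, in_Lp 2 u -> in_Lp 2 v ->
    eq_L (A (fun x => a * u x + v x)) (fun x => a * A u x + A v x);
  bounded_operator_bound : exists M : R, forall u, in_Lp 2 u ->
    (Lp_norm 2 (A u) <= M%:E * Lp_norm 2 u)%E }.

Definition symmetric_operator A : Prop :=
  forall u v, in_Lp 2 u -> in_Lp 2 v -> inner (A u) v = inner u (A v).

Definition positive_definite A : Prop :=
  forall u, in_Lp 2 u -> ~ eq_L u (fun=> 0) -> 0 < inner (A u) u.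

(* S = Q^(1/2) *)
Definition square_root Q S : Prop :=
  [/\ bounded_operator S, symmetric_operator S,
   forall u, in_Lp 2 u -> 0 <= inner (S u) u &
   forall u, in_Lp 2 u -> eq_L (S (S u)) (Q u)].

(* The next two notions do not depend on the orthonormal basis e. *)
Definition trace (e : nat -> fn R d) Q : \bar R :=
  (\sum_(0 <= i <oo) (inner (Q (e i)) (e i))%:E)%E.

Definition hilbert_schmidt (e : nat -> fn R d) S : Prop :=
  (\sum_(0 <= i <oo) (inner (S (e i)) (S (e i)))%:E < +oo)%E.

End operators.

(* Frechet differentiability on L^4, with D F(u) w = \int f(u) w *)
Definition potential {R : realType} {d : nat} (f : R -> R) (F : fn R d -> R) :
    Prop :=
  forall u, in_Lp 4 u -> forall eps : R, 0 < eps ->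
  exists2 delta : R, 0 < delta & forall w, in_Lp 4 w -> L4_norm w < delta ->
    `|F (u \+ w) - F u - inner (f \o u) w| <= eps * L4_norm w.

(* The centered Gaussian law of given variance: normal_prob is not the Dirac
   measure when the standard deviation is 0. *)
Definition gaussian {R : realType} (var : R) (B : set R) : \bar R :=
  if var == 0 then \d_(0 : R) B else normal_prob 0 (Num.sqrt var) B.

Section stochastic.
Context {R : realType} {d : nat} {dsp : measure_display}
  {Omega : measurableType dsp}.
Variables (P : probability Omega R) (Fil : R -> set (set Omega)).
Implicit Types (X W : R -> Omega -> fn R d) (D : set R).

(* indexed by [0, +oo[ *)
Definition filtration : Prop :=
  [/\ forall t, 0 <= t -> sigma_algebra setT (Fil t),
   forall t, 0 <= t -> Fil t `<=` measurable &
   forall s t, 0 <= s -> s <= t -> Fil s `<=` Fil t].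

(* the sigma-algebra generated by an L^2-valued random variable *)
Definition sigma_L2 (Y : Omega -> fn R d) : set (set Omega) :=
  <<s [set A | exists h B, [/\ in_Lp 2 h, measurable B &
                            A = (fun w => inner (Y w) h) @^-1` (B : set R)]] >>.

Definition adapted D X : Prop :=
  forall t, D t -> sigma_L2 (X t) `<=` Fil t.

Definition L2_continuous_on D (x : R -> fn R d) : Prop :=
  forall t, D t -> Lp_norm 2 (x s \- x t) @[s --> within D (nbhs t)] --> 0%E.

Record Q_wiener (Q : fn R d -> fn R d) W : Prop := {
  wiener_L2 : forall t w, 0 <= t -> in_Lp 2 (W t w);
  wiener_adapted : adapted `[0, +oo[ W;
  wiener_0 : {ae P, forall w, eq_L (W 0 w) (fun=> 0)};
  wiener_continuous :
    {ae P, forall w, L2_continuous_on `[0, +oo[ (fun t => W t w)};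
  wiener_gaussian : forall s t h B, 0 <= s -> s <= t -> in_Lp 2 h ->
    measurable B ->
    P ((fun w => inner (W t w \- W s w) h) @^-1` B) =
    gaussian ((t - s) * inner (Q h) h) B;
  wiener_independent : forall s t A B, 0 <= s -> s <= t -> Fil s A ->
    sigma_L2 (fun w => W t w \- W s w) B ->
    P (A `&` B) = (P A * P B)%E }.

(* Z is the stochastic integral of Phi with respect to W on [0, t], for a
   deterministic and continuous integrand Phi: the limit of the Riemann sums
   in L^2(Omega; L^2 * L^2). *)
Definition wiener_integral W (t : R) (Phi : R -> fn R d -> fn R d * fn R d)
    (Z : Omega -> fn R d * fn R d) : Prop :=
  let riemann (n : nat) (w : Omega) (pr : fn R d * fn R d -> fn R d) : fn R d :=
    fun x => \sum_(k < n) pr (Phi (t * k%:R / n%:R)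
      (W (t * k.+1%:R / n%:R) w \- W (t * k%:R / n%:R) w)) x in
  let sqnorm (u : fn R d) := inner u u in
  [/\ forall w, in_Lp 2 (Z w).1 /\ in_Lp 2 (Z w).2,
   sigma_L2 (fun w => (Z w).1) `<=` measurable,
   sigma_L2 (fun w => (Z w).2) `<=` measurable &
   (\int[P]_w (sqnorm (riemann n w fst \- (Z w).1) +
               sqnorm (riemann n w snd \- (Z w).2))%:E)%E
     @[n --> \oo] --> 0%E].

Section galerkin.
Variables (lam : nat -> R) (e : nat -> fn R d).
Local Notation E := (wave_group lam e).

(* The mild solution on [0, T] of the N-th spectral Galerkin approximation.
   E N t is the group generated by the matrix (0, Id; Lambda_N, 0) on
   U_N * U_N, composed with P_N on both components, so that P_N needs not be
   applied to f(u) and W.  The Bochner integrals in the finite-dimensional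
   space U_N are computed pointwise. *)
Record galerkin_mild_solution (f : R -> R) (u0 v0 : fn R d) (T : R) W
    (N : nat) (u v : R -> Omega -> fn R d) : Prop := {
  galerkin_span : forall t w, t \in `[0, T] ->
    in_span e N (u t w) /\ in_span e N (v t w);
  galerkin_adapted : adapted `[0, T] u /\ adapted `[0, T] v;
  galerkin_continuous : {ae P, forall w,
    L2_continuous_on `[0, T] (fun t => u t w) /\
    L2_continuous_on `[0, T] (fun t => v t w)};
  galerkin_mild : forall t, t \in `[0, T] -> exists2 Z : Omega -> fn R d * fn R d,
    wiener_integral W t (fun s h => E N (t - s) (cst 0, h)) Z &
    {ae P, forall w,
      eq_L (u t w) (fun x => (E N t (galerkin_proj lam e N u0, galerkin_proj lam e N v0)).1 x
        - \int[lebesgue_measure]_(s in `[0, t])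
            (E N (t - s) (cst 0, f \o u s w)).1 x
        + (Z w).1 x) /\
      eq_L (v t w) (fun x => (E N t (galerkin_proj lam e N u0, galerkin_proj lam e N v0)).2 x
        - \int[lebesgue_measure]_(s in `[0, t])
            (E N (t - s) (cst 0, f \o u s w)).2 x
        + (Z w).2 x)} }.

End galerkin.
End stochastic.

(* Main.v *)
Require Import Defs.
From HB Require Import structures.
From mathcomp Require Import all_boot all_order all_algebra.
From mathcomp Require Import all_classical all_reals all_analysis.
From mathcomp Require Import measurable_realfun.
From mathcomp Require Import ring lra.

Set Implicit Arguments.
Unset Strict Implicit.
Unset Printing Implicit Defensive.

Import Order.TTheory GRing.Theory Num.Theory.
Import numFieldNormedType.Exports.

Local Open Scope classical_set_scope.
Local Open Scope ring_scope.

(** Why the bound holds.  Write b_i = <W, e_i>.  The wave flow conserves V1, so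
    along a solution V1 changes only through the noise: heuristically
    dV1 = sum_i v_i db_i + (1/2) sum_i q_i dt with q_i = <Q e_i, e_i>, and the
    quadratic variation of the martingale part is at most Tr(Q) |v|^2 dt, hence
    at most 2 Tr(Q) V1 dt.  The exponential growth this causes is absorbed by
    the factor exp(- alpha t) in front of V1, so that exp(exp(- alpha t) V1)
    is a supermartingale up to a bounded factor.  Below this is carried out on a
    mesh, with alpha = 4 Tr(Q), from the scalar Gaussian laws and the
    independence of the increments of W; there is no stochastic calculus.

    Energy along a path.  The shifted velocity w = v - b is differentiable in
    time, even though v is not, so conservation of energy can be used path by
    path.  Together with a summation by parts it shows that, uniformly over the
    mesh points t_k, V1 at time t_k is close to the sum
    M_k = V1(0) + sum_(j < k) (<v(t_j), xi_j> + |xi_j|^2 / 2), where xi_j is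
    the increment of b over [t_j, t_j+1] (energy_sum_cvg).

    One step.  Convexity and the exponential moments of a scalar Gaussian give
    E[exp(c (<v, xi> + |xi|^2 / 2)) | past] <= exp(2 c^2 h Tr(Q) |v|^2 + 2 c h Tr(Q))
    for c <= 1 and a small mesh h (independent_gaussian_step).  On the event
    that |v(t_j)|^2 / 2 <= M_j + 1 for all j up to k, the right-hand side is
    compensated by the decrease of the discount c_k = exp(- 4 Tr(Q) t_k), and
    iterating bounds the expectation of exp(c_n M_n) on this event
    (weighted_le).  On almost every path the event is realised as soon as the
    mesh is fine enough (weighted_cvg), and Fatou's lemma yields the moment
    bound (energy_moment).

    From the mild solution to paths.  The stochastic integral is a mean-square
    limit of Riemann sums with a smooth integrand; summation by parts shows
    that these sums also converge path by path, so the two limits agree almost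
    surely (wiener_integral_coord).  The coordinates of the mild solution are
    then given by the variation of constants formula of a forced oscillator, at
    all rational times and by continuity at all times (galerkin_paths).

    Uniformity in N.  The initial energy contains F(P_N u0), that is, the L^4
    norm of P_N u0, in which the projections P_N need not be bounded.
    Ladyzhenskaya's inequality, valid for d <= 2, extended from test functions
    to H^1_0, together with Green's formula for the eigenfunctions, controls
    this norm by the H^1 norm of u0 (comb_L4, initial_energy_le). *)

(** * Integrals of possibly non-measurable functions *)

Section nonmeasurable_integrals.
Context {R : realType} {dsp : measure_display} {T : measurableType dsp}.
Variable mu : {measure set T -> \bar R}.
Import HBNNSimple.

(** The integral of a nonnegative function is the supremum of the integrals of
    the simple functions below it, so it is monotone even when the smaller
    function is arbitrary.  It is applied to functions of random elements of L^2
    that are only weakly measurable. *)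
Lemma ae_le_integral_nonmeasurable (f g : T -> \bar R) :
  (forall x, 0 <= f x)%E -> (forall x, 0 <= g x)%E -> measurable_fun setT g ->
  {ae mu, forall x, (f x <= g x)%E} -> (\int[mu]_x f x <= \int[mu]_x g x)%E.
Proof.
move=> f0 g0 mg fg; rewrite ge0_integralTE//.
apply: ge_ereal_sup => _ [h /= hf <-].
rewrite -integralT_nnsfun; apply: ae_ge0_le_integral => //.
- by move=> x _; rewrite lee_fin.
- exact/measurable_EFinP.
- by apply: filterS fg => x fgx _; exact: le_trans (hf x) fgx.
Qed.

Lemma le_integral_nonmeasurable (f g : T -> \bar R) :
  (forall x, 0 <= f x)%E -> (forall x, f x <= g x)%E ->
  (\int[mu]_x f x <= \int[mu]_x g x)%E.
Proof.
move=> f0 fg; have g0 x : (0 <= g x)%E by exact: le_trans (f0 x) (fg x).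
rewrite !ge0_integralTE//; apply: ge_ereal_sup => _ [h /= hf <-].
by apply: ereal_sup_ubound; exists h => //= x; exact: le_trans (hf x) (fg x).
Qed.

Section fatou.
Variables (Y : nat -> T -> R) (f : T -> R).
Hypotheses (mY : forall n, measurable_fun setT (Y n)) (Y0 : forall n x, 0 <= Y n x)
  (Yf : {ae mu, forall x, Y n x @[n --> \oo] --> f x}).

Let g x := limn_einf (fun n => (Y n x)%:E).

Let mg : measurable_fun setT g.
Proof.
rewrite (_ : g = (fun x => - limn_esup (fun n => - (Y n x)%:E))%E).
  apply: measurableT_comp => //; apply: measurable_fun_limn_esup => n.
  by apply: measurableT_comp => //; exact/measurable_EFinP.
apply/funext => x; rewrite -limn_einfN; congr limn_einf.
by apply/funext => n /=; rewrite opprK.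
Qed.

Let g0 x : (0 <= g x)%E.
Proof.
rewrite /g limn_einf_lim; apply: lime_ge; first exact: is_cvg_einfs.
by apply: nearW => n; apply: le_ereal_inf_tmp => _ [m _ <-]; rewrite lee_fin.
Qed.

Let gf : {ae mu, forall x, g x = (f x)%:E}.
Proof.
apply: filterS Yf => x Yx.
have YE : (Y n x)%:E @[n --> \oo] --> (f x)%:E.
  by apply: cvg_EFin; [exact: nearW|exact: Yx].
by rewrite /g; have [->] := cvg_limn_einf_sup YE.
Qed.

Let le_g (M : \bar R) : (\forall n \near \oo, (\int[mu]_x (Y n x)%:E <= M)%E) ->
  (\int[mu]_x g x <= M)%E.
Proof.
move=> YM; have mY' n : measurable_fun setT (fun x => (Y n x)%:E) by exact/measurable_EFinP.
apply: le_trans (fatou _ _ mY' _) _ => //; first by move=> n x _; rewrite lee_fin.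
rewrite limn_einf_lim; apply: lime_le; first exact: is_cvg_einfs.
case: YM => n0 _ YM; exists n0 => // n /= n0n.
by apply: le_trans (YM n n0n); apply: ereal_inf_lbound; exists n => /=.
Qed.

(** The lower limit g of the sequence is measurable and agrees almost
    everywhere with the limit f, which itself may fail to be measurable. *)
Lemma fatou_ae (M : \bar R) : (forall x, 0 <= f x) ->
  (\forall n \near \oo, (\int[mu]_x (Y n x)%:E <= M)%E) ->
  (\int[mu]_x (f x)%:E <= M)%E.
Proof.
move=> f0 YM; apply: le_trans (le_g YM).
apply: ae_le_integral_nonmeasurable => //.
by apply: filterS gf => x ->.
Qed.

(** With Y the squared distance to a mean-square limit, this identifies the almost
    sure limit with the mean-square one. *)
Lemma fatou_ae_eq0 : (\int[mu]_x (Y n x)%:E)%E @[n --> \oo] --> 0%E ->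
  {ae mu, forall x, f x = 0}.
Proof.
move=> Y_0.
have ig : (\int[mu]_x g x = 0)%E.
  apply/eqP; rewrite eq_le integral_ge0 ?andbT//.
  apply/lee_addgt0Pr => eps eps0; rewrite add0e; apply: le_g.
  have : \forall n \near \oo, (\int[mu]_x (Y n x)%:E < eps%:E)%E.
    apply: (Y_0 [set y | (y < eps%:E)%E]).
    rewrite nbhsE /=; exists [set y | (y < eps%:E)%E] => //.
    by split; [exact: open_ereal_lt_ereal|rewrite /= lte_fin].
  by apply: filterS => n; exact: ltW.
have : ae_eq mu setT g (cst 0%E).
  apply/ae_eq_integral_abs => //.
  by under eq_integral do rewrite gee0_abs//.
by apply: filterS2 gf => x -> /(_ I) [].
Qed.

End fatou.

End nonmeasurable_integrals.

(** * Inner products and Lebesgue norms on the cube *)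

Section Lp_algebra.
Context {R : realType} {d : nat}.
Implicit Types (u v w h : fn R d).

Local Notation mu := (@cube_measure R d).

Lemma in_Lp_measurable p u : in_Lp p u -> measurable_fun setT u.
Proof. by rewrite /in_Lp inE => /andP[]; rewrite inE. Qed.

Lemma in_LpD p u v : 1 <= p -> in_Lp p u -> in_Lp p v -> in_Lp p (u \+ v).
Proof.
move=> p1 pu pv; rewrite /in_Lp.
have p1' : (1 <= p%:E)%E by rewrite lee_fin.
have [_ DD] := @Lfun_addr_closed _ _ _ mu _ p1'.
exact: (DD u v pu pv).
Qed.

Lemma in_LpZ p (a : R) u : 1 <= p -> in_Lp p u -> in_Lp p (fun x => a * u x).
Proof.
move=> p1 pu; rewrite /in_Lp; have := Lfun_scale a p1 pu.
suff -> : (fun x => a * u x) = (a \o* u) by [].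
by apply/funext => x /=; rewrite mulrC.
Qed.

Lemma in_LpB p u v : 1 <= p -> in_Lp p u -> in_Lp p v -> in_Lp p (u \- v).
Proof.
move=> p1 pu pv; have := in_LpD p1 pu (in_LpZ (-1) p1 pv).
suff -> : u \- v = u \+ (fun x => -1 * v x) by [].
by apply/funext => x /=; rewrite mulN1r.
Qed.

Lemma in_Lp0 p : in_Lp p (cst 0 : fn R d).
Proof. exact: Lfun_cst. Qed.

Lemma in_Lp_sum p I (r : seq I) (a : I -> R) (u : I -> fn R d) : 1 <= p ->
  (forall i, in_Lp p (u i)) -> in_Lp p (fun x => \sum_(i <- r) a i * u i x).
Proof.
move=> p1 pu; elim: r => [|i r IH].
  rewrite (_ : (fun _ => _) = cst 0); first exact: in_Lp0.
  by apply/funext => x; rewrite big_nil.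
rewrite (_ : (fun _ => _) =
    (fun x => a i * u i x) \+ (fun x => \sum_(i <- r) a i * u i x)).
  by apply: in_LpD => //; exact: in_LpZ.
by apply/funext => x; rewrite big_cons.
Qed.

Lemma in_Lp_integrable (n : nat) u : in_Lp n.+1%:R u ->
  mu.-integrable setT (fun x => (`|u x| ^+ n.+1)%:E).
Proof.
move=> pu.
have := @Lfun_integrable _ _ _ mu u n.+1%:R (ler1n _ _) pu.
by congr (integrable _ _ _); apply/funext => x; rewrite powR_mulrn.
Qed.

Lemma in_LpP (n : nat) u : in_Lp n.+1%:R u <->
  measurable_fun setT u /\ (\int[mu]_x (`|u x| ^+ n.+1)%:E < +oo)%E.
Proof.
split=> [pu|[mu_ iu]].
  split; first exact: in_Lp_measurable pu.
  have /integrableP[_] := in_Lp_integrable pu.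
  by under eq_integral do rewrite /= ger0_norm ?exprn_ge0//.
rewrite /in_Lp inE; apply/andP; split; rewrite inE//=.
rewrite /finite_norm unlock poweR_lty//.
by under eq_integral do rewrite /= powR_mulrn//.
Qed.

Lemma in_Lp2_mul u v : in_Lp 2 u -> in_Lp 2 v ->
  mu.-integrable setT (EFin \o (fun x => u x * v x)).
Proof. by move=> pu pv; apply/Lfun1_integrable; exact: Lfun2_mul_Lfun1. Qed.

Lemma innerC u v : inner u v = inner v u.
Proof. by apply: eq_Rintegral => x _; rewrite mulrC. Qed.

Lemma ae_Rintegral u v : measurable_fun setT u -> measurable_fun setT v ->
  eq_L u v -> \int[mu]_x u x = \int[mu]_x v x.
Proof.
move=> mu_ mv uv; congr fine; apply: ae_eq_integral => //.
- exact/measurable_EFinP.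
- exact/measurable_EFinP.
- by apply: filterS uv => x -> _.
Qed.

Lemma inner_eq_L u v h : measurable_fun setT u -> measurable_fun setT v ->
  measurable_fun setT h -> eq_L u v -> inner u h = inner v h.
Proof.
move=> mu_ mv mh uv; apply: ae_Rintegral.
- exact: measurable_funM.
- exact: measurable_funM.
- by apply: filterS uv => x ->.
Qed.

Lemma innerDl u v h : in_Lp 2 u -> in_Lp 2 v -> in_Lp 2 h ->
  inner (u \+ v) h = inner u h + inner v h.
Proof.
move=> pu pv ph; rewrite /inner -RintegralD//; try exact: in_Lp2_mul.
by apply: eq_Rintegral => x _ /=; rewrite mulrDl.
Qed.

Lemma innerZl (a : R) u h : in_Lp 2 u -> in_Lp 2 h ->
  inner (fun x => a * u x) h = a * inner u h.
Proof.
move=> pu ph; rewrite /inner -RintegralZl//; last exact: in_Lp2_mul.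
by apply: eq_Rintegral => x _ /=; rewrite mulrA.
Qed.

Lemma innerBl u v h : in_Lp 2 u -> in_Lp 2 v -> in_Lp 2 h ->
  inner (u \- v) h = inner u h - inner v h.
Proof.
move=> pu pv ph; rewrite /inner -RintegralB//; try exact: in_Lp2_mul.
by apply: eq_Rintegral => x _ /=; rewrite mulrBl.
Qed.

Lemma inner0l h : inner (cst 0) h = 0.
Proof.
rewrite /inner (@eq_Rintegral _ _ _ mu setT (cst 0)) => [|x _].
  by rewrite Rintegral_cst// mul0r.
by rewrite /= mul0r.
Qed.

Lemma inner_suml I (r : seq I) (a : I -> R) (u : I -> fn R d) h :
  (forall i, in_Lp 2 (u i)) -> in_Lp 2 h ->
  inner (fun x => \sum_(i <- r) a i * u i x) h = \sum_(i <- r) a i * inner (u i) h.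
Proof.
move=> pu ph; elim: r => [|i r IH].
  rewrite big_nil -[RHS](inner0l h); congr inner.
  by apply/funext => x; rewrite big_nil.
rewrite big_cons -IH -innerZl// -innerDl//.
- by congr inner; apply/funext => x; rewrite big_cons.
- by apply: in_LpZ => //; rewrite ler1n.
- by apply: in_Lp_sum => //; rewrite ler1n.
Qed.

Lemma inner_ge0 u : 0 <= inner u u.
Proof. by apply: Rintegral_ge0 => x _; rewrite -expr2 sqr_ge0. Qed.

Lemma inner_CS u v : in_Lp 2 u -> in_Lp 2 v ->
  inner u v ^+ 2 <= inner u u * inner v v.
Proof.
move=> pu pv.
have H (t : R) : 0 <= inner u u + t * inner u v *+ 2 + t ^+ 2 * inner v v.
  have ptv : in_Lp 2 (fun x => t * v x) by apply: in_LpZ; rewrite ?ler1n.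
  have puv : in_Lp 2 (u \+ (fun x => t * v x)) by apply: in_LpD; rewrite ?ler1n.
  have := inner_ge0 (u \+ (fun x => t * v x)).
  rewrite innerDl// [inner u _]innerC innerDl// innerZl//.
  rewrite innerZl// [inner v (_ \+ _)]innerC innerDl// innerZl// (innerC v u).
  by move/le_trans; apply; rewrite le_eqVlt; apply/orP; left; apply/eqP; ring.
have [v0|v0] := eqVneq (inner v v) 0.
  rewrite v0 mulr0.
  have [/eqP->|uv0] := boolP (inner u v == 0); first by rewrite expr0n.
  exfalso; have := H (- (inner u u + 1) / (inner u v *+ 2)).
  have -> : inner u u + - (inner u u + 1) / (inner u v *+ 2) * inner u v *+ 2 +
    (- (inner u u + 1) / (inner u v *+ 2)) ^+ 2 * inner v v = -1.
    rewrite v0; field; exact: uv0.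
  by lra.
have vp : 0 < inner v v by rewrite lt_neqAle eq_sym v0 inner_ge0.
have := H (- inner u v / inner v v).
have -> : inner u u + - inner u v / inner v v * inner u v *+ 2 +
  (- inner u v / inner v v) ^+ 2 * inner v v =
  inner u u - inner u v ^+ 2 / inner v v by field.
by rewrite subr_ge0 ler_pdivrMr.
Qed.

Lemma inner_EFin u v : in_Lp 2 u -> in_Lp 2 v ->
  (\int[mu]_x (u x * v x)%:E)%E = (inner u v)%:E.
Proof.
by move=> pu pv; rewrite /inner fineK//; apply: integrable_fin_num => //;
  exact: in_Lp2_mul.
Qed.

Lemma Lp_norm2E u : in_Lp 2 u -> Lp_norm 2 u = (Num.sqrt (inner u u))%:E.
Proof.
move=> pu; rewrite /Lp_norm unlock.
under eq_integral do rewrite /= powR_mulrn// real_normK ?num_real// expr2.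
by rewrite inner_EFin// poweR_EFin powR12_sqrt ?inner_ge0.
Qed.

Lemma L4_normE u : in_Lp 4 u ->
  L4_norm u ^+ 4 = \int[mu]_x (u x ^+ 4) /\
  (\int[mu]_x (u x ^+ 4)%:E)%E = (\int[mu]_x (u x ^+ 4))%:E.
Proof.
move=> pu.
have E (x : 'rV[R]_d) : `|u x| ^+ 4 = u x ^+ 4.
  by rewrite -(normrX 4) ger0_norm// (exprM _ 2 2) sqr_ge0.
have I : (\int[mu]_x (u x ^+ 4)%:E)%E = (\int[mu]_x (u x ^+ 4))%:E.
  rewrite /Rintegral fineK//; apply: integrable_fin_num => //.
  have := in_Lp_integrable pu; congr (integrable _ _ _); apply/funext => x.
  by rewrite E.
split => //; rewrite /L4_norm /Lp_norm unlock.
under eq_integral do rewrite /= powR_mulrn// E.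
rewrite I poweR_EFin/= -powR_mulrn ?powR_ge0// -powRrM mulVf// powRr1//.
by apply: Rintegral_ge0 => x _; rewrite (exprM _ 2 2) sqr_ge0.
Qed.

End Lp_algebra.

(** * Ladyzhenskaya's inequality *)

Section continuous_measurable.
Context {R : realType}.

(** Every open set of R^n is a countable union of boxes with rational centres
    and radii, so it belongs to the coordinate sigma-algebra. *)
Lemma open_measurable_rV n (U : set 'rV[R]_n) : open U -> measurable U.
Proof.
move=> oU.
pose B (q : 'rV[rat]_n * nat) : set 'rV[R]_n :=
  [set x | forall i, `|ratr (q.1 ord0 i) - x ord0 i| < q.2.+1%:R^-1].
have -> : U = \bigcup_q (if `[< B q `<=` U >] then B q else set0).
  apply/seteqP; split=> [x Ux|x [q _]]; last first.
    by case: asboolP => [BU Bx|_ //]; exact: BU.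
  have /nbhs_ballP[e /= e0 xeU] := open_nbhs_nbhs (conj oU Ux).
  have [k /= ke] : exists k : nat, k.+1%:R^-1 < e / 2.
    have e20 : 0 < e / 2 by rewrite divr_gt0.
    exists (Num.truncn (e / 2)^-1); rewrite invf_plt ?posrE//.
    by have := truncnS_gt (e / 2)^-1.
  have k0 : (0 : R) < k.+1%:R^-1 by rewrite invr_gt0.
  have Q i : exists q : rat, `|ratr q - x ord0 i| < k.+1%:R^-1.
    have [q] := @rat_in_itvoo R (x ord0 i - k.+1%:R^-1) (x ord0 i + k.+1%:R^-1)
      ltac:(by rewrite ltrD2l gtrN).
    rewrite in_itv/= => /andP[q1 q2]; exists q.
    by rewrite ltr_norml ltrBrDl q1 ltrBlDl.
  have [q qP] := choice Q.
  exists (\row_i q i, k) => //=.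
  have Bx : B (\row_i q i, k) x by move=> i /=; rewrite mxE.
  case: asboolP => //; case=> y By; apply: xeU; split => // i j.
  rewrite /ball/= (ord1 i).
  have := By j; have := Bx j; rewrite /= mxE.
  move: (k.+1%:R^-1) ke => r ke /[!ltr_norml] /andP[? ?] /andP[? ?].
  by apply/andP; split; lra.
apply: countable_bigcupT_measurable => // q.
case: asboolP => // _.
have -> : B q = \bigcap_(i in [set: 'I_n])
    ((fun x : 'rV[R]_n => x ord0 i) @^-1`
      [set y | `|ratr (q.1 ord0 i) - y| < q.2.+1%:R^-1]).
  by apply/seteqP; split => [x Bx i _|x Bx i]; [exact: Bx|exact: Bx].
apply: fin_bigcap_measurable => // i _.
rewrite -[X in measurable X]setTI; apply: measurable_coor => //.
rewrite (_ : [set y | _] = ball (ratr (q.1 ord0 i) : R) q.2.+1%:R^-1)//.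
exact: measurable_ball.
Qed.

Lemma continuous_measurable_rV n (f : 'rV[R]_n -> R) :
  continuous f -> measurable_fun setT f.
Proof.
move=> cf; apply: (@measurability _ _ _ (measurableTypeR R) setT f _
  (RGenOpens.measurableE R)).
move=> _ [_ [a [b ->]] <-]; rewrite setTI; apply: open_measurable_rV.
by apply: open_comp => //; exact: interval_open.
Qed.

End continuous_measurable.

Section slices.
Context {R : realType}.
Local Notation leb := (@lebesgue_measure R).
Local Notation itvm := (@interval_measure R).

Lemma ge0_integral_interval (f : R -> \bar R) : measurable_fun setT f ->
  (forall x, 0 <= f x)%E ->
  (\int[itvm]_x f x = \int[leb]_(x in `]0%R, 1%R[) f x)%E.
Proof.
move=> mf f0.
rewrite (@ge0_negligible_integral _ _ _ itvm setT (~` `]0%R, 1%R[%classic))//; last 2 first.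
- by apply: measurableC; exact: measurable_itv.
- by rewrite /= /mfrestr /mrestr setICl measure0.
rewrite setTD setCK; apply: eq_measure_integral => A mA A01.
by rewrite /= /mfrestr /mrestr setIidl.
Qed.

Lemma ge0_integral_cube0 (f : 'rV[R]_0 -> \bar R) : measurable_fun setT f ->
  (\int[@cube_measure R 0]_x f x = f 0%R)%E.
Proof. by move=> mf; rewrite /= integral_dirac// diracT mul1e. Qed.

Lemma ge0_integral_cubeS n (f : 'rV[R]_n.+1 -> \bar R) : measurable_fun setT f ->
  (forall x, 0 <= f x)%E ->
  (\int[@cube_measure R n.+1]_x f x =
   \int[itvm]_t \int[@cube_measure R n]_y f (cons_rV (t, y)))%E.
Proof.
move=> mf f0 /=.
rewrite -[LHS]/(\int[pushforward (itvm \x @cube_measure R n) (@cons_rV R n)]_x f x)%E.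
rewrite ge0_integral_pushforward//; last exact: measurable_cons_rV.
rewrite preimage_setT fubini_tonelli1//; last by move=> x; exact: f0.
by apply: measurableT_comp => //; exact: measurable_cons_rV.
Qed.

Lemma line_is_derive n (f : 'rV[R]_n -> R) a v (t : R) :
  derivable f (a + t *: v) v ->
  is_derive t 1 (fun s => f (a + s *: v)) ('D_v f (a + t *: v)).
Proof.
move=> df.
have E : (fun h : R => h^-1 *: (((fun s => f (a + s *: v)) \o shift t) (h *: 1)
     - f (a + t *: v))) =
   (fun h : R => h^-1 *: ((f \o shift (a + t *: v)) (h *: v) - f (a + t *: v))).
  apply/funext => h /=; congr (_ *: (f _ - _)).
  by rewrite [h%:A]mulr1 scalerDl addrCA.
split; first by rewrite /derivable E.
by rewrite /derive E.
Qed.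

Definition set_coord n (i : 'I_n) (t : R) (x : 'rV[R]_n) : 'rV[R]_n :=
  \row_j (if j == i then t else x ord0 j).

Lemma set_coordE n (i : 'I_n) t (x : 'rV[R]_n) :
  set_coord i t x = set_coord i 0 x + t *: delta_mx ord0 i.
Proof.
apply/rowP => j; rewrite !mxE eqxx/=.
by case: eqP => _; rewrite ?mulr1 ?mulr0 ?add0r ?addr0.
Qed.

Lemma set_coord_id n (i : 'I_n) (x : 'rV[R]_n) : set_coord i (x ord0 i) x = x.
Proof. by apply/rowP => j; rewrite !mxE; case: eqP => // ->. Qed.

Section test_function_slices.
Variables (d : nat) (phi : fn R d).
Hypothesis tphi : test_function phi.

Lemma test_function_continuous : continuous phi.
Proof. by have [/(_ [::])[]] := tphi. Qed.

Lemma test_function_partial_continuous i : continuous (partial i phi).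
Proof. by have [/(_ [:: i])[]] := tphi. Qed.

Lemma test_function_derivable i x : derivable phi x (delta_mx ord0 i).
Proof. by have [/(_ [::])[_ H] _] := tphi; exact: H. Qed.

Lemma test_function_out x : ~ cube d x -> phi x = 0.
Proof.
by have [_ [K [_ Kc] K0]] := tphi => xc; apply: K0 => /Kc.
Qed.

Lemma set_coord_continuous i (x : 'rV[R]_d) : continuous (fun t : R => set_coord i t x).
Proof.
rewrite (_ : (fun _ => _) = (fun t : R => set_coord i 0 x + t *: delta_mx ord0 i)).
  move=> t; apply: (@cvgD _ 'rV[R]_d); first exact: cvg_cst.
  exact: scalel_continuous.
by apply/funext => t; exact: set_coordE.
Qed.

(** The fundamental theorem of calculus along the i-th coordinate line through
    x, starting from the boundary of the cube, where phi vanishes. *)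
Lemma sqr_test_function_le i x :
  ((phi x ^+ 2)%:E <= \int[itvm]_t
     (2 * `|phi (set_coord i t x) * partial i phi (set_coord i t x)|)%:E)%E.
Proof.
have [xc|xc] := pselect (cube d x); last first.
  by rewrite test_function_out// expr0n/= integral_ge0// => t _; rewrite lee_fin mulr_ge0.
have /andP[x0 x1] := xc i.
pose g (t : R) := phi (set_coord i t x).
pose g' (t : R) := partial i phi (set_coord i t x).
have dg (t : R) : is_derive t 1 g (g' t).
  have := @line_is_derive d phi (set_coord i 0 x) (delta_mx ord0 i) t
    (@test_function_derivable i _).
  rewrite -set_coordE -/(partial i phi) -/(g' t).
  by rewrite (_ : (fun s => _) = g)//; apply/funext => s; rewrite /g [in RHS]set_coordE.
have cg : continuous g.
  by move=> t; apply: continuous_comp; [exact: set_coord_continuous|exact: test_function_continuous].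
have cg' : continuous g'.
  by move=> t; apply: continuous_comp; [exact: set_coord_continuous|exact: test_function_partial_continuous].
have g0 : g 0 = 0.
  by apply: test_function_out => /(_ i); rewrite mxE eqxx ltxx.
have gx : g (x ord0 i) = phi x by rewrite /g set_coord_id.
have ch : continuous (fun t => 2 * (g t * g' t)).
  by move=> t; apply: cvgM; [exact: cvg_cst|apply: cvgM; [exact: cg|exact: cg']].
have dg2 (t : R) : is_derive t 1 (fun t => g t ^+ 2) (2 * (g t * g' t)).
  have D := dg t; apply: is_derive_eq.
  by rewrite /GRing.scale/=; ring.
have ch' : measurable_fun setT (fun t => (2 * `|g t * g' t|)%:E).
  apply/measurable_EFinP; apply: continuous_measurable_fun => t.
  apply: cvgM; first exact: cvg_cst.
  apply: (continuous_comp (f := fun t => g t * g' t)); last exact: norm_continuous.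
  by apply: cvgM; [exact: cg|exact: cg'].
have FTC : (\int[leb]_(t in `[0%R, x ord0 i]) (2 * (g t * g' t))%:E = (phi x ^+ 2)%:E)%E.
  rewrite (@continuous_FTC2 _ _ (fun t => g t ^+ 2))//.
  - by rewrite g0 gx expr0n/= sube0.
  - exact: continuous_subspaceT.
  - have cg2 : continuous (fun t => g t ^+ 2).
      by move=> t; apply: (continuous_comp (g := fun y : R => y ^+ 2)); [exact: cg|exact: exprn_continuous].
    split; first by move=> t _; have [] := dg2 t.
    + exact/cvg_at_right_filter/cg2.
    + exact/cvg_at_left_filter/cg2.
  - by move=> t _; rewrite derive1E; apply: derive_val.
rewrite -FTC ge0_integral_interval//.
apply: (@le_trans _ _ (\int[leb]_(t in `[0%R, x ord0 i]) (2 * `|g t * g' t|)%:E)%E).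
  apply: le_integral => //.
  - apply: continuous_compact_integrable; first exact: segment_compact.
    exact: continuous_subspaceT.
  - apply: continuous_compact_integrable; first exact: segment_compact.
    apply: continuous_subspaceT => t.
    apply: cvgM; first exact: cvg_cst.
    apply: (continuous_comp (f := fun t => g t * g' t)); last exact: norm_continuous.
    by apply: cvgM; [exact: cg|exact: cg'].
  - by move=> t _; rewrite lee_fin ler_pM2l// ler_norm.
rewrite integral_itv_bndoo//; last exact: measurable_funS ch'.
apply: ge0_subset_integral => //.
- exact: measurable_funS ch'.
- by apply: subset_itvl; rewrite bnd_simp ltW.
Qed.

End test_function_slices.
End slices.

Section ladyzhenskaya.
Context {R : realType}.
Local Notation leb := (@lebesgue_measure R).
Local Notation itvm := (@interval_measure R).

Lemma set_coord_cons0 n s t (y : 'rV[R]_n) :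
  set_coord ord0 t (cons_rV (s, y)) = cons_rV (t, y).
Proof.
apply/rowP => j; rewrite !mxE/=.
by case: (unliftP ord0 j) => [k ->|->]; rewrite ?eqxx// eq_sym (negbTE (neq_lift _ _)).
Qed.

Lemma set_coord_consS n (i : 'I_n) s t (y : 'rV[R]_n) :
  set_coord (lift ord0 i) t (cons_rV (s, y)) = cons_rV (s, set_coord i t y).
Proof.
apply/rowP => j; rewrite !mxE/=.
case: (unliftP ord0 j) => [k ->|->]; first by rewrite (inj_eq lift_inj) mxE.
by rewrite (negbTE (neq_lift _ _)).
Qed.

Lemma measurable_cons_rVr n (t : R) :
  measurable_fun setT (fun y : 'rV[R]_n => cons_rV (t, y)).
Proof.
apply: (measurableT_comp (@measurable_cons_rV R n)).
by apply: measurable_fun_pair => //; exact: measurable_cst.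
Qed.

Lemma interval_measureT : itvm setT = 1%E.
Proof.
rewrite /= /mfrestr /mrestr setTI lebesgue_measure_itv/= lte_fin ltr01.
by rewrite -EFinB subr0.
Qed.

Lemma in_Lp_normr d (n : nat) (u : fn R d) : in_Lp n.+1%:R u ->
  in_Lp n.+1%:R (fun x => `|u x|).
Proof.
move=> /in_LpP[mu_ iu]; apply/in_LpP; split; first exact: measurableT_comp.
by under eq_integral do rewrite normr_id.
Qed.

Lemma sqr_Rintegral_normM d (u v : fn R d) : in_Lp 2 u -> in_Lp 2 v ->
  inner (fun x => `|u x|) (fun x => `|v x|) ^+ 2 <= inner u u * inner v v.
Proof.
move=> pu pv.
have E (w : fn R d) : inner w w = inner (fun x => `|w x|) (fun x => `|w x|) :> R.
  by apply: eq_Rintegral => x _; rewrite -normrM ger0_norm// -expr2 sqr_ge0.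
by rewrite (E u) (E v); apply: inner_CS; exact: in_Lp_normr.
Qed.

(** Arithmetic-geometric mean inequality for the two partial derivatives. *)
Lemma mul2_le_mean (P X Y a b : R) : 0 <= P * X -> 0 <= P * Y ->
  a ^+ 2 <= P * X -> b ^+ 2 <= P * Y -> 2 * b * (2 * a) <= 4 * P * (X + Y).
Proof. by have := sqr_ge0 (a - b); lra. Qed.

Section one_test_function.
Variables (d : nat) (phi : fn R d).
Hypotheses (tphi : test_function phi) (phi2 : in_Lp 2 phi)
  (dphi2 : forall i, in_Lp 2 (partial i phi)).

Let a (i : 'I_d) := inner (fun x => `|phi x|) (fun x => `|partial i phi x|).

Let aE i : (\int[@cube_measure R d]_x (2 * `|phi x * partial i phi x|)%:E)%E =
  (2 * a i)%:E.
Proof.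
have L : in_Lp 2 (fun x => `|phi x|) by exact: in_Lp_normr.
have L' : in_Lp 2 (fun x => `|partial i phi x|) by exact: in_Lp_normr.
rewrite EFinM /a -inner_EFin// -ge0_integralZl_EFin//.
- by apply: eq_integral => x _; rewrite -EFinM normrM.
- by apply/measurable_EFinP; apply: measurable_funM; exact: in_Lp_measurable L || exact: in_Lp_measurable L'.
Qed.

Let a_ge0 i : 0 <= a i.
Proof. by apply: Rintegral_ge0 => x _; rewrite mulr_ge0. Qed.

Let sqr_a i : a i ^+ 2 <= inner phi phi * inner (partial i phi) (partial i phi).
Proof. exact: sqr_Rintegral_normM. Qed.

Let mh i : measurable_fun setT (fun x => (2 * `|phi x * partial i phi x|)%:E).
Proof.
apply/measurable_EFinP; apply: measurable_funM => //.
apply: measurableT_comp => //; apply: measurable_funM.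
- exact: in_Lp_measurable phi2.
- exact: in_Lp_measurable (dphi2 i).
Qed.

Let mphi n : measurable_fun setT (fun x => (phi x ^+ n)%:E).
Proof.
apply/measurable_EFinP; apply: measurable_funX.
exact: in_Lp_measurable phi2.
Qed.

Let h_ge0 i x : (0 <= (2 * `|phi x * partial i phi x|)%:E)%E.
Proof. by rewrite lee_fin mulr_ge0. Qed.

(** On the line, integrating the derivative of phi^2 bounds phi^2 everywhere by
    a constant, and the integral of phi^4 by the square of that constant. *)
Lemma ladyzhenskaya1 : d = 1%N ->
  (\int[@cube_measure R d]_x (phi x ^+ 4)%:E <=
   (4 * inner phi phi * \sum_i inner (partial i phi) (partial i phi))%:E)%E.
Proof.
move=> d1; subst d.
have sup x : phi x ^+ 2 <= 2 * a ord0.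
  rewrite -lee_fin -aE; apply: le_trans (sqr_test_function_le tphi ord0 x) _.
  rewrite ge0_integral_cubeS// le_eqVlt; apply/orP; left; apply/eqP.
  apply: eq_integral => t _; rewrite ge0_integral_cube0; last first.
    exact: measurableT_comp (mh ord0) (measurable_cons_rVr t).
  rewrite (_ : set_coord ord0 t x = cons_rV (t, 0))//.
  by apply/rowP => j; rewrite (ord1 j) !mxE/= unlift_none.
have -> : \sum_i inner (partial i phi) (partial i phi) =
    inner (partial ord0 phi) (partial ord0 phi) :> R.
  by rewrite big_ord_recl big_ord0 addr0.
apply: (@le_trans _ _ (4 * a ord0 ^+ 2)%:E); last first.
  by rewrite lee_fin -mulrA ler_pM2l.
apply: (@le_trans _ _ (\int[@cube_measure R 1]_x (4 * a ord0 ^+ 2)%:E)%E).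
  apply: ge0_le_integral => //; first by move=> x _; rewrite lee_fin (exprM _ 2 2) sqr_ge0.
  move=> x _; rewrite lee_fin (exprM _ 2 2) (_ : 4 * _ = (2 * a ord0) ^+ 2); last by ring.
  by rewrite ler_pXn2r// ?nnegrE ?sqr_ge0// mulr_ge0.
rewrite ge0_integral_cubeS//; last by move=> x; rewrite lee_fin mulr_ge0// sqr_ge0.
under eq_integral.
  move=> t _; rewrite ge0_integral_cube0; last first.
    by apply/measurable_EFinP; exact: measurable_cst.
  over.
by rewrite integral_cst// [X in (_ * X)%E]interval_measureT mule1.
Qed.

(** In the plane, integrating along the first axis bounds phi^2 by a function of
    the second coordinate only, and integrating along the second axis by a
    function of the first: the double integral of their product, which bounds
    that of phi^4, factorises. *)
Lemma ladyzhenskaya2 : d = 2%N ->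
  (\int[@cube_measure R d]_x (phi x ^+ 4)%:E <=
   (4 * inner phi phi * \sum_i inner (partial i phi) (partial i phi))%:E)%E.
Proof.
move=> d2; subst d.
pose h i x := (2 * `|phi x * partial i phi x|)%:E.
have aP i : exists ai : R, [/\ (\int[@cube_measure R 2]_x h i x = (2 * ai)%:E)%E,
    0 <= ai & ai ^+ 2 <= inner phi phi * inner (partial i phi) (partial i phi)].
  by exists (a i); split; [exact: aE|exact: a_ge0|exact: sqr_a].
have [a0 [a0E a00 sqr_a0]] := aP ord0.
have [a1 [a1E a10 sqr_a1]] := aP (lift ord0 ord0).
pose p (s t : R) : 'rV[R]_2 := cons_rV (s, cons_rV (t, 0)).
pose i1 : 'I_2 := lift ord0 ord0.
have mp2 : measurable_fun setT (fun z : measurableTypeR R * measurableTypeR R => p z.1 z.2).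
  apply: (measurableT_comp (@measurable_cons_rV R 1)).
  apply: measurable_fun_pair; first exact: measurable_fst.
  apply: (measurableT_comp (@measurable_cons_rV R 0)).
  by apply: measurable_fun_pair; [exact: measurable_snd|exact: measurable_cst].
have int2 (f : 'rV[R]_2 -> \bar R) : measurable_fun setT f -> (forall x, 0 <= f x)%E ->
    (\int[@cube_measure R 2]_x f x = \int[itvm]_s \int[itvm]_t f (p s t))%E.
  move=> mf f0; rewrite ge0_integral_cubeS//; apply: eq_integral => s _.
  have ms := measurableT_comp mf (measurable_cons_rVr s).
  rewrite ge0_integral_cubeS//.
  apply: eq_integral => t _; rewrite ge0_integral_cube0//.
  exact: measurableT_comp ms (measurable_cons_rVr t).
pose A t := (\int[itvm]_s h ord0 (p s t))%E.
pose B s := (\int[itvm]_t h i1 (p s t))%E.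
have mh2 i : measurable_fun setT (fun z : measurableTypeR R * measurableTypeR R => h i (p z.1 z.2)).
  exact: measurableT_comp (mh i) mp2.
have mA : measurable_fun setT A.
  by apply: (@measurable_fun_fubini_tonelli_G _ _ _ _ _ itvm
    (fun z => h ord0 (p z.1 z.2))) ; [exact: mh2|move=> z; exact: h_ge0].
have mB : measurable_fun setT B.
  by apply: (@measurable_fun_fubini_tonelli_F _ _ _ _ _ itvm
    (fun z => h i1 (p z.1 z.2))) ; [exact: mh2|move=> z; exact: h_ge0].
have m4 : measurable_fun setT
    (fun z : measurableTypeR R * measurableTypeR R => (phi (p z.1 z.2) ^+ 4)%:E).
  exact: measurableT_comp (mphi 4) mp2.
have p40 z : (0 <= (phi (p z.1 z.2) ^+ 4)%:E)%E.
  by rewrite lee_fin (exprM _ 2 2) sqr_ge0.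
have A0 t : (0 <= A t)%E by apply: integral_ge0 => s _; exact: h_ge0.
have B0 t : (0 <= B t)%E by apply: integral_ge0 => s _; exact: h_ge0.
have iA : (\int[itvm]_t A t = (2 * a0)%:E)%E.
  rewrite -a0E (int2 (h ord0) (mh ord0) (h_ge0 ord0)).
  exact/esym/(fubini_tonelli (m1 := itvm) (m2 := itvm) (fun z => h ord0 (p z.1 z.2)) (mh2 ord0)
    (fun z => h_ge0 ord0 (p z.1 z.2))).
have iB : (\int[itvm]_t B t = (2 * a1)%:E)%E.
  by rewrite -a1E (int2 (h i1) (mh i1) (h_ge0 i1)).
have iBA s : (\int[itvm]_t (B s * A t) = B s * (2 * a0)%:E)%E.
  rewrite -iA; exact: (@ge0_integralZl _ _ R itvm setT measurableT A mA (B s) (fun t _ => A0 t) (B0 s)).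
have key s t : ((phi (p s t) ^+ 4)%:E <= B s * A t)%E.
  rewrite (exprM _ 2 2) expr2 EFinM; apply: lee_pmul; rewrite ?lee_fin ?sqr_ge0//.
    apply: le_trans (sqr_test_function_le tphi i1 (p s t)) _.
    by under eq_integral do rewrite set_coord_consS set_coord_cons0.
  apply: le_trans (sqr_test_function_le tphi ord0 (p s t)) _.
  by under eq_integral do rewrite set_coord_cons0.
rewrite int2//; last by move=> x; rewrite lee_fin (exprM _ 2 2) sqr_ge0.
apply: (@le_trans _ _ (\int[itvm]_s \int[itvm]_t (B s * A t))%E).
  apply: ge0_le_integral => //.
  - by move=> s _; apply: integral_ge0 => t _; rewrite lee_fin (exprM _ 2 2) sqr_ge0.
  - by apply: (@measurable_fun_fubini_tonelli_F _ _ _ _ _ itvm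
      (fun z => (phi (p z.1 z.2) ^+ 4)%:E)); [exact: m4|exact: p40].
  - under eq_fun do rewrite iBA.
    exact: emeasurable_funM mB (measurable_cst _).
  - move=> s _; apply: ge0_le_integral => //.
    + by move=> t _; rewrite lee_fin (exprM _ 2 2) sqr_ge0.
    + exact: measurable_fun_pair2 s m4.
    + exact: emeasurable_funM (measurable_cst (B s)) mA.
have a20 : (0 <= (2 * a0)%:E)%E by rewrite lee_fin mulr_ge0.
have E : (\int[itvm]_s \int[itvm]_t (B s * A t) = (2 * a1)%:E * (2 * a0)%:E)%E.
  transitivity (\int[itvm]_s (B s * (2 * a0)%:E))%E.
    by apply: eq_integral => s _; exact: iBA.
  rewrite -iB.
  exact: (@ge0_integralZr _ _ R itvm setT measurableT B mB _ (fun s _ => B0 s) a20).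
have sum2 (G : 'I_2 -> R) : \sum_i G i = G ord0 + G i1.
  by rewrite big_ord_recl big_ord_recl big_ord0 addr0.
rewrite (sum2 (fun i => inner (partial i phi) (partial i phi))).
rewrite E -EFinM lee_fin; apply: mul2_le_mean sqr_a0 sqr_a1.
- exact: (mulr_ge0 (inner_ge0 _) (inner_ge0 _)).
- exact: (mulr_ge0 (inner_ge0 _) (inner_ge0 _)).
Qed.

Lemma ladyzhenskaya : d = 1%N \/ d = 2%N ->
  (\int[@cube_measure R d]_x (phi x ^+ 4)%:E <=
   (4 * inner phi phi * \sum_i inner (partial i phi) (partial i phi))%:E)%E.
Proof. by case; [exact: ladyzhenskaya1|exact: ladyzhenskaya2]. Qed.

End one_test_function.
End ladyzhenskaya.

(** * The Sobolev embedding of H^1_0 into L^4 *)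

Section L2_norm.
Context {R : realType} {d : nat}.
Implicit Types (u v w h : fn R d).
Local Notation mu := (@cube_measure R d).

Definition L2n u : R := Num.sqrt (inner u u).

Lemma L2n_ge0 u : 0 <= L2n u. Proof. exact: sqrtr_ge0. Qed.

Lemma sqr_L2n u : L2n u ^+ 2 = inner u u.
Proof. by rewrite sqr_sqrtr ?inner_ge0. Qed.

Lemma normr_inner_le u v : in_Lp 2 u -> in_Lp 2 v -> `|inner u v| <= L2n u * L2n v.
Proof.
move=> pu pv; rewrite -(@ler_pXn2r _ 2)// ?nnegrE ?mulr_ge0 ?L2n_ge0//.
by rewrite exprMn !sqr_L2n real_normK ?num_real// inner_CS.
Qed.

Lemma L2nD u v : in_Lp 2 u -> in_Lp 2 v -> L2n (u \+ v) <= L2n u + L2n v.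
Proof.
move=> pu pv; rewrite -(@ler_pXn2r _ 2)// ?nnegrE ?addr_ge0 ?L2n_ge0//.
rewrite sqrrD !sqr_L2n.
have puv : in_Lp 2 (u \+ v) by apply: in_LpD; rewrite ?ler1n.
rewrite innerDl// [inner u (_ \+ _)]innerC [inner v (_ \+ _)]innerC !innerDl// (innerC v u).
have := le_trans (ler_norm _) (normr_inner_le pu pv).
by set a := inner u u; set b := inner v v; move: (inner u v) (L2n u * L2n v) => c e; lra.
Qed.

Lemma L2nZ (a : R) u : in_Lp 2 u -> L2n (fun x => a * u x) = `|a| * L2n u.
Proof.
move=> pu; rewrite /L2n innerZl//; last by apply: in_LpZ; rewrite ?ler1n.
rewrite innerC innerZl// mulrA -expr2 sqrtrM ?sqr_ge0//.
by rewrite sqrtr_sqr.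
Qed.

End L2_norm.

Section H10_approx.
Context {R : realType} {d : nat}.
Implicit Types (u v w h phi : fn R d) (G : 'I_d -> fn R d).
Local Notation mu := (@cube_measure R d).

Lemma test_function0 : test_function (cst 0 : fn R d).
Proof.
have E s : iter_partial s (cst 0 : fn R d) = cst 0.
  elim: s => //= i s ->; apply/funext => x; rewrite /partial.
  by rewrite derive_cst.
split.
  move=> s; rewrite E; split; first exact: cst_continuous.
  by move=> i x; exact: derivable_cst.
by exists set0 => //; split; [exact: compact0|exact: sub0set].
Qed.

Lemma iter_partial_linear (a : R) phi psi : test_function phi -> test_function psi ->
  forall s, iter_partial s (fun x => a * phi x + psi x) =
  (fun x => a * iter_partial s phi x + iter_partial s psi x).
Proof.
move=> [t1 _] [t2 _]; elim => //= i s ->.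
apply/funext => x; rewrite /partial.
have [_ /(_ i x) d1] := t1 s; have [_ /(_ i x) d2] := t2 s.
rewrite (_ : (fun x => _) = (a \*: iter_partial s phi) + iter_partial s psi)//.
by rewrite deriveD ?deriveZ//; exact: derivableZ.
Qed.

Lemma test_function_linear (a : R) phi psi : test_function phi -> test_function psi ->
  test_function (fun x => a * phi x + psi x).
Proof.
move=> t1 t2; split.
  move=> s; rewrite iter_partial_linear//.
  have [c1 d1] := t1.1 s; have [c2 d2] := t2.1 s; split.
    by move=> x; exact: cvgD (cvgM (cvg_cst a) (c1 x)) (c2 x).
  move=> i x; rewrite (_ : (fun x => _) = (a \*: iter_partial s phi) + iter_partial s psi)//.
  by apply: derivableD; [apply: derivableZ; exact: d1|exact: d2].
have [_ [K1 [cK1 K1c] K10]] := t1; have [_ [K2 [cK2 K2c] K20]] := t2.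
exists (K1 `|` K2).
  by split; [exact: compactU|move=> x [xK|xK]; [exact: K1c|exact: K2c]].
move=> x xK; rewrite K10 ?K20 ?mulr0 ?addr0//.
- by move=> ?; apply: xK; right.
- by move=> ?; apply: xK; left.
Qed.

(** u lies in H^1_0 with gradient G, in an epsilon form that is closed under
    linear combinations and involves real norms only. *)
Definition H10_approx u G : Prop :=
  [/\ in_Lp 2 u, forall i, in_Lp 2 (G i) & forall eps : R, 0 < eps ->
    exists phi, [/\ test_function phi, in_Lp 2 phi,
      forall i, in_Lp 2 (partial i phi), L2n (phi \- u) <= eps &
      forall i, L2n (partial i phi \- G i) <= eps]].

Lemma Lp_norm2_lty u v : in_Lp 2 u -> measurable_fun setT v ->
  (Lp_norm 2 (v \- u)%R < +oo)%E -> in_Lp 2 v.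
Proof.
move=> pu mv vu.
have : in_Lp 2 (v \- u).
  rewrite /in_Lp inE; apply/andP; split; rewrite inE//=.
  by apply: measurable_funB => //; exact: in_Lp_measurable pu.
move=> /in_LpD/(_ pu); rewrite ler1n => /(_ isT).
by rewrite (_ : _ \+ _ = v)//; apply/funext => x /=; rewrite subrK.
Qed.

Lemma H10_gradient_approx u G : H10_gradient u G -> H10_approx u G.
Proof.
move=> [pu pG [phi [tphi phiu phiG]]]; split => // eps eps0.
have near_small (v : nat -> fn R d) w : in_Lp 2 w -> (forall n, measurable_fun setT (v n)) ->
    Lp_norm 2 (v n \- w) @[n --> \oo] --> 0%E ->
    \forall n \near \oo, in_Lp 2 (v n) /\ L2n (v n \- w) <= eps.
  move=> pw mv vw.
  have small : \forall n \near \oo, (Lp_norm 2 (v n \- w)%R < eps%:E)%E.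
    apply: (vw [set y | (y < eps%:E)%E]).
    rewrite nbhsE /=; exists [set y | (y < eps%:E)%E] => //.
    by split; [exact: open_ereal_lt_ereal|rewrite /= lte_fin].
  near=> n.
  have sn : (Lp_norm 2 (v n \- w)%R < eps%:E)%E by near: n.
  have pv : in_Lp 2 (v n).
    by apply: Lp_norm2_lty pw _ _ => //; apply: lt_trans sn _; rewrite ltry.
  split => //; move: sn; rewrite Lp_norm2E; first by rewrite lte_fin; exact: ltW.
  by apply: in_LpB; rewrite ?ler1n.
have mphi n : measurable_fun setT (phi n).
  by apply: continuous_measurable_rV; exact: test_function_continuous.
have mdphi i n : measurable_fun setT (partial i (phi n)).
  by apply: continuous_measurable_rV; exact: test_function_partial_continuous.
have [n [[p1 s1] H]] : exists n, (in_Lp 2 (phi n) /\ L2n (phi n \- u) <= eps) /\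
    forall i, in_Lp 2 (partial i (phi n)) /\ L2n (partial i (phi n) \- G i) <= eps.
  near \oo => n; exists n; split; near: n; first exact: near_small.
  by apply: filter_forall => i; exact: near_small.
by exists (phi n); split => // i; have [] := H i.
Unshelve. all: by end_near. Qed.

Lemma H10_approx0 : H10_approx (cst 0) (fun=> cst 0).
Proof.
split; [exact: in_Lp0|move=> _; exact: in_Lp0|] => eps eps0.
have E : L2n (cst 0 \- cst 0 : fn R d) = 0.
  rewrite /L2n (_ : _ \- _ = cst 0) ?inner0l ?sqrtr0//.
  by apply/funext => x /=; rewrite subrr.
have P i : partial i (cst 0 : fn R d) = cst 0.
  by apply/funext => x; rewrite /partial derive_cst.
exists (cst 0); split; [exact: test_function0|exact: in_Lp0| | |].
- by move=> i; rewrite P; exact: in_Lp0.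
- by rewrite E ltW.
- by move=> i; rewrite P E ltW.
Qed.

Lemma H10_approx_linear (a : R) u G v H : H10_approx u G -> H10_approx v H ->
  H10_approx (fun x => a * u x + v x) (fun i x => a * G i x + H i x).
Proof.
move=> [pu pG uG] [pv pH vH].
have plin w w' : in_Lp 2 w -> in_Lp 2 w' -> in_Lp 2 (fun x => a * w x + w' x).
  by move=> ? ?; apply: in_LpD; rewrite ?ler1n//; apply: in_LpZ; rewrite ?ler1n.
split; [exact: plin|by move=> i; exact: plin|] => eps eps0.
pose e1 := eps / 2 / (`|a| + 1).
have a1 : 0 < `|a| + 1 by rewrite ltr_wpDl.
have e10 : 0 < e1 by rewrite !divr_gt0.
have [phi [t1 p1 dp1 l1 dl1]] := uG _ e10.
have [psi [t2 p2 dp2 l2 dl2]] := vH (eps / 2) ltac:(by rewrite divr_gt0).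
have dE i : partial i (fun x => a * phi x + psi x) =
    (fun x => a * partial i phi x + partial i psi x).
  exact: (iter_partial_linear a t1 t2 [:: i]).
have key w w' z z' : in_Lp 2 w -> in_Lp 2 w' -> in_Lp 2 z -> in_Lp 2 z' ->
    L2n (w \- w') <= e1 -> L2n (z \- z') <= eps / 2 ->
    L2n ((fun x => a * w x + z x) \- (fun x => a * w' x + z' x)) <= eps.
  move=> pw pw' pz pz' le1 le2.
  have pww : in_Lp 2 (w \- w') by apply: in_LpB; rewrite ?ler1n.
  have pzz : in_Lp 2 (z \- z') by apply: in_LpB; rewrite ?ler1n.
  rewrite (_ : _ \- _ = (fun x => a * (w \- w') x) \+ (z \- z')); last first.
    by apply/funext => x /=; ring.
  apply: le_trans (L2nD _ pzz) _; first by apply: in_LpZ; rewrite ?ler1n.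
  rewrite L2nZ// [leRHS](splitr eps); apply: lerD => //.
  apply: (@le_trans _ _ ((`|a| + 1) * e1)).
    by apply: ler_pM; rewrite ?L2n_ge0// lerDl.
  by rewrite /e1 mulrC divfK// gt_eqF.
exists (fun x => a * phi x + psi x); split.
- exact: test_function_linear.
- exact: plin.
- by move=> i; rewrite dE; exact: plin.
- exact: key.
- by move=> i; rewrite dE; exact: key.
Qed.

Lemma H10_approx_sum n (a : 'I_n -> R) (u : 'I_n -> fn R d) (G : 'I_n -> 'I_d -> fn R d) :
  (forall i, H10_approx (u i) (G i)) ->
  H10_approx (fun x => \sum_(i < n) a i * u i x) (fun k x => \sum_(i < n) a i * G i k x).
Proof.
move=> uG.
suff H (r : seq 'I_n) : H10_approx (fun x => \sum_(i <- r) a i * u i x)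
    (fun k x => \sum_(i <- r) a i * G i k x) by exact: H.
elim: r => [|i r IH].
  have := H10_approx0; congr H10_approx.
    by apply/funext => x; rewrite big_nil.
  by apply/funext => k; apply/funext => x; rewrite big_nil.
have := H10_approx_linear (a i) (uG i) IH; congr H10_approx.
  by apply/funext => x; rewrite big_cons.
by apply/funext => k; apply/funext => x; rewrite big_cons.
Qed.

End H10_approx.

Section sobolev.
Context {R : realType} {d : nat}.
Hypothesis hd : d = 1%N \/ d = 2%N.
Implicit Types (u v w h phi : fn R d) (G : 'I_d -> fn R d).
Local Notation mu := (@cube_measure R d).

Lemma expr4_ge0 (x : R) : 0 <= x ^+ 4.
Proof. by rewrite (exprM _ 2 2) sqr_ge0. Qed.

Lemma le_of_le_eps (a b c : R) : (forall eps : R, 0 < eps -> eps < 1 -> a <= b + c * eps) -> a <= b.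
Proof.
move=> H; apply/ler_addgt0Pr => e e0.
have c1 : 0 < `|c| + 1 by rewrite ltr_wpDl.
pose k := Num.min (1 / 2) (e / (`|c| + 1)).
have k0 : 0 < k by rewrite lt_min !divr_gt0.
have k1 : k < 1 by rewrite gt_min; apply/orP; left; lra.
apply: le_trans (H k k0 k1) _; rewrite lerD2l.
apply: (@le_trans _ _ ((`|c| + 1) * k)).
  by rewrite ler_pM2r//; apply: le_trans (ler_norm _) _; rewrite lerDl.
by rewrite mulrC -ler_pdivlMr// ge_min lexx orbT.
Qed.

(** The fourth power is Lipschitz on [0, K], with constant 4 K^3. *)
Lemma trunc4_le (K a b : R) : 0 <= K ->
  Num.min `|a| K ^+ 4 <= b ^+ 4 + 4 * K ^+ 3 * `|a - b|.
Proof.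
move=> K0.
have H1 : `|a| <= `|b| + `|a - b| by rewrite -[in leLHS](subrK b a) addrC ler_normD.
have -> : b ^+ 4 = `|b| ^+ 4 by rewrite -(normrX 4) ger0_norm// expr4_ge0.
have [b0 d0] := (normr_ge0 b, normr_ge0 (a - b)); have a0 := normr_ge0 a.
move: `|a| `|b| `|a - b| a0 H1 b0 d0 => {a b} a b c a0 abc b0 c0.
set t := Num.min a K.
have t0 : 0 <= t by rewrite le_min a0.
have tK : t <= K by rewrite ge_min lexx orbT.
have tbc : t <= b + c by apply: le_trans abc; rewrite ge_min lexx.
have [tb|bt] := leP t b.
  apply: (@le_trans _ _ (b ^+ 4)); first by rewrite ler_pXn2r.
  by rewrite lerDl !mulr_ge0// exprn_ge0.
have E : t ^+ 4 - b ^+ 4 = (t - b) * (t ^+ 3 + t ^+ 2 * b + t * b ^+ 2 + b ^+ 3) by ring.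
rewrite addrC -lerBlDr E mulrC.
have bK : b <= K by exact: le_trans (ltW bt) tK.
have s : t ^+ 3 + t ^+ 2 * b + t * b ^+ 2 + b ^+ 3 <= 4 * K ^+ 3.
  have -> : 4 * K ^+ 3 = K ^+ 3 + K ^+ 2 * K + K * K ^+ 2 + K ^+ 3 by ring.
  apply: lerD; [apply: lerD; [apply: lerD|]|].
  - by rewrite ler_pXn2r.
  - by apply: ler_pM; rewrite ?exprn_ge0// ler_pXn2r.
  - by apply: ler_pM; rewrite ?exprn_ge0// ler_pXn2r.
  - by rewrite ler_pXn2r.
apply: ler_pM => //.
- by rewrite !addr_ge0// ?mulr_ge0// exprn_ge0.
- by rewrite subr_ge0 ltW.
- by lra.
Qed.

(** Ladyzhenskaya's inequality passes to the closure of the test functions: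
    truncation at height K makes the fourth power Lipschitz, hence continuous
    for the L^2 distance. *)
Lemma trunc4_H10_le u G (K : R) : H10_approx u G -> 0 <= K ->
  (\int[mu]_x (Num.min `|u x| K ^+ 4)%:E <=
   (4 * inner u u * \sum_i inner (G i) (G i))%:E)%E.
Proof.
move=> [pu pG uG] K0.
have pc : in_Lp 2 (cst 1 : fn R d) by exact: Lfun_cst.
pose c0 := L2n (cst 1 : fn R d).
pose S := \sum_i L2n (G i).
have bnd eps : 0 < eps -> eps < 1 ->
  (\int[mu]_x (Num.min `|u x| K ^+ 4)%:E <=
   (4 * (L2n u + eps) ^+ 2 * \sum_i (L2n (G i) + eps) ^+ 2 + 4 * K ^+ 3 * (c0 * eps))%:E)%E.
  move=> eps0 _; have [phi [tphi p dp le dle]] := uG _ eps0.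
  have mu_ := in_Lp_measurable pu; have mp := in_Lp_measurable p.
  have psub : in_Lp 2 (phi \- u) by apply: in_LpB; rewrite ?ler1n.
  have m1 : measurable_fun setT (fun x => (phi x ^+ 4)%:E).
    by apply/measurable_EFinP; exact: measurable_funX.
  have m2 : measurable_fun setT (fun x => (4 * K ^+ 3 * (1 * `|phi x - u x|))%:E).
    apply/measurable_EFinP; apply: measurable_funM => //; apply: measurable_funM => //.
    by apply: measurableT_comp => //; exact: measurable_funB.
  apply: (@le_trans _ _ (\int[mu]_x ((phi x ^+ 4)%:E +
      (4 * K ^+ 3 * (1 * `|phi x - u x|))%:E))%E).
    apply: ge0_le_integral => //.
    - by move=> x _; rewrite lee_fin expr4_ge0.
    - apply/measurable_EFinP; apply: measurable_funX.
      by apply: measurable_minr => //; exact: measurableT_comp.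
    - exact: emeasurable_funD m1 m2.
    - by move=> x _; rewrite -EFinD lee_fin mul1r distrC; exact: trunc4_le.
  have L : in_Lp 2 (fun x => `|(phi \- u) x|) by exact: in_Lp_normr.
  rewrite ge0_integralD//; last 2 first.
  - by move=> x _; rewrite lee_fin expr4_ge0.
  - by move=> x _; rewrite lee_fin !mulr_ge0// exprn_ge0.
  have -> : (\int[mu]_x (4 * K ^+ 3 * (1 * `|phi x - u x|))%:E =
      (4 * K ^+ 3 * inner (cst 1) (fun x => `|(phi \- u) x|))%:E)%E.
    rewrite EFinM -inner_EFin// -ge0_integralZl_EFin//.
    - by move=> x _; rewrite lee_fin mulr_ge0.
    - apply/measurable_EFinP; apply: measurable_funM => //.
      exact: in_Lp_measurable L.
    - by rewrite mulr_ge0// exprn_ge0.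
  rewrite EFinD; apply: leeD.
    apply: le_trans (ladyzhenskaya tphi p dp hd) _; rewrite lee_fin.
    have A v w : in_Lp 2 v -> in_Lp 2 w -> L2n (w \- v) <= eps ->
        inner w w <= (L2n v + eps) ^+ 2.
      move=> pv pw wv; rewrite -sqr_L2n ler_pXn2r// ?nnegrE ?addr_ge0 ?L2n_ge0// ?(ltW eps0)//.
      rewrite (_ : w = v \+ (w \- v)); last by apply/funext => x /=; ring.
      by apply: le_trans (L2nD _ _) _ => //; [apply: in_LpB; rewrite ?ler1n|rewrite lerD2l].
    rewrite -[leLHS]mulrA -[leRHS]mulrA ler_pM2l//; apply: ler_pM; rewrite ?inner_ge0//.
    - by apply: sumr_ge0 => i _; exact: inner_ge0.
    - exact: A pu p le.
    - by apply: ler_sum => i _; exact: A (pG i) (dp i) (dle i).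
  rewrite lee_fin; apply: ler_wpM2l; first by rewrite mulr_ge0// exprn_ge0.
  apply: le_trans (ler_norm _) _; apply: le_trans (normr_inner_le _ _) _ => //.
  rewrite ler_wpM2l ?L2n_ge0//.
  apply: le_trans le; rewrite /L2n (_ : inner _ _ = inner (phi \- u) (phi \- u))//.
  by apply: eq_Rintegral => x _; rewrite -normrM ger0_norm// -expr2 sqr_ge0.
set I := (\int[mu]_x _)%E in bnd *.
have Ifin : I = (fine I)%:E.
  rewrite fineK// ge0_fin_numE; last by apply: integral_ge0 => x _; rewrite lee_fin expr4_ge0.
  have h0 : 0 < 1 / 2 :> R by lra.
  have h1 : 1 / 2 < 1 :> R by lra.
  by apply: le_lt_trans (bnd _ h0 h1) _; rewrite ltry.
rewrite Ifin lee_fin.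
(* B collects the coefficients of eps, for eps < 1, in the expansion of the
   bound of bnd *)
pose B := 4 * (2 * L2n u + 1) * \sum_i (L2n (G i) + 1) ^+ 2
   + 4 * L2n u ^+ 2 * \sum_i (2 * L2n (G i) + 1) + 4 * K ^+ 3 * c0.
apply: (@le_of_le_eps _ _ B) => eps eps0 eps1.
have := bnd _ eps0 eps1; rewrite Ifin lee_fin => /le_trans; apply.
under [X in _ <= 4 * _ * X + _]eq_bigr do rewrite -sqr_L2n.
have sq (a : R) : 0 <= a -> (a + eps) ^+ 2 <= a ^+ 2 + (2 * a + 1) * eps.
  by move=> a0; nra.
have S1 : \sum_i (L2n (G i) + eps) ^+ 2 <=
    \sum_i L2n (G i) ^+ 2 + (\sum_i (2 * L2n (G i) + 1)) * eps.
  rewrite mulr_suml -big_split/=; apply: ler_sum => i _.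
  exact: sq (L2n_ge0 _).
have S2 : \sum_i (L2n (G i) + eps) ^+ 2 <= \sum_i (L2n (G i) + 1) ^+ 2.
  apply: ler_sum => i _; rewrite ler_pXn2r// ?nnegrE ?addr_ge0 ?L2n_ge0// ?lerD2l// ltW//.
have S0 : 0 <= \sum_i (L2n (G i) + eps) ^+ 2 by apply: sumr_ge0 => i _; exact: sqr_ge0.
have U := sq _ (L2n_ge0 u).
have u0 := L2n_ge0 u.
rewrite /B -sqr_L2n.
move: (\sum_i (L2n (G i) + eps) ^+ 2) (\sum_i (L2n (G i) + 1) ^+ 2) (\sum_i L2n (G i) ^+ 2)
  (\sum_i (2 * L2n (G i) + 1)) S0 S1 S2 => X Y Z V X0 XZ XY.
move: (L2n u) u0 U => a a0 U.
apply: (@le_trans _ _ (4 * (a ^+ 2 + (2 * a + 1) * eps) * X + 4 * K ^+ 3 * (c0 * eps))).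
  by rewrite lerD2r ler_wpM2r// ler_pM2l.
have E1 : 4 * a ^+ 2 * X <= 4 * a ^+ 2 * (Z + V * eps).
  by rewrite ler_wpM2l// mulr_ge0// sqr_ge0.
have E2 : 4 * (2 * a + 1) * eps * X <= 4 * (2 * a + 1) * eps * Y.
  by rewrite ler_wpM2l// !mulr_ge0// ?(ltW eps0)// addr_ge0// mulr_ge0.
by lra.
Qed.

(** Fatou's lemma removes the truncation. *)
Lemma H10_L4 u G : H10_approx u G -> in_Lp 4 u /\
  L4_norm u ^+ 4 <= 4 * inner u u * \sum_i inner (G i) (G i).
Proof.
move=> uG; have [pu _ _] := uG; have mu_ := in_Lp_measurable pu.
have I : (\int[mu]_x (u x ^+ 4)%:E <= (4 * inner u u * \sum_i inner (G i) (G i))%:E)%E.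
  apply: (@fatou_ae _ _ _ mu (fun n x => Num.min `|u x| n%:R ^+ 4)).
  - move=> n; apply: measurable_funX.
    by apply: measurable_minr => //; exact: measurableT_comp.
  - by move=> n x; exact: expr4_ge0.
  - apply/nearW => x.
    have -> : u x ^+ 4 = `|u x| ^+ 4 by rewrite -(normrX 4) ger0_norm// expr4_ge0.
    apply: cvg_near_cst; near=> n; rewrite min_l//.
    near: n; exact: nbhs_infty_ger.
  - by move=> x; exact: expr4_ge0.
  - by apply: nearW => n; apply: trunc4_H10_le.
have E (x : 'rV[R]_d) : `|u x| ^+ 4 = u x ^+ 4.
  by rewrite -(normrX 4) ger0_norm// expr4_ge0.
have p4 : in_Lp 4 u.
  apply/in_LpP; split => //.
  by under eq_integral do rewrite E; apply: le_lt_trans I _; rewrite ltry.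
split => //; have [-> I4] := L4_normE p4.
by rewrite -lee_fin -I4.
Unshelve. all: by end_near. Qed.

End sobolev.

(** * Finite spans of eigenfunctions *)

Section eigen.
Context {R : realType} {d : nat}.
Hypothesis hd : d = 1%N \/ d = 2%N.
Variables (lam : nat -> R) (e : nat -> fn R d).
Hypothesis hbasis : eigenbasis lam e.
Implicit Types (u v w h phi : fn R d) (G : 'I_d -> fn R d).
Local Notation mu := (@cube_measure R d).

Let pe i : in_Lp 2 (e i). Proof. exact: (eigenbasis_L2 hbasis). Qed.

Lemma eigenvalue_gt0 i : 0 < lam i.
Proof.
elim: i => [|i IH]; first exact: eigenbasis_gt0 hbasis.
exact: lt_le_trans IH (eigenbasis_le hbasis i).
Qed.

(** Green's formula, by density of the test functions. *)
Lemma eigen_green i G v H : H10_gradient (e i) G ->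
  (forall phi, test_function phi ->
    \sum_(k < d) inner (G k) (partial k phi) =
    - inner (fun x => - lam i * e i x) phi) ->
  H10_approx v H -> \sum_(k < d) inner (G k) (H k) = lam i * inner (e i) v.
Proof.
move=> eG weak [pv pH vH]; have [_ pG _] := H10_gradient_approx eG.
apply/eqP; rewrite -subr_eq0 -normr_eq0 eq_le normr_ge0 andbT.
apply: (@le_of_le_eps _ _ _ (\sum_k L2n (G k) + lam i * L2n (e i))) => eps eps0 _.
have [phi [tphi p dp le dle]] := vH _ eps0.
rewrite add0r mulrDl.
have W := weak _ tphi; rewrite innerZl// mulNr opprK in W.
have -> : \sum_(k < d) inner (G k) (H k) - lam i * inner (e i) v =
    lam i * inner (e i) (phi \- v) - \sum_(k < d) inner (G k) (partial k phi \- H k).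
  rewrite [inner (e i) (phi \- v)]innerC innerBl// !(innerC _ (e i)).
  have -> : \sum_(k < d) inner (G k) (partial k phi \- H k) =
      lam i * inner (e i) phi - \sum_(k < d) inner (G k) (H k).
    rewrite -W -sumrB; apply: eq_bigr => k _.
    by rewrite innerC innerBl// !(innerC _ (G k)).
  by ring.
apply: le_trans (ler_normB _ _) _; rewrite [leLHS]addrC.
apply: lerD.
  apply: le_trans (ler_norm_sum _ _ _) _; rewrite mulr_suml; apply: ler_sum => k _.
  apply: le_trans (normr_inner_le _ _) _ => //; first by apply: in_LpB; rewrite ?ler1n.
  by rewrite ler_wpM2l ?L2n_ge0.
have l0 := eigenvalue_gt0 i.
rewrite normrM gtr0_norm// -mulrA ler_pM2l//.
apply: le_trans (normr_inner_le _ _) _ => //; first by apply: in_LpB; rewrite ?ler1n.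
by rewrite ler_wpM2l ?L2n_ge0.
Qed.

Definition comb N (a : 'I_N -> R) : fn R d := fun x => \sum_(i < N) a i * e i x.

Lemma comb_L2 N (a : 'I_N -> R) : in_Lp 2 (comb a).
Proof. by apply: in_Lp_sum; rewrite ?ler1n. Qed.

Lemma inner_comb_e N (a : 'I_N -> R) (j : nat) :
  inner (comb a) (e j) = \sum_(i < N) a i * (i == j :> nat)%:R.
Proof.
rewrite /comb inner_suml//.
by apply: eq_bigr => i _; rewrite (eigenbasis_orthonormal hbasis).
Qed.

Lemma inner_comb_ord N (a : 'I_N -> R) (j : 'I_N) : inner (comb a) (e j) = a j.
Proof.
rewrite inner_comb_e (bigD1 j)//= eqxx mulr1 big1 ?addr0// => i ij.
by rewrite (_ : (i == j :> nat) = false) ?mulr0//; exact/negbTE.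
Qed.

Lemma inner_comb_out N (a : 'I_N -> R) j : (N <= j)%N -> inner (comb a) (e j) = 0.
Proof.
move=> Nj; rewrite inner_comb_e big1// => i _.
by rewrite ltn_eqF ?mulr0// (leq_trans (ltn_ord i)).
Qed.

Lemma inner_comb N (a b : 'I_N -> R) : inner (comb a) (comb b) = \sum_i a i * b i.
Proof.
rewrite innerC /comb inner_suml//; last exact: comb_L2.
by apply: eq_bigr => i _; rewrite innerC inner_comb_ord mulrC.
Qed.

(** The Dirichlet form of a finite combination is diagonal by Green's formula,
    so Ladyzhenskaya's inequality controls its L^4 norm by its coordinates
    alone, whatever the number of modes. *)
Lemma comb_L4 N (a : 'I_N -> R) : in_Lp 4 (comb a) /\
  L4_norm (comb a) ^+ 4 <= 4 * (\sum_i a i ^+ 2) * \sum_(i < N) lam i * a i ^+ 2.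
Proof.
have ex (i : 'I_N) : exists G, H10_gradient (e i) G /\
    (forall phi, test_function phi -> \sum_(k < d) inner (G k) (partial k phi) =
      - inner (fun x => - lam i * e i x) phi).
  by have [_ [G G1 G2]] := eigenbasis_eq hbasis i; exists G.
have [G GP] := choice ex.
have A (i : 'I_N) : H10_approx (e i) (G i) by apply: H10_gradient_approx; have [] := GP i.
have pG i k : in_Lp 2 (G i k) by have [_] := A i.
have S := H10_approx_sum a A.
have [p4 bnd] := H10_L4 hd S; split => //.
apply: le_trans bnd _; rewrite -/(comb a) inner_comb.
under [X in 4 * X * _ <= _]eq_bigr do rewrite -expr2.
rewrite le_eqVlt; apply/orP; left; apply/eqP; congr (_ * _).
transitivity (\sum_(k < d) \sum_(i < N) a i * inner (G i k) (fun x => \sum_(j < N) a j * G j k x)).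
  by apply: eq_bigr => k _; rewrite inner_suml//; apply: in_Lp_sum; rewrite ?ler1n.
rewrite exchange_big/=; apply: eq_bigr => i _.
rewrite -mulr_sumr (eigen_green (GP i).1 (GP i).2 S) -/(comb a) innerC inner_comb_ord.
by ring.
Qed.

Lemma eigen_in_L4 i : in_Lp 4 (e i).
Proof.
have [p4 _] := comb_L4 (fun j : 'I_i.+1 => (j == ord_max)%:R : R).
rewrite (_ : e i = comb (fun j : 'I_i.+1 => (j == ord_max)%:R))//.
apply/funext => x; rewrite /comb (bigD1 ord_max)//= eqxx mul1r big1 ?addr0//.
by move=> j /negbTE ->; rewrite mul0r.
Qed.

Lemma hdot1_comb N (a : 'I_N -> R) :
  hdot_sqnorm lam e 1 (comb a) = (\sum_(i < N) lam i * a i ^+ 2)%:E.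
Proof.
rewrite /hdot_sqnorm (nneseries_split 0 N)//; last first.
  by move=> k _; rewrite lee_fin mulr_ge0 ?powR_ge0 ?sqr_ge0.
rewrite eseries0 ?adde0; last first.
  by move=> k Nk _; rewrite inner_comb_out ?expr0n ?mulr0//.
rewrite add0n big_mkord sumEFin; congr EFin; apply: eq_bigr => i _.
by rewrite powRr1 ?(ltW (eigenvalue_gt0 i))// inner_comb_ord.
Qed.

End eigen.

(** * The potential along curves of finite combinations *)

Lemma cvg_bigsum {R : realType} {T I : Type} (F : set_system T) {FF : Filter F}
    (r : seq I) (f : I -> T -> R) (l : I -> R) :
  (forall i, f i x @[x --> F] --> l i) ->
  \sum_(i <- r) f i x @[x --> F] --> \sum_(i <- r) l i.
Proof.
move=> fl; elim: r => [|i r IH].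
  rewrite big_nil (_ : (fun x => _) = cst 0); first exact: cvg_cst.
  by apply/funext => x; rewrite big_nil.
rewrite big_cons (_ : (fun x => _) = (fun x => f i x + \sum_(j <- r) f j x)).
  exact: cvgD (fl i) IH.
by apply/funext => x; rewrite big_cons.
Qed.

Lemma cvg_is_derive {R : realType} (f : R -> R) (t l : R) :
  h^-1 * (f (h + t) - f t) @[h --> 0^'] --> l -> is_derive t 1 f l.
Proof.
move=> fl.
have E : (fun h => h^-1 *: ((f \o shift t) (h *: 1) - f t)) =
    (fun h : R => h^-1 * (f (h + t) - f t)).
  by apply/funext => h /=; rewrite [h%:A]mulr1.
split; first by rewrite /derivable E; apply/cvg_ex; exists l.
by rewrite /derive E; exact/cvg_lim.
Qed.

Lemma is_derive_cvg {R : realType} (f : R -> R) (t l : R) :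
  is_derive t 1 f l -> h^-1 * (f (h + t) - f t) @[h --> 0^'] --> l.
Proof.
move=> [df <-]; rewrite /derive.
have E : (fun h => h^-1 *: ((f \o shift t) (h *: 1) - f t)) =
    (fun h : R => h^-1 * (f (h + t) - f t)).
  by apply/funext => h /=; rewrite [h%:A]mulr1.
by move: df; rewrite /derivable E.
Qed.

Lemma is_derive_continuous {R : realType} (f : R -> R) (t l : R) :
  is_derive t 1 f l -> {for t, continuous f}.
Proof. by move=> [df _]; apply/differentiable_continuous/derivable1_diffP. Qed.

Section L4.
Context {R : realType} {d : nat}.
Implicit Types (u v w h : fn R d).
Local Notation mu := (@cube_measure R d).

Let le14 : 1 <= 4 :> R. Proof. by rewrite ler1n. Qed.
Let le14e : (1 <= (4 : R)%:E)%E. Proof. by rewrite lee_fin. Qed.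

Lemma L4_norm_ge0 u : 0 <= L4_norm u.
Proof. by rewrite /L4_norm fine_ge0// Lnorm_ge0. Qed.

Lemma L4_normZ (a : R) u : in_Lp 4 u -> L4_norm (fun x => a * u x) = `|a| * L4_norm u.
Proof.
move=> pu; rewrite /L4_norm /Lp_norm.
have := LnormZ (Lfun_Sub le14e pu) a.
rewrite (_ : EFin \o (a \*: _) = EFin \o (fun x => a * u x))// => ->.
rewrite fineM//= -(finite_norm_fine (Lfun_Sub le14e pu)).
exact: fin_numE.
Qed.

Lemma L4_normD u v : in_Lp 4 u -> in_Lp 4 v ->
  L4_norm (u \+ v) <= L4_norm u + L4_norm v.
Proof.
move=> pu pv; exact: (ler_LnormD (Lfun_Sub le14e pu) (Lfun_Sub le14e pv)).
Qed.

Lemma L4_norm_sum I (r : seq I) (a : I -> R) (u : I -> fn R d) :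
  (forall i, in_Lp 4 (u i)) ->
  L4_norm (fun x => \sum_(i <- r) a i * u i x) <= \sum_(i <- r) `|a i| * L4_norm (u i).
Proof.
move=> pu; elim: r => [|i r IH].
  rewrite big_nil (_ : (fun x => _) = (fun x => 0 * cst 0 x)).
    by rewrite L4_normZ ?normr0 ?mul0r//; exact: in_Lp0.
  by apply/funext => x; rewrite big_nil mul0r.
rewrite big_cons (_ : (fun x => _) =
    (fun x => a i * u i x) \+ (fun x => \sum_(j <- r) a j * u j x)).
  apply: le_trans (L4_normD _ _) _; [exact: in_LpZ|exact: in_Lp_sum|].
  by rewrite L4_normZ// lerD2l.
by apply/funext => x; rewrite big_cons.
Qed.

(** The cubic nonlinearity tested against a function is a combination of values
    of this form at u and 1; multilinearity reduces its continuity in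
    finite-dimensional spaces to that of the coordinates. *)
Definition T4 u v w h : R := \int[mu]_x (u x * v x * w x * h x).

Lemma mul4_integrable u v w h : in_Lp 4 u -> in_Lp 4 v -> in_Lp 4 w -> in_Lp 4 h ->
  mu.-integrable setT (EFin \o (fun x => u x * v x * w x * h x)).
Proof.
move=> pu pv pw ph.
have I z : in_Lp 4 z -> mu.-integrable setT (fun x => (z x ^+ 4)%:E).
  move=> pz; have := in_Lp_integrable pz; congr (integrable _ _ _).
  by apply/funext => x; rewrite -(normrX 4) ger0_norm// expr4_ge0.
have m z : in_Lp 4 z -> measurable_fun setT z by exact: in_Lp_measurable.
apply: (@le_integrable _ _ _ mu setT measurableT _
  (fun x => (u x ^+ 4)%:E + (v x ^+ 4)%:E + (w x ^+ 4)%:E + (h x ^+ 4)%:E)%E).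
- apply/measurable_EFinP; apply: measurable_funM; last exact: m.
  by apply: measurable_funM; last exact: m; apply: measurable_funM; exact: m.
- move=> x _; rewrite /= !normrM lee_fin.
  rewrite [leRHS]ger0_norm; last by rewrite !addr_ge0// expr4_ge0.
  have e4 z : z ^+ 4 = `|z| ^+ 4 :> R by rewrite -(normrX 4) ger0_norm// expr4_ge0.
  rewrite (e4 (u x)) (e4 (v x)) (e4 (w x)) (e4 (h x)).
  move: `|u x| `|v x| `|w x| `|h x| => a b c k.
  have := sqr_ge0 (a * b - c * k); have := sqr_ge0 (a ^+ 2 - b ^+ 2).
  have := sqr_ge0 (c ^+ 2 - k ^+ 2).
  have := expr4_ge0 a; have := expr4_ge0 b; have := expr4_ge0 c; have := expr4_ge0 k.
  by nra.
- by apply: integrableD => //; [apply: integrableD => //; [apply: integrableD => //|]|]; exact: I.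
Qed.

Lemma T4_suml I (r : seq I) (a : I -> R) (u : I -> fn R d) v w h :
  (forall i, in_Lp 4 (u i)) -> in_Lp 4 v -> in_Lp 4 w -> in_Lp 4 h ->
  T4 (fun x => \sum_(i <- r) a i * u i x) v w h = \sum_(i <- r) a i * T4 (u i) v w h.
Proof.
move=> pu pv pw ph; elim: r => [|i r IH].
  rewrite big_nil /T4 (@eq_Rintegral _ _ _ mu setT (cst 0)).
    by rewrite Rintegral_cst// mul0r.
  by move=> x _; rewrite big_nil !mul0r.
rewrite big_cons -IH /T4 -RintegralZl//; last exact: mul4_integrable.
rewrite -RintegralD//.
- by apply: eq_Rintegral => x _; rewrite big_cons; ring.
- have := mul4_integrable (in_LpZ (a i) le14 (pu i)) pv pw ph.
  congr (integrable _ _ _); apply/funext => x /=; congr EFin; ring.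
- by apply: mul4_integrable => //; exact: in_Lp_sum.
Qed.

Lemma T4_perm u v w h : T4 u v w h = T4 v w u h.
Proof. by apply: eq_Rintegral => x _; ring. Qed.

Lemma cvg_T4_suml {T : Type} {FF : set_system T} {fF : Filter FF} N
    (a : 'I_N -> T -> R) (l : 'I_N -> R) (u : 'I_N -> fn R d) (v w : T -> fn R d) v' w' h :
  (forall i, in_Lp 4 (u i)) -> (forall t, in_Lp 4 (v t)) -> (forall t, in_Lp 4 (w t)) ->
  in_Lp 4 v' -> in_Lp 4 w' -> in_Lp 4 h ->
  (forall i, a i t @[t --> FF] --> l i) ->
  (forall i, T4 (u i) (v t) (w t) h @[t --> FF] --> T4 (u i) v' w' h) ->
  T4 (fun x => \sum_(i < N) a i t * u i x) (v t) (w t) h @[t --> FF] -->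
  T4 (fun x => \sum_(i < N) l i * u i x) v' w' h.
Proof.
move=> pu pv pw pv' pw' ph al Tl; rewrite T4_suml//.
rewrite (_ : (fun t => _) = (fun t => \sum_(i < N) a i t * T4 (u i) (v t) (w t) h)).
  by apply: cvg_bigsum => i; apply: cvgM; [exact: al|exact: Tl].
by apply/funext => t; rewrite T4_suml.
Qed.

End L4.

Section cubic.
Context {R : realType} {d : nat}.
Variables (c0 c1 c2 c3 : R) (f : R -> R).
Hypothesis hf : f = fun x => c3 * x ^+ 3 + c2 * x ^+ 2 + c1 * x + c0.
Implicit Types (u v w h : fn R d).
Local Notation mu := (@cube_measure R d).

Let le14 : 1 <= 4 :> R. Proof. by rewrite ler1n. Qed.
Let one4 : in_Lp 4 (cst 1 : fn R d). Proof. exact: Lfun_cst. Qed.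

Lemma cubic_mul_integrable u h : in_Lp 4 u -> in_Lp 4 h ->
  mu.-integrable setT (EFin \o (fun x => f (u x) * h x)).
Proof.
move=> pu ph.
have I3 := integrableZl measurableT c3 (mul4_integrable pu pu pu ph).
have I2 := integrableZl measurableT c2 (mul4_integrable pu pu one4 ph).
have I1 := integrableZl measurableT c1 (mul4_integrable pu one4 one4 ph).
have I0 := integrableZl measurableT c0 (mul4_integrable one4 one4 one4 ph).
have := integrableD measurableT (integrableD measurableT (integrableD measurableT I3 I2) I1) I0.
congr (integrable _ _ _); apply/funext => x; rewrite hf /=; congr EFin.
by ring.
Qed.

Lemma inner_cubicE u h : in_Lp 4 u -> in_Lp 4 h ->
  inner (f \o u) h = c3 * T4 u u u h + c2 * T4 u u (cst 1) h +
    c1 * T4 u (cst 1) (cst 1) h + c0 * T4 (cst 1) (cst 1) (cst 1) h.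
Proof.
move=> pu ph; rewrite /T4.
have m4 := @mul4_integrable R d.
have zint (c : R) u1 u2 u3 : in_Lp 4 u1 -> in_Lp 4 u2 -> in_Lp 4 u3 ->
    mu.-integrable setT (EFin \o (fun x => c * (u1 x * u2 x * u3 x * h x))).
  move=> p1 p2 p3; have := integrableZl measurableT c (m4 _ _ _ _ p1 p2 p3 ph).
  by congr (integrable _ _ _); apply/funext => x.
have addint (g1 g2 : fn R d) : mu.-integrable setT (EFin \o g1) ->
    mu.-integrable setT (EFin \o g2) -> mu.-integrable setT (EFin \o (fun x => g1 x + g2 x)).
  by move=> i1 i2; have := integrableD measurableT i1 i2.
have i3 := zint c3 _ _ _ pu pu pu; have i2 := zint c2 _ _ _ pu pu one4.
have i1 := zint c1 _ _ _ pu one4 one4; have i0 := zint c0 _ _ _ one4 one4 one4.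
have i32 := addint _ _ i3 i2; have i321 := addint _ _ i32 i1.
rewrite -!RintegralZl//; try exact: m4.
rewrite -(RintegralD measurableT i3 i2) -(RintegralD measurableT i32 i1).
rewrite -(RintegralD measurableT i321 i0).
by apply: eq_Rintegral => x _; rewrite /= hf; ring.
Qed.

Lemma inner_cubic_sum u I (r : seq I) (b : I -> R) (h : I -> fn R d) :
  in_Lp 4 u -> (forall i, in_Lp 4 (h i)) ->
  inner (f \o u) (fun x => \sum_(i <- r) b i * h i x) =
  \sum_(i <- r) b i * inner (f \o u) (h i).
Proof.
move=> pu ph; elim: r => [|i r IH].
  rewrite big_nil -[RHS](inner0l (f \o u)) innerC; congr inner.
  by apply/funext => x; rewrite big_nil.
rewrite big_cons -IH /inner -RintegralZl//; last exact: cubic_mul_integrable.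
rewrite -RintegralD//.
- by apply: eq_Rintegral => x _; rewrite big_cons; ring.
- have := cubic_mul_integrable pu (in_LpZ (b i) le14 (ph i)).
  by congr (integrable _ _ _); apply/funext => x /=; congr EFin; ring.
- by apply: cubic_mul_integrable => //; apply: in_Lp_sum; rewrite ?ler1n.
Qed.

Lemma cvg_inner_cubic {T : Type} {FF : set_system T} {fF : Filter FF} N
    (a : 'I_N -> T -> R) (l : 'I_N -> R) (e : 'I_N -> fn R d) h :
  (forall i, in_Lp 4 (e i)) -> in_Lp 4 h ->
  (forall i, a i t @[t --> FF] --> l i) ->
  inner (f \o (fun x => \sum_(i < N) a i t * e i x)) h @[t --> FF] -->
  inner (f \o (fun x => \sum_(i < N) l i * e i x)) h.
Proof.
move=> pe ph al.
have pS (b : 'I_N -> R) : in_Lp 4 (fun x => \sum_(i < N) b i * e i x).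
  by apply: in_Lp_sum; rewrite ?ler1n.
rewrite inner_cubicE//.
rewrite (_ : (fun t => _) = (fun t => let u := (fun x => \sum_(i < N) a i t * e i x) in
    c3 * T4 u u u h + c2 * T4 u u (cst 1) h +
    c1 * T4 u (cst 1) (cst 1) h + c0 * T4 (cst 1) (cst 1) (cst 1) h)); last first.
  by apply/funext => t; rewrite inner_cubicE.
have C1 v w k : in_Lp 4 v -> in_Lp 4 w -> in_Lp 4 k ->
    T4 (fun x => \sum_(i < N) a i t * e i x) v w k @[t --> FF] -->
    T4 (fun x => \sum_(i < N) l i * e i x) v w k.
  by move=> pv pw pk; apply: cvg_T4_suml => // i; exact: cvg_cst.
have C2 w k : in_Lp 4 w -> in_Lp 4 k ->
    (let u t := fun x => \sum_(i < N) a i t * e i x in T4 (u t) (u t) w k @[t --> FF]) -->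
    (let u := fun x => \sum_(i < N) l i * e i x in T4 u u w k).
  move=> pw pk; apply: cvg_T4_suml => // i.
  rewrite (T4_perm (e i)) (_ : (fun t => _) =
     (fun t => T4 (fun x => \sum_(i < N) a i t * e i x) w (e i) k)).
    exact: C1.
  by apply/funext => t; rewrite T4_perm.
have C3 : (let u t := fun x => \sum_(i < N) a i t * e i x in
      T4 (u t) (u t) (u t) h @[t --> FF]) -->
    (let u := fun x => \sum_(i < N) l i * e i x in T4 u u u h).
  apply: cvg_T4_suml => // i.
  rewrite (T4_perm (e i)) (_ : (fun t => _) =
     (fun t => let u := (fun x => \sum_(i < N) a i t * e i x) in T4 u u (e i) h)).
    exact: C2.
  by apply/funext => t; rewrite T4_perm.
apply: cvgD; last exact: cvg_cst.
apply: cvgD; last by apply: cvgM; [exact: cvg_cst|exact: C1].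
apply: cvgD; first by apply: cvgM; [exact: cvg_cst|exact: C3].
by apply: cvgM; [exact: cvg_cst|exact: C2].
Qed.

End cubic.

Section potential.
Context {R : realType} {d : nat}.
Variables (c0 c1 c2 c3 : R) (f : R -> R).
Hypothesis hf : f = fun x => c3 * x ^+ 3 + c2 * x ^+ 2 + c1 * x + c0.
Variable F : fn R d -> R.
Hypothesis hF : potential f F.
Implicit Types (u v w : fn R d).
Local Notation mu := (@cube_measure R d).

Let le14 : 1 <= 4 :> R. Proof. by rewrite ler1n. Qed.

Lemma measurable_cubic u : measurable_fun setT u -> measurable_fun setT (f \o u).
Proof.
move=> mu_; rewrite hf (_ : _ \o u = (fun x => c3 * u x ^+ 3 + c2 * u x ^+ 2 + c1 * u x + c0))//.
apply: measurable_funD => //; apply: measurable_funD; last exact: measurable_funM.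
by apply: measurable_funD; apply: measurable_funM => //; exact: measurable_funX.
Qed.

(** F only depends on the class of u: differentiability at u bounds the change of
    F along w by a multiple of the norm of w, which is 0 when w is negligible. *)
Lemma potential_eq_L u u' : in_Lp 4 u -> in_Lp 4 u' -> eq_L u u' -> F u = F u'.
Proof.
move=> pu pu' uu'.
have mu_ := in_Lp_measurable pu; have mu' := in_Lp_measurable pu'.
pose w := u' \- u.
have pw : in_Lp 4 w by exact: in_LpB.
have w0 : eq_L w (cst 0) by apply: filterS uu' => x; rewrite /w /= => ->; rewrite subrr.
have wn : L4_norm w = 0.
  suff /eqP : L4_norm w ^+ 4 = 0 by rewrite expf_eq0 => /andP[_ /eqP].
  have [-> _] := L4_normE pw.
  rewrite (@ae_Rintegral _ _ _ (cst 0)) ?Rintegral_cst ?mul0r//.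
  - by apply: measurable_funX; exact: in_Lp_measurable pw.
  - by apply: filterS w0 => x ->; rewrite expr0n.
have iw : inner (f \o u) w = 0.
  rewrite /inner (@ae_Rintegral _ _ _ (cst 0)) ?Rintegral_cst ?mul0r//.
  - apply: measurable_funM; first exact: measurable_cubic.
    exact: in_Lp_measurable pw.
  - by apply: filterS w0 => x ->; rewrite mulr0.
have [del del0 /(_ w pw)] := hF pu ltr01.
rewrite wn => /(_ del0); rewrite iw mulr0 subr0 normr_le0 subr_eq0 => /eqP <-.
by congr F; apply/funext => x /=; rewrite /w /=; ring.
Qed.

(** The chain rule: the L^4 norm of a small displacement is of the order of the
    time step, so that the Frechet remainder of F is negligible. *)
Lemma potential_is_derive N (e : 'I_N -> fn R d) (a : 'I_N -> R -> R) (b : 'I_N -> R) (t : R) :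
  (forall i, in_Lp 4 (e i)) -> (forall i, is_derive t 1 (a i) (b i)) ->
  is_derive t 1 (fun s => F (fun x => \sum_(i < N) a i s * e i x))
    (\sum_(i < N) inner (f \o (fun x => \sum_(j < N) a j t * e j x)) (e i) * b i).
Proof.
move=> pe da; apply: cvg_is_derive.
pose u s : fn R d := fun x => \sum_(i < N) a i s * e i x.
have pu s : in_Lp 4 (u s) by exact: in_Lp_sum.
pose g i := inner (f \o u t) (e i).
pose q i (h : R) := h^-1 * (a i (h + t) - a i t).
have qb i : q i h @[h --> 0^'] --> b i by exact: is_derive_cvg.
pose w (h : R) : fn R d := fun x => \sum_(i < N) (a i (h + t) - a i t) * e i x.
have pw h : in_Lp 4 (w h) by exact: in_Lp_sum.
have uw h : u (h + t) = u t \+ w h.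
  by apply/funext => x; rewrite /= -big_split/=; apply: eq_bigr => i _; ring.
pose r (h : R) := F (u (h + t)) - F (u t) - inner (f \o u t) (w h).
have E : (fun h => h^-1 * (F (u (h + t)) - F (u t))) =
    (fun h => h^-1 * r h + \sum_(i < N) g i * q i h).
  apply/funext => h.
  have -> : r h = F (u (h + t)) - F (u t) - \sum_(i < N) (a i (h + t) - a i t) * g i.
    by rewrite /r /w (inner_cubic_sum hf).
  move: (F _ - F _) => D; rewrite mulrBr mulr_sumr.
  rewrite [X in _ + X](_ : _ = \sum_(i < N) h^-1 * ((a i (h + t) - a i t) * g i)).
    by rewrite subrK.
  by apply: eq_bigr => i _; rewrite /q; ring.
rewrite E -[X in _ --> X]add0r; apply: cvgD; last first.
  by apply: cvg_bigsum => i; apply: cvgM; [exact: cvg_cst|exact: qb].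
pose B := \sum_(i < N) (`|b i| + 1) * L4_norm (e i).
have B0 : 0 <= B by apply: sumr_ge0 => i _; rewrite mulr_ge0 ?L4_norm_ge0// addr_ge0.
apply/cvgr0Pnorm_le => eps eps0.
have eB0 : 0 < eps / (B + 1) by rewrite divr_gt0// ltr_wpDl.
have [del del0 rdel] := hF (pu t) eB0.
have wB : \forall h \near (0 : R)^', L4_norm (w h) <= `|h| * B.
  have qB : \forall h \near 0^', forall i, `|q i h| <= `|b i| + 1.
    apply: filter_forall => i.
    have : `|q i h| @[h --> 0^'] --> `|b i| by exact: cvg_norm.
    by move/cvgr_le; apply; rewrite ltrDl.
  near=> h.
  have h0 : h != 0 by near: h; exact: nbhs_dnbhs_neq.
  have qh : forall i, `|q i h| <= `|b i| + 1 by near: h.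
  apply: le_trans (L4_norm_sum _ _ pe) _; rewrite mulr_sumr; apply: ler_sum => i _.
  have -> : a i (h + t) - a i t = h * q i h by rewrite /q mulVKf.
  by rewrite normrM -mulrA ler_wpM2l// ler_wpM2r// L4_norm_ge0.
have hdel : \forall h \near (0 : R)^', `|h| * B < del.
  have : `|h| * B @[h --> (0 : R)^'] --> `|0 : R| * B.
    have n0 : `|h| @[h --> (0 : R)^'] --> `|0 : R|.
      by apply: (@cvg_norm _ R _ _ _ id); exact: cvg_within.
    exact: cvgM n0 (cvg_cst B).
  by rewrite normr0 mul0r => /cvgr_lt /(_ _ del0).
near=> h.
have h0 : h != 0 by near: h; exact: nbhs_dnbhs_neq.
have wh : L4_norm (w h) <= `|h| * B by near: h.
have rh : `|r h| <= eps / (B + 1) * L4_norm (w h).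
  rewrite /r uw; apply: rdel => //; apply: le_lt_trans wh _; near: h; exact: hdel.
have hp : 0 < `|h| by rewrite normr_gt0.
rewrite normrM normfV ler_pdivrMl//.
apply: le_trans rh _; apply: le_trans (ler_wpM2l (ltW eB0) wh) _.
rewrite mulrCA ler_pM2l// -mulrA ger_pMr//.
by rewrite mulrC ler_pdivrMr ?mul1r ?lerDl// ltr_wpDl.
Unshelve. all: by end_near. Qed.

End potential.

(** * Pathwise calculus *)

Section real_analysis.
Context {R : realType}.
Implicit Types (f g b : R -> R) (s t : R).

(** Heine's theorem; only x has to lie in the segment. *)
Lemma continuous_segment_unif f (s eps : R) : continuous f -> 0 < eps ->
  \forall del \near (0 : R)^'+,
    forall x y, 0 <= x <= s -> `|x - y| < del -> `|f x - f y| < eps.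
Proof.
move=> cf eps0.
have /compact_near_coveringP := @segment_compact R 0 s.
move=> /(_ R (0 : R)^'+ (fun del x => forall y, `|x - y| < del -> `|f x - f y| < eps) _).
case.
  move=> x _; have : \forall y \near x, `|f x - f y| < eps / 2.
    by move/cvgrPdist_lt : (cf x); apply; rewrite divr_gt0.
  move=> /nbhs_ballP[eta /= eta0 xeta].
  exists (ball x (eta / 2), [set del | del < eta / 2]) => /=.
    split; first by apply: nbhsx_ballx; rewrite divr_gt0.
    by apply: nbhs_right_lt; rewrite divr_gt0.
  move=> [x' del] /= [xx' deleta] y x'y.
  have h1 : `|f x - f x'| < eps / 2.
    by apply: xeta; apply: le_ball xx'; lra.
  have h2 : `|f x - f y| < eps / 2.
    apply: xeta; rewrite /ball/= in xx' *.
    rewrite -(subrKA x') (le_lt_trans (ler_normD _ _))//; lra.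
  rewrite -(subrKA (f x)) (le_lt_trans (ler_normD _ _))// [eps]splitr ltrD//.
  by rewrite distrC.
move=> del /= del0 H; exists del => // del' /= dd' d'0 x y xs.
by apply: H => //=; rewrite in_itv.
Qed.

Lemma integrable_continuous_itv f (a b : R) : continuous f ->
  lebesgue_measure.-integrable `[a, b] (EFin \o f).
Proof.
move=> cf; apply: continuous_compact_integrable; first exact: segment_compact.
exact: continuous_subspaceT.
Qed.

(** The primitive is based at -1 so that it is differentiable at 0 too. *)
Lemma primitive_continuous f : continuous f -> exists G : R -> R,
  [/\ G 0 = 0, forall t, -1 < t -> is_derive t 1 G (f t) &
   forall t, 0 <= t -> \int[lebesgue_measure]_(r in `[0, t]) f r = G t].
Proof.
move=> cf.
pose I (t : R) := \int[lebesgue_measure]_(r in `[-1, t]) f r.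
exists (fun t => I t - I 0); split; first by rewrite subrr.
  move=> t t1.
  have tt1 : t < t + 1 by rewrite ltrDl.
  have [dI I'] := @continuous_FTC1_closed R f (-1) t (t + 1) tt1
    (integrable_continuous_itv _ _ cf) t1 (cf t).
  have dI' : is_derive t 1 I (f t).
    by apply: DeriveDef; [exact: dI|rewrite -derive1E; exact: I'].
  by apply: is_derive_eq; rewrite subr0.
move=> t t0; apply/esym.
rewrite /I Rintegral_itvB//; last 2 first.
- exact: integrable_continuous_itv.
- by rewrite bnd_simp; lra.
- by rewrite Rintegral_itv_obnd_cbnd//; apply: integrableS (integrable_continuous_itv _ _ cf) => //;
   apply: subset_itvr; rewrite bnd_simp.
Qed.

(** On a mesh interval ending at t', the function B - sum_i b_i(t') w_i has
    derivative sum_i (b_i(t) - b_i(t')) a_i(t), so the mean value theorem bounds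
    the error by the oscillation of b, which is uniformly small. *)
Lemma riemann_stieltjes N (b w a : 'I_N -> R -> R) (B : R -> R) (s A : R) :
  0 <= s -> (forall i, continuous (b i)) ->
  (forall i t, 0 <= t <= s -> is_derive t 1 (w i) (a i t)) ->
  (forall t, 0 <= t <= s -> is_derive t 1 B (\sum_(i < N) b i t * a i t)) ->
  (forall i t, 0 <= t <= s -> `|a i t| <= A) ->
  forall eps : R, 0 < eps -> exists n0 : nat, forall n k, (n0 <= n)%N -> (k <= n)%N ->
  `|B (s * k%:R / n%:R) - B 0 - \sum_(j < k) \sum_(i < N) b i (s * j.+1%:R / n%:R) *
     (w i (s * j.+1%:R / n%:R) - w i (s * j%:R / n%:R))| <= eps.
Proof.
move=> s0 cb dw dB aA eps eps0.
pose c := N%:R * `|A| * s.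
have c0 : 0 <= c by rewrite !mulr_ge0.
have eta0 : 0 < eps / (c + 1) by rewrite divr_gt0// ltr_wpDl.
have [del [del0 unif]] : exists del : R, 0 < del /\ forall i, forall x y, 0 <= x <= s ->
    `|x - y| < del -> `|b i x - b i y| < eps / (c + 1).
  have H : \forall del \near (0 : R)^'+, forall i, forall x y, 0 <= x <= s ->
    `|x - y| < del -> `|b i x - b i y| < eps / (c + 1).
    by apply: filter_forall => i; exact: continuous_segment_unif.
  by near ((0 : R)^'+) => del; exists del; split; near: del => //; exact: nbhs_right_gt.
exists (Num.truncn (s / del)).+1 => n k nn0.
have n0 : (0 < n)%N by exact: leq_trans nn0.
have nR0 : 0 < n%:R :> R by rewrite ltr0n.
have hdel : s / n%:R < del.
  rewrite ltr_pdivrMr// mulrC -ltr_pdivrMr//.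
  by apply: lt_le_trans (truncnS_gt _) _; rewrite ler_nat.
pose tau (k : nat) := s * k%:R / n%:R.
rewrite -/(tau k).
have tau0 : tau 0%N = 0 by rewrite /tau mulr0 mul0r.
have tauS j : tau j.+1 = tau j + s / n%:R by rewrite /tau -natr1; ring.
have h0 : 0 <= s / n%:R by rewrite divr_ge0.
have tau_ge0 j : 0 <= tau j by rewrite /tau !mulr_ge0// invr_ge0 ltW.
have taus j : (j <= n)%N -> tau j <= s.
  by move=> jn; rewrite /tau ler_pdivrMr// ler_wpM2l// ler_nat.
have step j : (j < n)%N -> `|B (tau j.+1) - B (tau j) - \sum_(i < N) b i (tau j.+1) *
     (w i (tau j.+1) - w i (tau j))| <= N%:R * (eps / (c + 1)) * `|A| * (s / n%:R).
  move=> jn.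
  (* the error over the mesh interval is the increment of D *)
  pose D t := B t - \sum_(i < N) b i (tau j.+1) * w i t.
  pose D' t := \sum_(i < N) b i t * a i t - \sum_(i < N) b i (tau j.+1) * a i t.
  have in_s t : t \in `[tau j, tau j.+1] -> 0 <= t <= s.
    rewrite in_itv/= => /andP[t1 t2]; apply/andP; split; first exact: le_trans t1.
    exact: le_trans t2 (taus _ jn).
  have dD t : t \in `[tau j, tau j.+1] -> is_derive t 1 D (D' t).
    move=> /in_s ts; have dBt := dB t ts.
    have dS : is_derive t 1 (fun t => \sum_(i < N) b i (tau j.+1) * w i t)
        (\sum_(i < N) b i (tau j.+1) * a i t).
      apply: cvg_is_derive.
      rewrite (_ : (fun h => _) = (fun h => \sum_(i < N) b i (tau j.+1) *
          (h^-1 * (w i (h + t) - w i t)))); last first.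
        apply/funext => h; rewrite -sumrB mulr_sumr; apply: eq_bigr => i _; ring.
      by apply: cvg_bigsum => i; apply: cvgM; [exact: cvg_cst|apply: is_derive_cvg; exact: dw].
    exact: is_deriveB.
  have tjS : tau j <= tau j.+1 by rewrite tauS lerDl.
  have dDo t : t \in `]tau j, tau j.+1[ -> is_derive t 1 D (D' t).
    by move=> tj; apply: dD; exact: subset_itv_oo_cc tj.
  have cD : {within `[tau j, tau j.+1], continuous D}.
    by apply: derivable_within_continuous => t tj; have [] := dD t tj.
  have [x xj E] := MVT_segment tjS dDo cD.
  rewrite (_ : _ - _ - _ = D (tau j.+1) - D (tau j)); last first.
    rewrite /D (eq_bigr (fun i => b i (tau j.+1) * w i (tau j.+1) -
      b i (tau j.+1) * w i (tau j))); last by move=> i _; rewrite mulrBr.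
    by rewrite sumrB; ring.
  rewrite E normrM (_ : tau j.+1 - tau j = s / n%:R); last by rewrite tauS; ring.
  rewrite (ger0_norm h0) ler_wpM2r//.
  rewrite /D' -sumrB; apply: le_trans (ler_norm_sum _ _ _) _.
  apply: (@le_trans _ _ (\sum_(i < N) (eps / (c + 1) * `|A|))).
    apply: ler_sum => i _; rewrite -mulrBl normrM; apply: ler_pM => //.
      apply/ltW/unif; first exact: in_s.
      move: xj; rewrite in_itv/= tauS => /andP[x1 x2].
      by rewrite ler0_norm ?subr_le0//; apply: le_lt_trans hdel; lra.
    by apply: le_trans (aA i x (in_s _ xj)) (ler_norm _).
  by rewrite sumr_const card_ord -[leLHS]mulr_natl [leLHS]mulrA.
have tot : (k <= n)%N -> `|B (tau k) - B 0 - \sum_(j < k) \sum_(i < N) b i (tau j.+1) *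
     (w i (tau j.+1) - w i (tau j))| <= k%:R * (N%:R * (eps / (c + 1)) * `|A| * (s / n%:R)).
  elim: k => [_|k IH kn]; first by rewrite big_ord0 tau0 subrr subr0 normr0 mul0r.
  rewrite big_ord_recr/=.
  set S := \sum_(j < k) _ in IH *; set S' := \sum_(i < N) _.
  rewrite (_ : _ - _ - _ = (B (tau k) - B 0 - S) + (B (tau k.+1) - B (tau k) - S')); last by ring.
  apply: le_trans (ler_normD _ _) _; rewrite -natr1 mulrDl mul1r; apply: lerD.
    by apply: IH; exact: ltnW.
  exact: step.
move=> kn; apply: le_trans (tot kn) _.
have M0 : 0 <= N%:R * (eps / (c + 1)) * `|A| * (s / n%:R).
  by rewrite !mulr_ge0// ltW// invr_gt0 ltr_wpDl.
apply: (@le_trans _ _ (n%:R * (N%:R * (eps / (c + 1)) * `|A| * (s / n%:R)))).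
  by apply: ler_wpM2r => //; rewrite ler_nat.
have -> : n%:R * (N%:R * (eps / (c + 1)) * `|A| * (s / n%:R)) = eps * (c / (c + 1)).
  rewrite /c; field; rewrite ?gt_eqF// ltr_wpDl//.
by rewrite ger_pMr// ler_pdivrMr ?mul1r ?lerDl// ltr_wpDl.
Unshelve. all: by end_near. Qed.

End real_analysis.

Section oscillator.
Context {R : realType}.
Implicit Types (g b phi : R -> R) (t : R).
Local Notation leb := (@lebesgue_measure R).

Lemma is_derive_sinM (om t : R) : is_derive t 1 (fun r => sin (r * om)) (om * cos (t * om)).
Proof.
have D : is_derive t 1 (fun r : R => r * om) om.
  by apply: is_derive_eq; rewrite /GRing.scale/=; ring.
by have := @is_derive1_comp R sin (fun r => r * om) t _ _ (is_derive_sin (t * om)) D; rewrite mulrC.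
Qed.

Lemma is_derive_cosM (om t : R) : is_derive t 1 (fun r => cos (r * om)) (- (om * sin (t * om))).
Proof.
have D : is_derive t 1 (fun r : R => r * om) om.
  by apply: is_derive_eq; rewrite /GRing.scale/=; ring.
by have := @is_derive1_comp R cos (fun r => r * om) t _ _ (is_derive_cos (t * om)) D; rewrite mulNr mulrC.
Qed.

Lemma continuous_sinM (om : R) : continuous (fun r : R => sin (r * om)).
Proof. by move=> t; exact: is_derive_continuous (is_derive_sinM om t). Qed.

Lemma continuous_cosM (om : R) : continuous (fun r : R => cos (r * om)).
Proof. by move=> t; exact: is_derive_continuous (is_derive_cosM om t). Qed.

Lemma sum_by_parts n (a b : nat -> R) :
  \sum_(k < n) a k * (b k.+1 - b k) =
  a n * b n - a 0%N * b 0%N - \sum_(k < n) b k.+1 * (a k.+1 - a k).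
Proof.
elim: n => [|n IH]; first by rewrite !big_ord0; ring.
by rewrite !big_ord_recr/= IH; ring.
Qed.

(** The stochastic integral of a differentiable deterministic integrand,
    computed path by path: summation by parts turns its Riemann sums into
    Riemann sums of the integrator. *)
Lemma stieltjes_sum_cvg (phi phi' b : R -> R) t : 0 <= t -> continuous b -> continuous phi' ->
  (forall r : R, is_derive r 1 phi (phi' r)) ->
  \sum_(k < n) phi (t * k%:R / n%:R) * (b (t * k.+1%:R / n%:R) - b (t * k%:R / n%:R))
    @[n --> \oo] -->
  phi t * b t - phi 0 * b 0 - \int[leb]_(r in `[0, t]) (b r * phi' r).
Proof.
move=> t0 cb cphi' dphi.
have cbp : continuous (fun r : R => b r * phi' r).
  by move=> r; apply: cvgM; [exact: cb|exact: cphi'].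
have [B [B0 dB ->//]] := primitive_continuous cbp.
have [A phiA] : exists A, forall r, 0 <= r <= t -> `|phi' r| <= A.
  have [|c _ cA] := @EVT_max R (fun r => `|phi' r|) 0 t t0.
    apply: continuous_subspaceT => r.
    by apply: (continuous_comp (f := phi')); [exact: cphi'|exact: norm_continuous].
  by exists `|phi' c| => r rt; apply: cA; rewrite in_itv.
apply/cvgrPdist_le => eps eps0.
have dB' (r : R) : 0 <= r <= t -> is_derive r 1 B (\sum_(i < 1) b r * phi' r).
  by move=> /andP[r0 _]; rewrite big_ord1; apply: dB; apply: lt_le_trans r0; rewrite ltrN10.
have [n0 H] := @riemann_stieltjes R 1 (fun=> b) (fun=> phi) (fun=> phi') B t A t0
  (fun=> cb) (fun _ r _ => dphi r) dB' (fun=> phiA) eps eps0.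
exists n0.+1 => // n /= nn0.
have nR0 : n%:R != 0 :> R by rewrite pnatr_eq0 -lt0n (leq_trans _ nn0).
have := H n n (ltnW nn0) (leqnn n).
rewrite mulfK// B0 subr0.
under [X in `|_ - X| <= _]eq_bigr => j _ do rewrite big_ord1.
rewrite (sum_by_parts n (fun k => phi (t * k%:R / n%:R)) (fun k => b (t * k%:R / n%:R)))/=.
rewrite mulfK// mulr0 mul0r.
by rewrite distrC; congr (`|_| <= _); ring.
Qed.

(** Variation of constants, read backwards: by the addition formulas, every
    term of the mild formula is a product of differentiable functions, so that
    the mild formula defines the solution of the second-order equation with
    forcing g, whose velocity is shifted by the noise b. *)
Lemma oscillator_mild (om x y : R) g b : om != 0 -> continuous g -> continuous b ->
  exists U V : R -> R, [/\ U 0 = x, V 0 = y,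
    forall t, -1 < t -> is_derive t 1 U (V t + b t),
    forall t, -1 < t -> is_derive t 1 V (- (om ^+ 2 * U t) + g t) &
    forall t, 0 <= t ->
      U t = cos (t * om) * x + sin (t * om) / om * y
        + \int[leb]_(r in `[0, t]) (sin ((t - r) * om) / om * g r)
        + \int[leb]_(r in `[0, t]) (b r * cos ((t - r) * om)) /\
      V t = - (om * sin (t * om)) * x + cos (t * om) * y
        + \int[leb]_(r in `[0, t]) (cos ((t - r) * om) * g r)
        - \int[leb]_(r in `[0, t]) (b r * (om * sin ((t - r) * om)))].
Proof.
move=> om0 cg cb.
have cM (h k : R -> R) : continuous h -> continuous k -> continuous (fun r : R => h r * k r).
  by move=> ch ck r; apply: cvgM; [exact: ch|exact: ck].
have cco := @continuous_cosM om; have csi := @continuous_sinM om.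
have ccg := cM _ _ cco cg; have csg := cM _ _ csi cg.
have ccb := cM _ _ cco cb; have csb := cM _ _ csi cb.
have [Cg [Cg0 dCg iCg]] := primitive_continuous ccg.
have [Sg [Sg0 dSg iSg]] := primitive_continuous csg.
have [Cb [Cb0 dCb iCb]] := primitive_continuous ccb.
have [Sb [Sb0 dSb iSb]] := primitive_continuous csb.
have lin (h1 h2 : R -> R) (k1 k2 t : R) : continuous h1 -> continuous h2 ->
    \int[leb]_(r in `[0, t]) (k1 * h1 r + k2 * h2 r) =
    k1 * (\int[leb]_(r in `[0, t]) h1 r) + k2 * (\int[leb]_(r in `[0, t]) h2 r).
  move=> c1 c2; have i1 := integrable_continuous_itv 0 t c1.
  have i2 := integrable_continuous_itv 0 t c2.
  have cZ (k : R) h : continuous h -> continuous (fun r : R => k * h r).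
    by move=> ch r; apply: cvgM; [exact: cvg_cst|exact: ch].
  rewrite RintegralD//; first by rewrite !RintegralZl.
  - exact: integrable_continuous_itv (cZ k1 _ c1).
  - exact: integrable_continuous_itv (cZ k2 _ c2).
(* Cg, Sg, Cb, Sb are the primitives of cos g, sin g, cos b, sin b *)
pose U t := cos (t * om) * x + sin (t * om) / om * y
  + (sin (t * om) * Cg t - cos (t * om) * Sg t) / om
  + (cos (t * om) * Cb t + sin (t * om) * Sb t).
pose V t := - (om * sin (t * om)) * x + cos (t * om) * y
  + (cos (t * om) * Cg t + sin (t * om) * Sg t)
  - om * (sin (t * om) * Cb t - cos (t * om) * Sb t).
exists U, V; split.
- by rewrite /U !mul0r cos0 sin0 Cg0 Sg0 Cb0 Sb0; ring.
- by rewrite /V !mul0r cos0 sin0 Cg0 Sg0 Cb0 Sb0; ring.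
- move=> t t1; have ds := is_derive_sinM om t; have dc := is_derive_cosM om t.
  have d1 := dCg t t1; have d2 := dSg t t1; have d3 := dCb t t1; have d4 := dSb t t1.
  apply: is_derive_eq; rewrite /V /GRing.scale/=.
  rewrite [X in _ = _ + X](_ : b t = b t * (cos (t * om) ^+ 2 + sin (t * om) ^+ 2)).
    by field.
  by rewrite cos2Dsin2 mulr1.
- move=> t t1; have ds := is_derive_sinM om t; have dc := is_derive_cosM om t.
  have d1 := dCg t t1; have d2 := dSg t t1; have d3 := dCb t t1; have d4 := dSb t t1.
  apply: is_derive_eq; rewrite /U /GRing.scale/=.
  rewrite [X in _ = _ + X](_ : g t = g t * (cos (t * om) ^+ 2 + sin (t * om) ^+ 2)).
    by field.
  by rewrite cos2Dsin2 mulr1.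
- move=> t t0.
  have sB r : sin ((t - r) * om) = sin (t * om) * cos (r * om) - cos (t * om) * sin (r * om).
    by rewrite mulrBl sinB.
  have cB r : cos ((t - r) * om) = cos (t * om) * cos (r * om) + sin (t * om) * sin (r * om).
    by rewrite mulrBl cosB.
  rewrite /U /V -(iCg t t0) -(iSg t t0) -(iCb t t0) -(iSb t t0); split.
    congr (_ + _ + _).
      rewrite [RHS](_ : _ = \int[leb]_(r in `[0, t]) (sin (t * om) / om * (cos (r * om) * g r) +
          - (cos (t * om) / om) * (sin (r * om) * g r))).
        by rewrite lin//; ring.
      by apply: eq_Rintegral => r _; rewrite sB; ring.
    rewrite -lin//; apply: eq_Rintegral => r _; rewrite cB; ring.
  congr (_ + _ + _ - _).
    rewrite -lin//; apply: eq_Rintegral => r _; rewrite cB; ring.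
  rewrite [RHS](_ : _ = \int[leb]_(r in `[0, t]) (om * sin (t * om) * (cos (r * om) * b r) +
      - (om * cos (t * om)) * (sin (r * om) * b r))).
    by rewrite lin//; ring.
  by apply: eq_Rintegral => r _; rewrite sB; ring.
Qed.

End oscillator.

Section energy.
Context {R : realType} {d : nat}.
Variables (c0 c1 c2 c3 : R) (f : R -> R).
Hypothesis hf : f = fun x => c3 * x ^+ 3 + c2 * x ^+ 2 + c1 * x + c0.
Variable F : fn R d -> R.
Hypothesis hF : potential f F.
Variables (N : nat) (lam : 'I_N -> R) (e : 'I_N -> fn R d).
Hypothesis pe : forall i, in_Lp 4 (e i).
Variables (u w b : 'I_N -> R -> R) (s : R).
Hypothesis s0 : 0 <= s.

Let position t : fn R d := fun x => \sum_(i < N) u i t * e i x.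
Let force i t := - (lam i * u i t) - inner (f \o position t) (e i).

Hypothesis cb : forall i, continuous (b i).
Hypothesis du : forall i t, 0 <= t <= s -> is_derive t 1 (u i) (w i t + b i t).
Hypothesis dw : forall i t, 0 <= t <= s -> is_derive t 1 (w i) (force i t).

Definition wave_energy t := (\sum_(i < N) lam i * u i t ^+ 2) / 2 +
  (\sum_(i < N) (w i t + b i t) ^+ 2) / 2 + F (position t).

(** The energy predicted from the increments of the noise: the squared increments
    are the Ito correction before its expectation is taken. *)
Definition energy_sum n k := wave_energy 0 + \sum_(j < k) \sum_(i < N)
  ((w i (s * j%:R / n%:R) + b i (s * j%:R / n%:R)) *
     (b i (s * j.+1%:R / n%:R) - b i (s * j%:R / n%:R)) +
   (b i (s * j.+1%:R / n%:R) - b i (s * j%:R / n%:R)) ^+ 2 / 2).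

(** The energy of the shifted velocity w is differentiable, because w does not
    feel the roughness of the noise; conservation of energy leaves only the
    work of the noise against the force. *)
Let smooth_energy t := (\sum_(i < N) lam i * u i t ^+ 2) / 2 +
  (\sum_(i < N) w i t ^+ 2) / 2 + F (position t).

Let is_derive_smooth_energy t : 0 <= t <= s ->
  is_derive t 1 (fun t => - smooth_energy t) (\sum_(i < N) b i t * force i t).
Proof.
move=> ts.
have dF := potential_is_derive hf hF pe (fun i => du i ts).
have dsum (a : 'I_N -> R -> R) (a' : 'I_N -> R) : (forall i, is_derive t 1 (a i) (a' i)) ->
    is_derive t 1 (fun t => \sum_(i < N) a i t) (\sum_(i < N) a' i).
  move=> da; apply: cvg_is_derive.
  rewrite (_ : (fun h => _) = (fun h => \sum_(i < N) h^-1 * (a i (h + t) - a i t))).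
    by apply: cvg_bigsum => i; exact: is_derive_cvg.
  by apply/funext => h; rewrite -sumrB mulr_sumr.
have d1 : is_derive t 1 (fun t => \sum_(i < N) lam i * u i t ^+ 2)
    (\sum_(i < N) lam i * (2 * u i t * (w i t + b i t))).
  apply: dsum => i; have D := du i ts; apply: is_derive_eq.
  by rewrite /GRing.scale/=; ring.
have d2 : is_derive t 1 (fun t => \sum_(i < N) w i t ^+ 2)
    (\sum_(i < N) 2 * w i t * force i t).
  apply: dsum => i; have D := dw i ts; apply: is_derive_eq.
  by rewrite /GRing.scale/=; ring.
rewrite /smooth_energy; apply: is_derive_eq.
rewrite /GRing.scale/= !mulr0 !add0r !mulr_sumr -!big_split/= -sumrN.
apply: eq_bigr => i _; by rewrite /force /position; field.
Qed.

Let force_bounded : exists A, forall i t, 0 <= t <= s -> `|force i t| <= A.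
Proof.
have bnd i : exists A, forall t, 0 <= t <= s -> `|force i t| <= A.
  have cforce : {within `[0, s], continuous (fun t => `|force i t|)}.
    apply: continuous_in_subspaceT => t; rewrite inE/= in_itv/= => ts.
    apply: (continuous_comp (f := force i)); last exact: norm_continuous.
    apply: cvgB; last first.
      by apply: (cvg_inner_cubic hf) => // j; exact: is_derive_continuous (du j ts).
    by apply: cvgN; apply: cvgM; [exact: cvg_cst|exact: is_derive_continuous (du i ts)].
  have [c _ cA] := EVT_max s0 cforce.
  by exists `|force i c| => t ts; apply: cA; rewrite in_itv.
have [A HA] := choice bnd.
exists (\sum_(i < N) `|A i|) => i t ts; apply: le_trans (HA i t ts) _.
apply: le_trans (ler_norm _) _; rewrite (bigD1 i)//= lerDl.
by apply: sumr_ge0.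
Qed.

(** Expanding the squares of the velocities w + b and summing by parts, the error
    of the energy sums is, up to the sign, that of the Riemann-Stieltjes sums of
    b dw, whose limit is minus the increment of the smooth energy. *)
Lemma energy_sum_cvg (eps : R) : 0 < eps -> exists n0 : nat, forall n k,
  (n0 <= n)%N -> (k <= n)%N -> `|wave_energy (s * k%:R / n%:R) - energy_sum n k| <= eps.
Proof.
move=> eps0; have [A forceA] := force_bounded.
have [n0 H] := riemann_stieltjes s0 cb dw is_derive_smooth_energy forceA eps0.
exists n0 => n k n0n kn; apply: le_trans (H n k n0n kn).
rewrite le_eqVlt; apply/orP; left; apply/eqP; rewrite -normrN; congr (`|_|).
pose tau (k : nat) := s * k%:R / n%:R.
have WE t : wave_energy t = smooth_energy t + \sum_(i < N) (w i t * b i t + b i t ^+ 2 / 2).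
  rewrite /wave_energy /smooth_energy.
  rewrite (_ : (\sum_(i < N) (w i t + b i t) ^+ 2) / 2 =
      (\sum_(i < N) w i t ^+ 2) / 2 + \sum_(i < N) (w i t * b i t + b i t ^+ 2 / 2)).
    by ring.
  rewrite mulrC [X in _ = X + _]mulrC !mulr_sumr -big_split/=.
  by apply: eq_bigr => i _; field.
elim: k {kn} => [|k IH].
  by rewrite /energy_sum !big_ord0 mulr0 mul0r; ring.
rewrite /energy_sum !big_ord_recr/=; move: IH; rewrite /energy_sum -!/(tau _).
set S1 := \sum_(j < k) _; set S2 := \sum_(j < k) _ => IH.
set x1 := \sum_(i < N) _; set x2 := \sum_(i < N) _.
have D : wave_energy (tau k.+1) - wave_energy (tau k) - x1 =
    smooth_energy (tau k.+1) - smooth_energy (tau k) + x2.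
  rewrite !WE.
  rewrite (_ : x2 = \sum_(i < N) (w i (tau k.+1) * b i (tau k.+1) + b i (tau k.+1) ^+ 2 / 2)
    - \sum_(i < N) (w i (tau k) * b i (tau k) + b i (tau k) ^+ 2 / 2) - x1); first by ring.
  by rewrite /x1 /x2 -!sumrB; apply: eq_bigr => i _; field.
move: IH D; move: (wave_energy 0) (wave_energy (tau k)) (wave_energy (tau k.+1))
  (smooth_energy 0) (smooth_energy (tau k)) (smooth_energy (tau k.+1)).
by move=> W0 W1 W2 E0 E1 E2; lra.
Qed.

End energy.

(** * Exponential moments of Gaussian increments *)

Section gaussian_moments.
Context {R : realType}.
Local Notation leb := (@lebesgue_measure R).
Import HBNNSimple.

(** Both sides are compared on the simple functions below g, for which the
    density formula is the hypothesis on nu. *)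
Lemma le_integral_density (nu : {measure set (measurableTypeR R) -> \bar R}) (p g : R -> R) :
  measurable_fun setT p -> measurable_fun setT g ->
  (forall x, 0 <= p x) -> (forall x, 0 <= g x) ->
  (forall A, measurable A -> nu A = \int[leb]_(x in A) (p x)%:E)%E ->
  (\int[nu]_x (g x)%:E <= \int[leb]_x (g x * p x)%:E)%E.
Proof.
move=> mp mg p0 g0 nuE.
rewrite [leLHS]ge0_integralTE//.
apply: ge_ereal_sup => _ [h /= hg <-].
apply: (@le_trans _ _ (\int[leb]_x (h x * p x)%:E)%E); last first.
  apply: ge0_le_integral => //.
  - by move=> x _; rewrite lee_fin mulr_ge0.
  - by apply/measurable_EFinP; exact: measurable_funM.
  - by apply/measurable_EFinP; exact: measurable_funM.
  - by move=> x _; rewrite lee_fin ler_wpM2r// -lee_fin hg.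
rewrite sintegralE.
have hE x : (h x * p x)%:E = (\sum_(y \in range h) (y * \1_(h @^-1` [set y]) x * p x)%:E)%E.
  rewrite {1}(fimfunE h x) mulr_fsuml// fsumEFin//.
under [leRHS]eq_integral do rewrite hE.
rewrite ge0_integral_fsum//; last 2 first.
- move=> y; apply/measurable_EFinP; apply: measurable_funM => //.
  by apply: measurable_funM => //; exact: measurable_indic.
- by move=> y x _; rewrite lee_fin mulr_ge0//; have := nnfun_muleindic_ge0 h y x; rewrite lee_fin.
apply: lee_fsum => // y [x _ <-].
rewrite nuE// [X in (_ * X <= _)%E]integral_mkcond.
have -> : (\int[leb]_z (h x * \1_(h @^-1` [set h x]) z * p z)%:E =
    \int[leb]_z ((h x)%:E * (\1_(h @^-1` [set h x]) z * p z)%:E))%E.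
  by apply: eq_integral => z _; rewrite -EFinM mulrA.
rewrite ge0_integralZl_EFin//.
- rewrite lee_wpmul2l// ?lee_fin//.
  rewrite le_eqVlt; apply/orP; left; apply/eqP; apply: eq_integral => z _.
  by rewrite patchE indicE; case: ifPn; rewrite ?mul1r ?mul0r.
- by move=> z _; rewrite lee_fin mulr_ge0.
- by apply/measurable_EFinP; apply: measurable_funM => //; exact: measurable_indic.
Qed.

End gaussian_moments.

Lemma variance_ratio {R : realType} (v p y : R) : v != 0 -> p != 0 -> 1 - y != 0 ->
  (v * p *+ 2)^-1 * (v / (1 - y) * p *+ 2) = (1 - y)^-1.
Proof.
move=> v0 p0 y0; rewrite !mulr2n; field.
by rewrite y0 -mulr2n -mulr_natr !mulf_neq0// pnatr_eq0.
Qed.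

Section gaussian_variable.
Context {R : realType} {dsp : measure_display} {Omega : measurableType dsp}.
Variable P : probability Omega R.
Local Notation leb := (@lebesgue_measure R).
Variables (X : Omega -> R) (var : R).
Hypotheses (mX : measurable_fun setT X) (var0 : 0 <= var).
Hypothesis lawX : forall B : set R, measurable B -> P (X @^-1` B) = gaussian var B.

Lemma integral_gaussian_le (g : R -> R) : measurable_fun setT g -> (forall x, 0 <= g x) ->
  (\int[P]_w (g (X w))%:E <=
   if (var == 0)%R then (g 0)%:E else \int[leb]_x (g x * normal_pdf 0 (Num.sqrt var) x)%:E)%E.
Proof.
move=> mg g0.
pose X' : {mfun Omega >-> measurableTypeR R} := HB.pack X (isMeasurableFun.Build _ _ Omega (measurableTypeR R) X mX).
have E : (\int[P]_w (g (X w))%:E = \int[pushforward P X']_x (g x)%:E)%E.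
  rewrite ge0_integral_pushforward//; last by move=> y _; rewrite lee_fin.
  by apply/measurable_EFinP; exact: mg.
rewrite E; have [v0|v0] := eqVneq var 0; last first.
  apply: le_integral_density => //.
  - exact: measurable_normal_pdf.
  - by move=> x; exact: normal_pdf_ge0.
  - move=> A mA; rewrite -[LHS]/(P (X @^-1` A)) (lawX mA) /gaussian (negbTE v0).
    by [].
rewrite (@eq_measure_integral _ _ _ _ (\d_(0 : measurableTypeR R))).
  by rewrite integral_dirac// ?diracT ?mul1e//; exact/measurable_EFinP.
by move=> A mA _; rewrite -[LHS]/(P (X @^-1` A)) (lawX mA) /gaussian v0 eqxx.
Qed.

(** Completing the square, the integrand is a constant times the density of the
    Gaussian law shifted by a var. *)
Lemma gaussian_exp_linear (a : R) :
  (\int[P]_w (expR (a * X w))%:E <= (expR (a ^+ 2 * var / 2))%:E)%E.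
Proof.
have mg : measurable_fun setT (fun x => expR (a * x)).
  by apply: measurableT_comp => //; exact: measurable_funM.
apply: le_trans (integral_gaussian_le mg (fun x => expR_ge0 _)) _.
have [v0|v0] := eqVneq var 0.
  by rewrite v0 !mulr0 mul0r lexx.
have sv0 : Num.sqrt var != 0 by rewrite gt_eqF// sqrtr_gt0 lt_neqAle eq_sym v0.
have sq : Num.sqrt var ^+ 2 = var by rewrite sqr_sqrtr.
rewrite (_ : (\int[leb]_x _)%E = (\int[leb]_x ((expR (a ^+ 2 * var / 2))%:E *
    (normal_pdf (a * var) (Num.sqrt var) x)%:E))%E).
  rewrite ge0_integralZl_EFin ?expR_ge0//.
  - by rewrite integral_normal_pdf mule1.
  - by move=> x _; rewrite lee_fin normal_pdf_ge0.
  - by apply/measurable_EFinP; exact: measurable_normal_pdf.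
apply: eq_integral => x _; rewrite !normal_pdfE//= -EFinM; congr EFin.
rewrite mulrCA [RHS]mulrCA; congr (_ * _).
rewrite /normal_fun sq -!expRD; congr expR; field.
by rewrite v0.
Qed.

(** The integrand is a constant times the centered Gaussian density of variance
    var / (1 - 2 b var), and the constant (1 - 2 b var)^(-1/2) is at most
    exp(2 b var) when 2 b var <= 1/2. *)
Lemma gaussian_exp_square (b : R) : 0 <= b -> 4 * b * var <= 1 ->
  (\int[P]_w (expR (b * X w ^+ 2))%:E <= (expR (2 * b * var))%:E)%E.
Proof.
move=> b0 bv.
have mg : measurable_fun setT (fun x : R => expR (b * x ^+ 2)).
  by apply: measurableT_comp => //; apply: measurable_funM => //; exact: measurable_funX.
apply: le_trans (integral_gaussian_le mg (fun x => expR_ge0 _)) _.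
have [v0|v0] := eqVneq var 0.
  by rewrite v0 expr0n/= !mulr0 lexx.
have var_gt0 : 0 < var by rewrite lt_neqAle eq_sym v0.
(* tau2 is the variance after the exponential tilt *)
pose y := 2 * b * var.
have y0 : 0 <= y by rewrite !mulr_ge0.
have y2 : y <= 1 / 2 by rewrite /y; lra.
have y1 : 0 < 1 - y by lra.
pose tau2 := var / (1 - y).
have tau20 : 0 < tau2 by rewrite divr_gt0.
have sv0 : Num.sqrt var != 0 by rewrite gt_eqF// sqrtr_gt0.
have st0 : Num.sqrt tau2 != 0 by rewrite gt_eqF// sqrtr_gt0.
have sq : Num.sqrt var ^+ 2 = var by rewrite sqr_sqrtr.
have sqt : Num.sqrt tau2 ^+ 2 = tau2 by rewrite sqr_sqrtr// ltW.
pose c := normal_peak (Num.sqrt var) / normal_peak (Num.sqrt tau2).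
have pt0 := normal_peak_gt0 st0.
have c0 : 0 <= c by rewrite divr_ge0// ?normal_peak_ge0.
rewrite (_ : (\int[leb]_x _)%E = (\int[leb]_x (c%:E *
    (normal_pdf 0 (Num.sqrt tau2) x)%:E))%E); last first.
  apply: eq_integral => x _; rewrite !normal_pdfE//= -EFinM; congr EFin.
  rewrite /c -[RHS]mulrA mulKf ?gt_eqF// mulrCA; congr (_ * _).
  rewrite /normal_fun sq sqt -expRD; congr expR; rewrite /tau2 /y; field.
  by rewrite v0/= gt_eqF.
rewrite ge0_integralZl_EFin//; last 2 first.
- by move=> x _; rewrite lee_fin normal_pdf_ge0.
- by apply/measurable_EFinP; exact: measurable_normal_pdf.
rewrite integral_normal_pdf mule1 lee_fin.
rewrite -(@ler_pXn2r _ 2)// ?nnegrE ?expR_ge0//.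
have -> : c ^+ 2 = (1 - y)^-1.
  have E (z : R) : 0 <= z -> (normal_peak (Num.sqrt z)) ^+ 2 = (z * pi *+ 2)^-1.
    move=> z0; rewrite /normal_peak exprVn sqr_sqrtr ?sqr_sqrtr//.
    by rewrite mulrn_wge0// mulr_ge0// pi_ge0.
  rewrite /c exprMn (E _ var0) [(_^-1) ^+ 2]exprVn (E _ (ltW tau20)) invrK /tau2.
  by apply: variance_ratio; rewrite gt_eqF// pi_gt0.
rewrite -/y -invf_ple ?posrE ?exprn_gt0 ?expR_gt0//.
rewrite -expRM_natl -expRN.
apply: (@le_trans _ _ ((1 + 2 * y)^-1)).
  rewrite expRN lef_pV2 ?posrE ?expR_gt0 ?ltr_wpDr// ?mulr_ge0//.
  exact: expR_ge1Dx.
rewrite -[leRHS]invrK lef_pV2 ?posrE ?invr_gt0//; last by rewrite ltr_wpDr// mulr_ge0.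
rewrite invf_ple ?posrE//; last by rewrite ltr_wpDr// mulr_ge0.
rewrite -[leLHS]mul1r ler_pdivrMr; last by rewrite ltr_wpDr// mulr_ge0.
have yy : 0 <= y * (1 / 2 - y) by rewrite mulr_ge0// subr_ge0.
lra.
Qed.

End gaussian_variable.

(** The difference of the two sides is half the sum of the squares of the
    minors x_i y_j - x_j y_i. *)
Lemma sum_CS {R : realType} N (x y : 'I_N -> R) :
  (\sum_i x i * y i) ^+ 2 <= (\sum_i x i ^+ 2) * (\sum_i y i ^+ 2).
Proof.
rewrite -subr_ge0 expr2.
rewrite -(pmulrn_lge0 _ (ltn0Sn 1)) (_ : _ *+ 2 =
  \sum_i \sum_j (x i * y j - x j * y i) ^+ 2).
  by apply: sumr_ge0 => i _; apply: sumr_ge0 => j _; exact: sqr_ge0.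
have E1 (a b : 'I_N -> R) : (\sum_i a i) * (\sum_j b j) = \sum_i \sum_j a i * b j.
  by rewrite mulr_suml; apply: eq_bigr => i _; rewrite mulr_sumr.
rewrite mulrnBl !mulr2n {1}[X in X + _ - _ = _]E1 [X in _ + X - _]mulrC !E1.
rewrite -!big_split -sumrB /=; apply: eq_bigr => i _.
rewrite -!big_split -sumrB /=; apply: eq_bigr => j _; ring.
Qed.

Section gaussian_step.
Context {R : realType} {dsp : measure_display} {Omega : measurableType dsp}.
Variable P : probability Omega R.

(** Jensen's inequality, from the tangent line of the exponential at the mean. *)
Lemma expR_convex_sum N (th y : 'I_N -> R) : (forall i, 0 <= th i) ->
  \sum_i th i = 1 -> expR (\sum_i th i * y i) <= \sum_i th i * expR (y i).
Proof.
move=> th0 th1; set m := \sum_i th i * y i.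
apply: (@le_trans _ _ (\sum_i th i * (expR m * (1 + (y i - m))))).
  rewrite (eq_bigr (fun i => expR m * (th i + (th i * y i - th i * m)))); last first.
    by move=> i _; ring.
  by rewrite -mulr_sumr big_split/= sumrB -mulr_suml th1 -/m mul1r subrr addr0 mulr1.
apply: ler_sum => i _; apply: ler_wpM2l => //.
rewrite -[leRHS](_ : expR m * expR (y i - m) = _); last by rewrite -expRD addrC subrK.
by rewrite ler_wpM2l ?expR_ge0// expR_ge1Dx.
Qed.

Variables (N : nat) (xi : 'I_N -> Omega -> R) (q : 'I_N -> R) (h tr : R).
Hypotheses (N0 : (0 < N)%N) (mxi : forall i, measurable_fun setT (xi i)).
Hypotheses (q0 : forall i, 0 < q i) (h0 : 0 <= h) (qtr : \sum_i q i <= tr) (htr : 4 * tr * h <= 1).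
Hypothesis lawxi : forall i (B : set R), measurable B ->
  P (xi i @^-1` B) = gaussian (h * q i) B.

Let var_ge0 i : 0 <= h * q i. Proof. by rewrite mulr_ge0// ltW. Qed.

Let integral_sum_le (th : 'I_N -> R) (G : 'I_N -> Omega -> R) (M : R) :
  (forall i, 0 <= th i) -> \sum_i th i = 1 ->
  (forall i, measurable_fun setT (G i)) ->
  (forall i, (\int[P]_w (expR (G i w))%:E <= M%:E)%E) ->
  (\int[P]_w (expR (\sum_i th i * G i w))%:E <= M%:E)%E.
Proof.
move=> th0 th1 mG GM.
have mE i : measurable_fun setT (fun w => (expR (G i w))%:E).
  by apply/measurable_EFinP; exact: measurableT_comp.
apply: (@le_trans _ _ (\int[P]_w (\sum_(i < N) (th i)%:E * (expR (G i w))%:E))%E).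
  apply: ge0_le_integral => //.
  - apply/measurable_EFinP; apply: measurableT_comp => //.
    by apply: measurable_sum => i; exact: measurable_funM.
  - apply: emeasurable_sum => i; apply: emeasurable_funM => //; exact: measurable_cst.
  - move=> w _; under [leRHS]eq_bigr do rewrite -EFinM.
    rewrite sumEFin lee_fin.
    exact: expR_convex_sum.
rewrite ge0_integral_sum//; last 2 first.
- by move=> i; apply: emeasurable_funM => //; exact: measurable_cst.
- by move=> i w _; rewrite mule_ge0// lee_fin ?expR_ge0.
apply: (@le_trans _ _ (\sum_(i < N) (th i)%:E * M%:E)%E).
  apply: lee_sum => i _; rewrite ge0_integralZl_EFin//.
  by apply: lee_wpmul2l => //; rewrite lee_fin.
under eq_bigr do rewrite -EFinM; rewrite sumEFin lee_fin -mulr_suml th1 mul1r//.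
Qed.

Let Q := \sum_i q i.

Let Q_gt0 : 0 < Q.
Proof.
rewrite /Q (bigD1 (Ordinal N0))//=; apply: ltr_wpDr => //.
by apply: sumr_ge0 => i _; rewrite ltW.
Qed.

(** Convexity with weights proportional to the variances: the rescaled summands
    all have the same law. *)
Lemma gaussian_vector_square (c : R) : 0 <= c <= 1 ->
  (\int[P]_w (expR (c * \sum_i xi i w ^+ 2))%:E <= (expR (2 * c * tr * h))%:E)%E.
Proof.
move=> /andP[c0 c1].
have E w : c * \sum_i xi i w ^+ 2 = \sum_i (q i / Q) * (c * Q / q i * xi i w ^+ 2).
  rewrite mulr_sumr; apply: eq_bigr => i _; field.
  by rewrite !gt_eqF.
under eq_integral do rewrite E.
have cQh : c * Q * h <= tr * h.
  rewrite ler_wpM2r//; apply: le_trans qtr; rewrite -/Q.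
  by rewrite ler_piMl// ltW.
apply: integral_sum_le.
- by move=> i; rewrite divr_ge0// ltW.
- by rewrite -mulr_suml divff// gt_eqF.
- by move=> i; apply: measurable_funM => //; exact: measurable_funX.
move=> i; have qi : q i != 0 by rewrite gt_eqF.
have Eq : c * Q / q i * (h * q i) = c * Q * h by field.
apply: le_trans (gaussian_exp_square (mxi i) (var_ge0 i) (lawxi i) _ _) _.
- by rewrite divr_ge0// ?mulr_ge0// ltW.
- by rewrite -mulrA Eq; apply: le_trans htr; rewrite -[leRHS]mulrA ler_pM2l.
rewrite lee_fin ler_expR -mulrA Eq -!mulrA ler_pM2l// ler_wpM2l//.
by rewrite mulrC [leRHS]mulrC ler_wpM2l.
Qed.

(** Convexity reduces the scalar product to its coordinates.  The weights
    sqrt(q_i) |a_i| give all the summands the same variance, and their total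
    mass S is controlled by the Cauchy-Schwarz inequality; compared with the
    jointly Gaussian case this only loses the factor Tr(Q) |a|^2 / <Q a, a>. *)
Lemma gaussian_vector_linear (c : R) (a : 'I_N -> R) :
  (\int[P]_w (expR (2 * c * \sum_i a i * xi i w))%:E <=
   (expR (2 * c ^+ 2 * h * tr * \sum_i a i ^+ 2))%:E)%E.
Proof.
pose S := \sum_i Num.sqrt (q i) * `|a i|.
have S0 : 0 <= S by apply: sumr_ge0 => i _; rewrite mulr_ge0// sqrtr_ge0.
have tr0 : 0 <= tr by apply: le_trans qtr; rewrite -/Q ltW.
have a20 : 0 <= \sum_i a i ^+ 2 by apply: sumr_ge0 => i _; exact: sqr_ge0.
have [S00|S00] := eqVneq S 0.
  have a0 i : a i = 0.
    move/eqP : S00; rewrite psumr_eq0; last by move=> j _; rewrite mulr_ge0// sqrtr_ge0.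
    move=> /allP/(_ i); rewrite mem_index_enum => /(_ isT)/=.
    by rewrite mulf_eq0 sqrtr_eq0 leNgt q0/= normr_eq0 => /eqP.
  rewrite [leLHS](_ : _ = \int[P]_w (cst 1%E w))%E; last first.
    apply: eq_integral => w _; rewrite big1 ?mulr0 ?expR0// => i _.
    by rewrite a0 mul0r.
  rewrite integral_cst// [X in (_ * X)%E]probability_setT mule1 lee_fin.
  rewrite -[leLHS]expR0 ler_expR.
  by rewrite mulr_ge0// mulr_ge0// mulr_ge0// mulr_ge0// sqr_ge0.
have Sgt0 : 0 < S by rewrite lt_neqAle eq_sym S00.
have CS : S ^+ 2 <= tr * \sum_i a i ^+ 2.
  have H (x y : 'I_N -> R) : (\sum_i x i * y i) ^+ 2 <= (\sum_i x i ^+ 2) * (\sum_i y i ^+ 2).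
    exact: sum_CS.
  apply: le_trans (H _ _) _; apply: ler_pM.
  - by apply: sumr_ge0 => i _; exact: sqr_ge0.
  - by apply: sumr_ge0 => i _; exact: sqr_ge0.
  - by apply: le_trans qtr; apply: ler_sum => i _; rewrite sqr_sqrtr// ltW.
  - by apply: ler_sum => i _; rewrite real_normK ?num_real.
pose th i := Num.sqrt (q i) * `|a i| / S.
have th0 i : 0 <= th i by rewrite divr_ge0// mulr_ge0// sqrtr_ge0.
have sq0 i : Num.sqrt (q i) != 0 by rewrite gt_eqF// sqrtr_gt0.
have E w : 2 * c * \sum_i a i * xi i w = \sum_i th i * (2 * c * a i / th i * xi i w).
  rewrite mulr_sumr; apply: eq_bigr => i _.
  have [ai|ai] := eqVneq (a i) 0; first by rewrite ai !(mulr0, mul0r).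
  have thi : th i != 0 by rewrite !mulf_neq0 ?normr_eq0 ?invr_eq0.
  by field.
under eq_integral do rewrite E.
apply: integral_sum_le => //.
- by rewrite -mulr_suml divff.
- by move=> i; exact: measurable_funM.
move=> i; apply: le_trans (gaussian_exp_linear (mxi i) (var_ge0 i) (lawxi i) _) _.
rewrite lee_fin ler_expR.
have [ai|ai] := eqVneq (a i) 0.
  by rewrite ai !(mulr0, mul0r) expr0n/= !mul0r mulr_ge0// mulr_ge0// mulr_ge0// mulr_ge0// sqr_ge0.
have -> : (2 * c * a i / th i) ^+ 2 * (h * q i) / 2 = 2 * c ^+ 2 * h * S ^+ 2.
  have -> : (2 * c * a i / th i) ^+ 2 = 4 * c ^+ 2 * S ^+ 2 / q i.
    rewrite /th -[in RHS](@sqr_sqrtr _ (q i)) ?ltW//.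
    rewrite !expr_div_n !exprMn real_normK ?num_real//.
    by field; rewrite ai/= ?sq0 S00.
  by field; rewrite gt_eqF.
rewrite -[leRHS]mulrA; apply: ler_wpM2l => //.
by rewrite mulr_ge0// mulr_ge0// sqr_ge0.
Qed.

(** exp(x + y) is at most the mean of exp(2 x) and exp(2 y), which separates the
    linear part from the quadratic one. *)
Lemma gaussian_vector_step (c : R) (a : 'I_N -> R) : 0 <= c <= 1 ->
  (\int[P]_w (expR (c * \sum_i (a i * xi i w + xi i w ^+ 2 / 2)))%:E <=
   (expR (2 * c ^+ 2 * h * tr * \sum_i a i ^+ 2 + 2 * c * tr * h))%:E)%E.
Proof.
move=> c01; have /andP[c0 c1] := c01.
have tr0 : 0 <= tr by apply: le_trans qtr; rewrite -/Q ltW.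
have a20 : 0 <= \sum_i a i ^+ 2 by apply: sumr_ge0 => i _; exact: sqr_ge0.
set A := 2 * c ^+ 2 * h * tr * _; set B := 2 * c * tr * h.
have A0 : 0 <= A by rewrite mulr_ge0// mulr_ge0// mulr_ge0// mulr_ge0// sqr_ge0.
have B0 : 0 <= B by rewrite !mulr_ge0.
have m1 : measurable_fun setT (fun w => (expR (2 * c * \sum_i a i * xi i w))%:E).
  apply/measurable_EFinP; apply: measurableT_comp => //; apply: measurable_funM => //.
  by apply: measurable_sum => i; exact: measurable_funM.
have m2 : measurable_fun setT (fun w => (expR (c * \sum_i xi i w ^+ 2))%:E).
  apply/measurable_EFinP; apply: measurableT_comp => //; apply: measurable_funM => //.
  by apply: measurable_sum => i; exact: measurable_funX.
have half0 : (0%R <= (2^-1)%:E :> \bar R)%E by rewrite lee_fin invr_ge0.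
apply: (@le_trans _ _ (\int[P]_w ((2^-1)%:E * ((expR (2 * c * \sum_i a i * xi i w))%:E +
    (expR (c * \sum_i xi i w ^+ 2))%:E)))%E).
  apply: ge0_le_integral => //.
  - apply/measurable_EFinP; apply: measurableT_comp => //; apply: measurable_funM => //.
    apply: measurable_sum => i; apply: measurable_funD; first exact: measurable_funM.
    by apply: measurable_funM => //; exact: measurable_funX.
  - apply: emeasurable_funM; first exact: measurable_cst.
    exact: emeasurable_funD.
  - move=> w _; rewrite -EFinD -EFinM lee_fin.
    set x := \sum_i a i * xi i w; set y := \sum_i xi i w ^+ 2.
    have -> : c * \sum_i (a i * xi i w + xi i w ^+ 2 / 2) = c * x + c * y / 2.
      rewrite big_split/= -mulr_suml -/x -/y; ring.
    have -> : 2 * c * x = c * x + c * x by ring.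
    have E2 : c * y = c * y / 2 + c * y / 2 by field.
    rewrite [in leRHS]E2 !expRD; move: (expR (c * x)) (expR (c * y / 2)) => s t.
    by have := sqr_ge0 (s - t); lra.
rewrite ge0_integralZl_EFin//; last 2 first.
- by move=> w _; rewrite adde_ge0// lee_fin expR_ge0.
- exact: emeasurable_funD.
rewrite ge0_integralD//; try by move=> w _; rewrite lee_fin expR_ge0.
apply: (@le_trans _ _ ((2^-1)%:E * ((expR (A + B))%:E + (expR (A + B))%:E))%E).
  apply: lee_wpmul2l => //; apply: leeD.
    by apply: le_trans (gaussian_vector_linear c a) _; rewrite lee_fin ler_expR -/A lerDl.
  by apply: le_trans (gaussian_vector_square c01) _; rewrite lee_fin ler_expR -/B lerDr.
by rewrite -EFinD -EFinM lee_fin le_eqVlt; apply/orP; left; apply/eqP; field.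
Qed.

End gaussian_step.

Section independence.
Context {R : realType} {dsp : measure_display} {Omega : measurableType dsp}.
Variable P : probability Omega R.

(** Stated through preimages, so that functions on Omega can be considered for
    several sigma-algebras at once. *)
Definition measurable_wrt (G : set (set Omega)) (X : Omega -> R) : Prop :=
  forall B : set R, measurable B -> <<s G >> (X @^-1` B).

Lemma measurable_wrtP (G : set (set Omega)) (X : Omega -> R) : measurable_wrt G X ->
  measurable_fun setT (X : g_sigma_algebraType G -> R).
Proof. by move=> mX _ B mB; rewrite setTI; exact: mX. Qed.

Variables G1 G2 : set (set Omega).
Hypotheses (sG1 : <<s G1 >> `<=` measurable) (sG2 : <<s G2 >> `<=` measurable).
Hypothesis indep : forall A B, <<s G1 >> A -> <<s G2 >> B -> P (A `&` B) = (P A * P B)%E.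

Local Notation T1 := (g_sigma_algebraType G1).
Local Notation T2 := (g_sigma_algebraType G2).

Let id1 (w : Omega) : T1 := w.
Let id2 (w : Omega) : T2 := w.

Let mid1 : measurable_fun setT id1.
Proof. by move=> _ B mB; rewrite setTI; exact: sG1. Qed.
Let mid2 : measurable_fun setT id2.
Proof. by move=> _ B mB; rewrite setTI; exact: sG2. Qed.

Let X1 : {mfun Omega >-> T1} := HB.pack id1 (isMeasurableFun.Build _ _ Omega T1 id1 mid1).
Let X2 : {mfun Omega >-> T2} := HB.pack id2 (isMeasurableFun.Build _ _ Omega T2 id2 mid2).
Let diag (w : Omega) : T1 * T2 := (id1 w, id2 w).
Let mdiag : measurable_fun setT diag.
Proof. exact: measurable_fun_pair. Qed.
Let X12 : {mfun Omega >-> (T1 * T2)%type} :=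
  HB.pack diag (isMeasurableFun.Build _ _ Omega (T1 * T2)%type diag mdiag).

(** Independence says that the diagonal map sends P to the product of its two
    restrictions; the disintegration of an expectation is then Tonelli's
    theorem. *)
Lemma independent_tonelli (H : T1 * T2 -> \bar R) :
  measurable_fun setT H -> (forall z, 0 <= H z)%E ->
  (\int[P]_w H (w, w) = \int[P]_w1 \int[P]_w2 H (w1, w2))%E.
Proof.
move=> mH H0.
pose m1 := distribution P X1; pose m2 := distribution P X2; pose m12 := distribution P X12.
have E : (\int[m1 \x m2]_z H z = \int[m12]_z H z)%E.
  apply: eq_measure_integral => A mA _.
  have K (B : set T1) (C : set T2) : measurable B -> measurable C ->
      m12 (B `*` C) = (m1 B * m2 C)%E.
    by move=> mB mC; exact: (indep mB mC).
  exact: (@product_measure_unique _ _ T1 T2 R m1 m2 m12 K A mA).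
have -> : (\int[P]_w H (w, w) = \int[m12]_z H z)%E.
  by rewrite ge0_integral_pushforward.
rewrite -E fubini_tonelli1// ge0_integral_pushforward//; last 2 first.
- exact: measurable_fun_fubini_tonelli_F.
- by move=> w _; apply: integral_ge0.
apply: eq_integral => w _; rewrite /= /fubini_F ge0_integral_pushforward//.
exact: measurable_fun_pair2.
Qed.

Variables (N : nat) (v xi : 'I_N -> Omega -> R) (Z : Omega -> R) (q : 'I_N -> R) (h tr : R).
Hypotheses (mv : forall i, measurable_wrt G1 (v i)) (mZ : measurable_wrt G1 Z)
  (mxi : forall i, measurable_wrt G2 (xi i)) (Z0 : forall w, 0 <= Z w).
Hypotheses (N0 : (0 < N)%N).
Hypotheses (q0 : forall i, 0 < q i) (h0 : 0 <= h) (qtr : \sum_i q i <= tr) (htr : 4 * tr * h <= 1).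
Hypothesis lawxi : forall i (B : set R), measurable B ->
  P (xi i @^-1` B) = gaussian (h * q i) B.

(** Conditionally on the sigma-algebra generated by G1, v and Z are constants, and
    gaussian_vector_step applies to xi. *)
Lemma independent_gaussian_step (c : R) : 0 <= c <= 1 ->
  (\int[P]_w (Z w * expR (c * \sum_i (v i w * xi i w + xi i w ^+ 2 / 2)))%:E <=
   \int[P]_w (Z w * expR (2 * c ^+ 2 * h * tr * \sum_i v i w ^+ 2 + 2 * c * tr * h))%:E)%E.
Proof.
move=> c01.
pose H (z : T1 * T2) :=
  (Z z.1 * expR (c * \sum_i (v i z.1 * xi i z.2 + xi i z.2 ^+ 2 / 2)))%:E.
have mH : measurable_fun setT H.
  have m1 (X : Omega -> R) : measurable_wrt G1 X ->
      measurable_fun setT (fun z : T1 * T2 => X z.1).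
    move=> /measurable_wrtP mX; exact: (measurableT_comp mX measurable_fst).
  have m2 (X : Omega -> R) : measurable_wrt G2 X ->
      measurable_fun setT (fun z : T1 * T2 => X z.2).
    move=> /measurable_wrtP mX; exact: (measurableT_comp mX measurable_snd).
  apply/measurable_EFinP; apply: measurable_funM; first exact: m1.
  apply: measurableT_comp => //; apply: measurable_funM => //.
  apply: measurable_sum => i; apply: measurable_funD.
    by apply: measurable_funM; [exact: m1|exact: m2].
  by apply: measurable_funM => //; apply: measurable_funX; exact: m2.
have H0 z : (0 <= H z)%E by rewrite lee_fin mulr_ge0// expR_ge0.
rewrite (independent_tonelli mH H0).
have P1 (X : Omega -> R) : measurable_wrt G1 X -> measurable_fun setT X.
  by move=> mX _ B mB; rewrite setTI; apply: sG1; exact: mX.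
have P2 (X : Omega -> R) : measurable_wrt G2 X -> measurable_fun setT X.
  by move=> mX _ B mB; rewrite setTI; apply: sG2; exact: mX.
apply: ae_le_integral_nonmeasurable.
- by move=> w; apply: integral_ge0 => w2 _; exact: H0.
- by move=> w; rewrite lee_fin mulr_ge0// expR_ge0.
- apply/measurable_EFinP; apply: measurable_funM; first exact: P1.
  apply: measurableT_comp => //; apply: measurable_funD => //.
  apply: measurable_funM => //; apply: measurable_sum => i.
  by apply: measurable_funX; exact: P1.
apply: nearW => w; rewrite /H/=.
under eq_integral do rewrite EFinM.
rewrite ge0_integralZl_EFin//; last first.
  apply/measurable_EFinP; apply: measurableT_comp => //; apply: measurable_funM => //.
  apply: measurable_sum => i; apply: measurable_funD.
    by apply: measurable_funM => //; exact: P2.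
  by apply: measurable_funM => //; apply: measurable_funX; exact: P2.
rewrite EFinM; apply: lee_wpmul2l; first by rewrite lee_fin.
exact: (gaussian_vector_step N0 (fun i => P2 _ (mxi i)) q0 h0 qtr htr lawxi (fun i => v i w) c01).
Qed.

End independence.

(** * The discrete exponential supermartingale *)

Section discrete_supermartingale.
Context {R : realType} {dsp : measure_display} {Omega : measurableType dsp}.
Variable P : probability Omega R.
Variables (A B : nat -> set (set Omega)).
Hypotheses (sA : forall k, <<s A k >> `<=` measurable) (sB : forall k, <<s B k >> `<=` measurable).
Hypothesis AS : forall k, <<s A k >> `<=` <<s A k.+1 >>.
Hypothesis indep : forall k X Y, <<s A k >> X -> <<s B k >> Y -> P (X `&` Y) = (P X * P Y)%E.
Variables (N : nat) (v xi : nat -> 'I_N -> Omega -> R) (q : 'I_N -> R) (h tr V0 : R).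
Hypotheses (mv : forall k i, measurable_wrt (A k) (v k i))
  (mxi : forall k i, measurable_wrt (B k) (xi k i))
  (mxiA : forall k i, measurable_wrt (A k.+1) (xi k i)).
Hypotheses (N0 : (0 < N)%N) (q0 : forall i, 0 < q i) (h0 : 0 <= h)
  (qtr : \sum_i q i <= tr) (htr : 4 * tr * h <= 1).
Hypothesis lawxi : forall k i (B : set R), measurable B ->
  P (xi k i @^-1` B) = gaussian (h * q i) B.

Definition incr k w := \sum_i (v k i w * xi k i w + xi k i w ^+ 2 / 2).

Definition accum k w : R := V0 + \sum_(j < k) incr j w.

(** The indicator of the event that the accumulated energy has dominated the
    kinetic energy, up to 1, at the first k times.  On this event the growth of
    the exponential moment in the next step is linear in the accumulated
    energy. *)
Fixpoint controlled k w : R :=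
  if k is j.+1 then controlled j w * ((\sum_i v j i w ^+ 2) / 2 <= accum j w + 1)%R%:R
  else 1.

(** The value of exp(- alpha t) at the k-th mesh point, for alpha = 4 tr. *)
Definition discount k : R := expR (- (4 * tr * h * k%:R)).

Let tr_ge0 : 0 <= tr.
Proof. by apply: le_trans qtr; apply: sumr_ge0 => i _; rewrite ltW. Qed.

Let discount_gt0 k : 0 < discount k. Proof. exact: expR_gt0. Qed.

Let discount_le1 k : discount k <= 1.
Proof. by rewrite -expR0 ler_expR oppr_le0 !mulr_ge0. Qed.

Let discountS k : discount k.+1 * (1 + 4 * tr * h) <= discount k.
Proof.
have -> : discount k = discount k.+1 * expR (4 * tr * h).
  by rewrite /discount -expRD; congr expR; rewrite -natr1; ring.
by rewrite ler_pM2l// expR_ge1Dx.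
Qed.

Lemma controlled01 k w : controlled k w = 0 \/ controlled k w = 1.
Proof.
elim: k => [|k IH] /=; first by right.
by case: (_ <= _); rewrite ?mulr0 ?mulr1; [exact: IH|left].
Qed.

Lemma controlled_ge0 k w : 0 <= controlled k w.
Proof. by case: (controlled01 k w) => ->. Qed.

Lemma controlled_eq1 k w : (forall j, (j < k)%N ->
  (\sum_i v j i w ^+ 2) / 2 <= accum j w + 1) -> controlled k w = 1.
Proof.
elim: k => [//|k IH] H /=; rewrite H// mulr1; apply: IH => j jk.
by apply: H; exact: ltnW.
Qed.

Let AwP k (X : Omega -> R) :
  measurable_wrt (A k) X <-> measurable_fun setT (X : g_sigma_algebraType (A k) -> R).
Proof.
split; first exact: measurable_wrtP.
by move=> mX C mC; have := mX measurableT C mC; rewrite setTI.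
Qed.

Let AwS k (X : Omega -> R) : measurable_wrt (A k) X -> measurable_wrt (A k.+1) X.
Proof. by move=> mX C mC; apply: AS; exact: mX. Qed.

Let accum_measurable k : measurable_wrt (A k) (accum k).
Proof.
elim: k => [|k IH].
  apply/AwP; rewrite (_ : accum 0 = cst V0); first exact: measurable_cst.
  by apply/funext => w; rewrite /accum big_ord0 addr0.
apply/AwP; rewrite (_ : accum k.+1 = fun w => accum k w + incr k w); last first.
  by apply/funext => w; rewrite /accum big_ord_recr/= addrA.
have m1 (X : Omega -> R) : measurable_wrt (A k) X -> measurable_fun setT
    (X : g_sigma_algebraType (A k.+1) -> R) by move=> mX; apply/AwP; exact: AwS.
apply: measurable_funD; first exact: m1.
apply: measurable_sum => i; apply: measurable_funD.
  by apply: measurable_funM; [exact: m1|apply/AwP; exact: mxiA].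
by apply: measurable_funM => //; apply: measurable_funX; apply/AwP; exact: mxiA.
Qed.

Let controlled_measurable k : measurable_wrt (A k) (controlled k.+1).
Proof.
have m1 j : measurable_wrt (A j) (fun w => ((\sum_i v j i w ^+ 2) / 2 <= accum j w + 1)%R%:R : R).
  apply/AwP; rewrite (_ : (fun w => _) =
    \1_[set w : g_sigma_algebraType (A j) | (\sum_i v j i w ^+ 2) / 2 <= accum j w + 1]).
    apply: measurable_indic; rewrite -[X in measurable X]setTI.
    apply: measurable_fun_le => //.
      apply: measurable_funM => //; apply: measurable_sum => i.
      by apply: measurable_funX; exact/AwP.
    by apply: measurable_funD => //; exact/AwP.
  by apply/funext => w; rewrite indicE; congr ((nat_of_bool _)%:R); apply/idP/idP; rewrite inE.
elim: k => [|k IH].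
  by apply/AwP; apply: measurable_funM => //; apply/AwP; exact: m1.
apply/AwP; rewrite (_ : controlled k.+2 = fun w => controlled k.+1 w *
  ((\sum_i v k.+1 i w ^+ 2) / 2 <= accum k.+1 w + 1)%R%:R)//.
by apply: measurable_funM; apply/AwP; [exact: AwS|exact: m1].
Qed.

Definition weighted k w := controlled k w * expR (discount k * accum k w).

Lemma weighted_ge0 k w : 0 <= weighted k w.
Proof. by rewrite mulr_ge0 ?expR_ge0 ?controlled_ge0. Qed.

Lemma weighted_measurable k : measurable_fun setT (weighted k).
Proof.
have m j (X : Omega -> R) : measurable_wrt (A j) X -> measurable_fun setT X.
  by move=> mX _ C mC; rewrite setTI; apply: sA; exact: mX.
apply: measurable_funM.
  case: k => [|k]; first exact: measurable_cst.
  exact: m _ _ (@controlled_measurable k).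
by apply: measurableT_comp => //; apply: measurable_funM => //; exact: m _ _ (@accum_measurable k).
Qed.

(** With c the discount at time k + 1, the step produces the exponent
    2 c^2 h tr |v|^2 + 2 c h tr, where |v|^2 <= 2 (accum + 1) on the control
    event.  By discountS the term 4 c h tr (accum + 1) is at most the decrease of
    the discount times accum + 1. *)
Lemma weighted_step k : (\int[P]_w (weighted k.+1 w)%:E <=
  (expR (2 * tr * h + (discount k - discount k.+1)))%:E * \int[P]_w (weighted k w)%:E)%E.
Proof.
set c := discount k.+1.
have c0 : 0 <= c by apply: ltW; exact: discount_gt0.
have c1 : c <= 1 by exact: discount_le1.
pose Z w := controlled k.+1 w * expR (c * accum k w).
have Z0 w : 0 <= Z w by rewrite mulr_ge0 ?expR_ge0 ?controlled_ge0.
have mZ : measurable_wrt (A k) Z.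
  apply/AwP; apply: measurable_funM; first exact/AwP.
  by apply: measurableT_comp => //; apply: measurable_funM => //; exact/AwP.
have -> : (\int[P]_w (weighted k.+1 w)%:E =
    \int[P]_w (Z w * expR (c * \sum_i (v k i w * xi k i w + xi k i w ^+ 2 / 2)))%:E)%E.
  apply: eq_integral => w _; congr EFin; rewrite /weighted /Z -mulrA -expRD -mulrDr.
  by rewrite /accum big_ord_recr/= addrA.
have c01 : 0 <= c <= 1 by rewrite c0 c1.
have step := @independent_gaussian_step _ _ _ P (A k) (B k) (@sA k) (@sB k) (@indep k) N
  (v k) (xi k) Z q h tr (@mv k) mZ (@mxi k) Z0 N0 q0 h0 qtr htr (@lawxi k) c c01.
apply: le_trans step _.
have mw := weighted_measurable.
rewrite -ge0_integralZl_EFin ?expR_ge0//; last 2 first.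
- by move=> w _; rewrite lee_fin weighted_ge0.
- by apply/measurable_EFinP; exact: mw.
apply: ae_le_integral_nonmeasurable.
- by move=> w; rewrite lee_fin mulr_ge0 ?Z0 ?expR_ge0.
- by move=> w; rewrite mule_ge0 ?lee_fin ?expR_ge0 ?weighted_ge0.
- apply: emeasurable_funM; first exact: measurable_cst.
  by apply/measurable_EFinP; exact: mw.
apply: nearW => w; rewrite -EFinM lee_fin /Z /weighted /=.
case: (controlled01 k w) => ->; first by rewrite !mul0r mulr0.
have [vM|_] := boolP ((\sum_i v k i w ^+ 2) / 2 <= accum k w + 1); last first.
  by rewrite /= mulr0 !mul0r mulr_ge0 ?expR_ge0// mulr_ge0 ?expR_ge0.
rewrite /= mulr1 !mul1r -!expRD ler_expR.
have S0 : 0 <= \sum_i v k i w ^+ 2 by apply: sumr_ge0 => i _; exact: sqr_ge0.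
move: (\sum_i v k i w ^+ 2) vM S0 => S SM S0.
have cS := discountS k; rewrite -/c in cS.
move: (accum k w) SM => M SM.
have M0 : 0 <= M + 1 by apply: le_trans SM; rewrite divr_ge0.
have th0 : 0 <= tr * h by rewrite mulr_ge0.
apply: (@le_trans _ _ (c * M + (c * (4 * tr * h) * (M + 1) + 2 * tr * h))).
  rewrite lerD2l; apply: lerD.
    apply: (@le_trans _ _ (2 * c * (tr * h) * S)).
      rewrite (_ : 2 * c ^+ 2 * h * tr = c * (2 * c * (tr * h))); last by ring.
      by rewrite ler_wpM2r// ler_piMl// !mulr_ge0.
    rewrite (_ : c * (4 * tr * h) * (M + 1) = 2 * c * (tr * h) * (2 * (M + 1))); last by ring.
    by rewrite ler_wpM2l ?mulr_ge0//; lra.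
  rewrite -!mulrA ler_pM2l// [leRHS](_ : _ = 1 * (tr * h)); last by rewrite mul1r.
  by rewrite ler_wpM2r.
have := ler_wpM2r M0 cS; lra.
Qed.

(** The factors 2 tr h add up to 2 tr times the final time, and the decreases of
    the discount telescope to at most 1. *)
Lemma weighted_le n : (\int[P]_w (weighted n w)%:E <= (expR (V0 + 1 + 2 * tr * h * n%:R))%:E)%E.
Proof.
suff H : (\int[P]_w (weighted n w)%:E <=
    (expR (V0 + (1 - discount n) + 2 * tr * h * n%:R))%:E)%E.
  apply: le_trans H _; rewrite lee_fin ler_expR lerD2r lerD2l lerBlDr lerDl.
  exact: ltW.
elim: n => [|n IH].
  rewrite (_ : (\int[P]_w _)%E = (\int[P]_w (cst (expR V0)%:E w))%E).
    rewrite integral_cst// [X in (_ * X)%E]probability_setT mule1 lee_fin ler_expR.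
    by rewrite /discount !mulr0 oppr0 expR0 subrr !addr0.
  apply: eq_integral => w _; rewrite /weighted /= mul1r /accum big_ord0 addr0.
  by rewrite /discount !mulr0 oppr0 expR0 mul1r.
apply: le_trans (weighted_step n) _.
apply: (@le_trans _ _ ((expR (2 * tr * h + (discount n - discount n.+1)))%:E *
   (expR (V0 + (1 - discount n) + 2 * tr * h * n%:R))%:E)%E).
  by apply: lee_wpmul2l => //; rewrite lee_fin expR_ge0.
rewrite -EFinM lee_fin -expRD ler_expR -natr1 le_eqVlt; apply/orP; left; apply/eqP.
by ring.
Qed.

End discrete_supermartingale.

(** * Coordinates of continuous paths *)

Section clamping.
Context {R : realType}.
Variable T : R.
Hypothesis T0 : 0 <= T.

(** Composing a path on [0, T] with this retraction extends it continuously to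
    the whole line. *)
Definition clamp (t : R) : R := Num.max 0 (Num.min t T).

Lemma clamp_in t : 0 <= clamp t <= T.
Proof. by rewrite /clamp le_max lexx/= ge_max T0 ge_min lexx orbT. Qed.

Lemma clamp_id t : 0 <= t <= T -> clamp t = t.
Proof. by move=> /andP[t0 tT]; rewrite /clamp min_l// max_r. Qed.

Lemma clamp_continuous : continuous clamp.
Proof.
move=> t; apply: (@continuous_max R R (fun=> 0) (fun t => Num.min t T)); first exact: cvg_cst.
by apply: (@continuous_min R R (fun t => t) (fun=> T)); [exact: cvg_id|exact: cvg_cst].
Qed.

(** The mild formulation holds almost surely at each time, hence almost surely at
    all rational times; continuity is what extends it to all times. *)
Lemma continuous_eq_rat (f g : R -> R) : continuous f -> continuous g ->
  (forall q : rat, f (ratr q) = g (ratr q)) -> f =1 g.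
Proof.
move=> cf cg fg t; apply/eqP; rewrite -subr_eq0; apply/negPn/negP => d0.
have ch : continuous (fun x => f x - g x) by move=> x; apply: cvgB; [exact: cf|exact: cg].
have oU : open [set x | 0 < `|f x - g x|].
  apply: (@open_comp _ _ (fun x => `|f x - g x|) [set y | 0 < y]); last exact: open_gt.
  by move=> x _; apply: (continuous_comp (f := fun x => f x - g x)); [exact: ch|exact: norm_continuous].
have [|x [/= U0 [q _ qE]]] := @dense_rat R [set x | 0 < `|f x - g x|] _ oU.
  by exists t; rewrite /= normr_gt0.
by move: U0; rewrite -qE fg subrr normr0 ltxx.
Qed.

End clamping.

Section L2_paths.
Context {R : realType} {d : nat}.
Implicit Types (x : R -> fn R d) (h : fn R d).

Lemma L2_continuous_inner (D : set R) x h (T : R) : 0 <= T -> `[0, T] `<=` D ->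
  (forall t, D t -> in_Lp 2 (x t)) -> in_Lp 2 h -> L2_continuous_on D x ->
  continuous (fun t => inner (x (clamp T t)) h).
Proof.
move=> T0 TD px ph cx t.
have clD r : D (clamp T r) by apply: TD; rewrite /= in_itv/=; exact: clamp_in.
apply/cvgrPdist_lt => eps eps0.
have hp : 0 < L2n h + 1 by rewrite ltr_wpDl// L2n_ge0.
have small : \forall r \near t, (Lp_norm 2 (x (clamp T r) \- x (clamp T t))%R < (eps / (L2n h + 1))%:E)%E.
  have := cx _ (clD t).
  move=> /(_ [set y | (y < (eps / (L2n h + 1))%:E)%E]) cxt.
  have : \forall s \near within D (nbhs (clamp T t)),
     (Lp_norm 2 (x s \- x (clamp T t))%R < (eps / (L2n h + 1))%:E)%E.
    apply: cxt; rewrite nbhsE /=; exists [set y | (y < (eps / (L2n h + 1))%:E)%E] => //.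
    by split; [exact: open_ereal_lt_ereal|rewrite /= lte_fin divr_gt0].
  rewrite near_withinE => H.
  have K : \forall r \near t, D (clamp T r) ->
     (Lp_norm 2 (x (clamp T r) \- x (clamp T t))%R < (eps / (L2n h + 1))%:E)%E.
    exact: (@clamp_continuous R T t _ H).
  by near=> r; have Hr := clD r; move: Hr; near: r.
near=> r; have sm : (Lp_norm 2 (x (clamp T r) \- x (clamp T t))%R < (eps / (L2n h + 1))%:E)%E.
  by near: r; exact: small.
have pd : in_Lp 2 (x (clamp T r) \- x (clamp T t)).
  by apply: in_LpB; rewrite ?ler1n//; apply: px.
move: sm; rewrite Lp_norm2E// lte_fin -/(L2n _) => sm.
rewrite distrC -innerBl//; [|exact: px|exact: px].
apply: le_lt_trans (normr_inner_le pd ph) _.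
apply: (@le_lt_trans _ _ (L2n (x (clamp T r) \- x (clamp T t)) * (L2n h + 1))).
  by rewrite ler_wpM2l ?L2n_ge0// lerDl.
by rewrite -ltr_pdivlMr.
Unshelve. all: by end_near. Qed.

End L2_paths.

Section span_coordinates.
Context {R : realType} {d : nat}.
Hypothesis hd : d = 1%N \/ d = 2%N.
Variables (lam : nat -> R) (e : nat -> fn R d).
Hypothesis hbasis : eigenbasis lam e.
Variable N : nat.
Implicit Types (u v : fn R d).

Definition coords u : 'I_N -> R := fun i => inner u (e i).

Let pe i : in_Lp 2 (e i). Proof. exact: (eigenbasis_L2 hbasis). Qed.

Lemma in_span_coords u : in_span e N u -> eq_L u (comb e (coords u)).
Proof.
move=> [pu [a ua]].
suff -> : coords u = a by [].
apply/funext => j; rewrite /coords (inner_eq_L _ _ _ ua).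
- exact: (inner_comb_ord hbasis).
- exact: in_Lp_measurable pu.
- exact: in_Lp_measurable (comb_L2 hbasis a).
- exact: in_Lp_measurable (pe j).
Qed.

Lemma in_span_L4 u : in_span e N u -> in_Lp 4 u.
Proof.
move=> su; have us := in_span_coords su; have [pu _] := su.
have [p4 _] := comb_L4 hd hbasis (coords u).
apply/in_LpP; split; first exact: in_Lp_measurable pu.
have /in_LpP[m4 i4] := p4.
rewrite (ae_eq_integral (fun x => (`|comb e (coords u) x| ^+ 4)%:E))//.
- apply/measurable_EFinP; apply: measurable_funX; apply: measurableT_comp => //.
  exact: in_Lp_measurable pu.
- by apply/measurable_EFinP; apply: measurable_funX; exact: measurableT_comp.
- by apply: filterS us => x -> _.
Qed.

Lemma inner_span u h : in_span e N u -> in_Lp 2 h ->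
  inner u h = inner (comb e (coords u)) h.
Proof.
move=> su ph; apply: inner_eq_L; last exact: in_span_coords.
- by have [pu _] := su; exact: in_Lp_measurable pu.
- exact: in_Lp_measurable (comb_L2 hbasis _).
- exact: in_Lp_measurable ph.
Qed.

Lemma hdot1_span u : in_span e N u ->
  hdot_sqnorm lam e 1 u = (\sum_(i < N) lam i * coords u i ^+ 2)%:E.
Proof.
move=> su; rewrite -(hdot1_comb hbasis); apply: eq_eseriesr => i _.
by rewrite (inner_span su).
Qed.

Lemma sqnorm_span u : in_span e N u -> inner u u = \sum_(i < N) coords u i ^+ 2.
Proof.
move=> su; have [pu _] := su; rewrite (inner_span su pu) innerC (inner_span su); last exact: (comb_L2 hbasis).
by rewrite (inner_comb hbasis); apply: eq_bigr => i _; rewrite expr2.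
Qed.

Section V1_span.
Variables (c0 c1 c2 c3 : R) (f : R -> R).
Hypothesis hf : f = fun x => c3 * x ^+ 3 + c2 * x ^+ 2 + c1 * x + c0.
Variable F : fn R d -> R.
Hypothesis hF : potential f F.

Lemma V1_coords C1 u v : in_span e N u -> in_span e N v ->
  V1 lam e F C1 u v = (\sum_(i < N) lam i * coords u i ^+ 2) / 2 +
    (\sum_(i < N) coords v i ^+ 2) / 2 + F (comb e (coords u)) + C1.
Proof.
move=> su sv; rewrite /V1 hdot1_span//= sqnorm_span//.
congr (_ + _ + _).
apply: (potential_eq_L hf hF); [exact: in_span_L4|by have [] := comb_L4 hd hbasis (coords u)|].
exact: in_span_coords.
Qed.

Lemma force_span u (i : nat) : in_span e N u ->
  inner (f \o u) (e i) = inner (f \o comb e (coords u)) (e i).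
Proof.
move=> su; have [pu _] := su; apply: inner_eq_L.
- exact: measurable_cubic hf _ (in_Lp_measurable pu).
- exact: measurable_cubic hf _ (in_Lp_measurable (comb_L2 hbasis _)).
- exact: in_Lp_measurable (pe i).
- by apply: filterS (in_span_coords su) => x /= ->.
Qed.

End V1_span.

End span_coordinates.

(** * The stochastic convolution, path by path *)

Section stochastic_integral.
Context {R : realType} {d : nat}.
Variables (lam : nat -> R) (e : nat -> fn R d).
Hypothesis hbasis : eigenbasis lam e.
Context {dsp : measure_display} {Omega : measurableType dsp}.
Variables (P : probability Omega R) (Fil : R -> set (set Omega)).
Variables (W : R -> Omega -> fn R d) (Q : fn R d -> fn R d).
Hypotheses (hFil : filtration Fil) (hW : Q_wiener P Fil Q W).
Local Notation leb := (@lebesgue_measure R).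

Let pe i : in_Lp 2 (e i). Proof. exact: (eigenbasis_L2 hbasis). Qed.

(** The frequencies of the wave group: the i-th mode is a harmonic oscillator. *)
Definition freq (i : nat) : R := Num.sqrt (lam i).

Lemma freq_neq0 i : freq i != 0.
Proof. by rewrite gt_eqF// sqrtr_gt0; exact: (eigenvalue_gt0 hbasis). Qed.

Definition noise (w : Omega) (i : nat) (t : R) : R := inner (W t w) (e i).

(** The noise and the nonlinearity enter through the velocity component. *)
Lemma wave_group_kick N (t : R) (h : fn R d) :
  wave_group lam e N t (cst 0, h) =
  (comb e (fun i : 'I_N => sin (t * freq i) / freq i * inner h (e i)),
   comb e (fun i : 'I_N => cos (t * freq i) * inner h (e i))).
Proof.
by congr pair; apply/funext => x; rewrite /= /spectral /comb -big_split/=;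
  apply: eq_bigr => i _; rewrite inner0l mulr0 mul0r add0r.
Qed.

Lemma wiener_increment s t w i : 0 <= s -> 0 <= t ->
  inner (W t w \- W s w) (e i) = noise w i t - noise w i s.
Proof. by move=> s0 t0; rewrite innerBl//; exact: (wiener_L2 hW). Qed.

Lemma adapted_inner (D : set R) (X : R -> Omega -> fn R d) t h : adapted Fil D X -> D t ->
  in_Lp 2 h -> measurable_wrt (Fil t) (fun w => inner (X t w) h).
Proof.
move=> aX Dt ph B mB; apply: sub_sigma_algebra; apply: (aX t Dt).
by apply: sub_sigma_algebra; exists h, B.
Qed.

Lemma filtration_generated t : 0 <= t -> <<s Fil t >> = Fil t.
Proof. by move=> t0; apply: sigma_algebra_id; have [H _ _] := hFil; exact: H. Qed.

Lemma noise_adapted t i : 0 <= t -> measurable_wrt (Fil t) (fun w => noise w i t).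
Proof.
move=> t0; apply: (adapted_inner (wiener_adapted hW)) => //.
by rewrite /= in_itv/= t0.
Qed.

Lemma measurable_wrt_Fil t (X : Omega -> R) : 0 <= t -> measurable_wrt (Fil t) X ->
  measurable_fun setT X.
Proof.
move=> t0 mX _ B mB; rewrite setTI; have [_ sub _] := hFil; apply: (sub t t0).
by rewrite -(filtration_generated t0); exact: mX.
Qed.

Lemma noise_measurable t i : 0 <= t -> measurable_fun setT (fun w => noise w i t).
Proof. by move=> t0; exact: (measurable_wrt_Fil t0 (noise_adapted i t0)). Qed.

Definition noise_path T w i : R -> R := fun r => noise w i (clamp T r).

Lemma noise_path_ae T : 0 <= T ->
  {ae P, forall w, forall i, continuous (noise_path T w i) /\ noise_path T w i 0 = 0}.
Proof.
move=> T0; apply: filterS2 (wiener_continuous hW) (wiener_0 hW) => w cw w0 i; split.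
  apply: (@L2_continuous_inner _ _ `[0, +oo[%classic (fun t => W t w) (e i) T T0) => //.
  - by move=> r; rewrite /= !in_itv/= andbT => /andP[].
  - by move=> r; rewrite /= in_itv/= andbT; exact: (wiener_L2 hW).
rewrite /noise_path clamp_id ?lexx// /noise -[RHS](inner0l (e i)); apply: inner_eq_L => //.
- by apply: (@in_Lp_measurable _ _ 2); exact: (wiener_L2 hW).
- exact: in_Lp_measurable (pe i).
Qed.

(** The Riemann sums of the stochastic integral of phi against the i-th
    coordinate of W. *)
Definition noise_sum (phi : R -> R) i t n w : R :=
  \sum_(k < n) phi (t * k%:R / n%:R) * (noise w i (t * k.+1%:R / n%:R) - noise w i (t * k%:R / n%:R)).

Let grid_ge0 (t : R) (n k : nat) : 0 <= t -> 0 <= t * k%:R / n%:R.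
Proof. by move=> t0; rewrite !mulr_ge0// invr_ge0. Qed.

Lemma noise_sum_measurable phi i t n : 0 <= t -> measurable_fun setT (noise_sum phi i t n).
Proof.
move=> t0; apply: measurable_sum => k; apply: measurable_funM => //.
by apply: measurable_funB; apply: noise_measurable; exact: grid_ge0.
Qed.

Lemma noise_sum_cvg T t i w (phi phi' : R -> R) : 0 <= t <= T ->
  continuous (noise_path T w i) -> continuous phi' ->
  (forall r : R, is_derive r 1 phi (phi' r)) ->
  noise_sum phi i t n w @[n --> \oo] -->
  phi t * noise_path T w i t - phi 0 * noise_path T w i 0
    - \int[leb]_(r in `[0, t]) (noise_path T w i r * phi' r).
Proof.
move=> /andP[t0 tT] cb cphi' dphi.
rewrite (_ : (fun n => _) = (fun n => \sum_(k < n) phi (t * k%:R / n%:R) *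
  (noise_path T w i (t * k.+1%:R / n%:R) - noise_path T w i (t * k%:R / n%:R)))).
  exact: stieltjes_sum_cvg.
apply/funext => n; apply: eq_bigr => k _; rewrite /noise_path.
have n0 : 0 < n%:R :> R by rewrite ltr0n (leq_trans _ (ltn_ord k)).
have in_t (j : nat) : (j <= n)%N -> 0 <= t * j%:R / n%:R <= T.
  move=> jn; rewrite grid_ge0//=; apply: le_trans tT.
  by rewrite ler_pdivrMr// ler_wpM2l// ler_nat.
by rewrite !clamp_id//; apply: in_t; [exact: ltnW|].
Qed.

(** Path by path, the Riemann sums of the stochastic convolution converge to
    an ordinary integral; they also converge to Z in mean square, and the two
    limits agree almost surely. *)
Lemma wiener_integral_coord (T : R) N (t : R) (Z : Omega -> fn R d * fn R d) : 0 <= t <= T ->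
  wiener_integral P W t (fun s h => wave_group lam e N (t - s) (cst 0, h)) Z ->
  {ae P, forall w, forall i : 'I_N,
    inner (Z w).1 (e i) =
      \int[leb]_(r in `[0, t]) (noise_path T w i r * cos ((t - r) * freq i)) /\
    inner (Z w).2 (e i) = noise w i t -
      \int[leb]_(r in `[0, t]) (noise_path T w i r * (freq i * sin ((t - r) * freq i)))}.
Proof.
move=> tT [pZ sZ1 sZ2 cvgZ]; have /andP[t0 t1] := tT.
have T0 : 0 <= T by exact: le_trans t1.
pose k1 (i : nat) (r : R) := sin ((t - r) * freq i) / freq i.
pose k2 (i : nat) (r : R) := cos ((t - r) * freq i).
have dlin (om r : R) : is_derive r 1 (fun r : R => (t - r) * om) (- om).
  by apply: is_derive_eq; rewrite /GRing.scale/=; ring.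
have dk1 (i : nat) (r : R) : is_derive r 1 (k1 i) (- cos ((t - r) * freq i)).
  have D := @is_derive1_comp R sin (fun r => (t - r) * freq i) r _ _ (is_derive_sin _) (dlin (freq i) r).
  apply: is_derive_eq; rewrite /GRing.scale/=; field; exact: freq_neq0.
have dk2 (i : nat) (r : R) : is_derive r 1 (k2 i) (freq i * sin ((t - r) * freq i)).
  have D := @is_derive1_comp R cos (fun r => (t - r) * freq i) r _ _ (is_derive_cos _) (dlin (freq i) r).
  by apply: is_derive_eq; ring.
have ccos i : continuous (fun r : R => cos ((t - r) * freq i)).
  by move=> r; exact: is_derive_continuous (dk2 i r).
have csin i : continuous (fun r : R => freq i * sin ((t - r) * freq i)).
  move=> r; apply: cvgM; first exact: cvg_cst.
  have c1 := is_derive_continuous (dk1 i r).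
  rewrite (_ : (fun r => sin _) = (fun r => k1 i r * freq i)); last first.
    by apply/funext => x; rewrite /k1 divfK// freq_neq0.
  rewrite (_ : sin _ = k1 i r * freq i); last by rewrite /k1 divfK// freq_neq0.
  by apply: cvgM; [exact: c1|exact: cvg_cst].
have comb_sum n w (pr : fn R d * fn R d -> fn R d) (k : nat -> R -> R) :
    (forall s h, pr (wave_group lam e N (t - s) (cst 0, h)) =
       comb e (fun i : 'I_N => k i s * inner h (e i))) ->
    (fun x => \sum_(j < n) pr (wave_group lam e N (t - t * j%:R / n%:R)
      (cst 0, W (t * j.+1%:R / n%:R) w \- W (t * j%:R / n%:R) w)) x) =
    comb e (fun i : 'I_N => noise_sum (k i) i t n w).
  move=> prE; apply/funext => x; rewrite /comb /noise_sum.
  under [RHS]eq_bigr do rewrite mulr_suml.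
  rewrite exchange_big/=; apply: eq_bigr => j _; rewrite prE /comb.
  by apply: eq_bigr => i _; rewrite wiener_increment//; exact: grid_ge0.
have sq_le (z : fn R d) (a : 'I_N -> R) (i : 'I_N) : in_Lp 2 z ->
    (a i - inner z (e i)) ^+ 2 <= inner (comb e a \- z) (comb e a \- z).
  move=> pz; have pa := comb_L2 hbasis a.
  have pd : in_Lp 2 (comb e a \- z) by apply: in_LpB; rewrite ?ler1n.
  rewrite -(inner_comb_ord hbasis a i) -innerBl//.
  by apply: le_trans (inner_CS pd (pe i)) _; rewrite (eigenbasis_orthonormal hbasis) eqxx mulr1.
have main (pr : fn R d * fn R d -> fn R d) (k k' : nat -> R -> R) (i : 'I_N) :
    (forall w, in_Lp 2 (pr (Z w))) ->
    measurable_fun setT (fun w => inner (pr (Z w)) (e i)) ->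
    (forall n w, ((noise_sum (k i) i t n w - inner (pr (Z w)) (e i)) ^+ 2)%:E <=
      (inner ((fun x => \sum_(j < n) (wave_group lam e N (t - t * j%:R / n%:R)
          (cst 0, W (t * j.+1%:R / n%:R) w \- W (t * j%:R / n%:R) w)).1 x) \- (Z w).1)
        ((fun x => \sum_(j < n) (wave_group lam e N (t - t * j%:R / n%:R)
          (cst 0, W (t * j.+1%:R / n%:R) w \- W (t * j%:R / n%:R) w)).1 x) \- (Z w).1) +
      inner ((fun x => \sum_(j < n) (wave_group lam e N (t - t * j%:R / n%:R)
          (cst 0, W (t * j.+1%:R / n%:R) w \- W (t * j%:R / n%:R) w)).2 x) \- (Z w).2)
        ((fun x => \sum_(j < n) (wave_group lam e N (t - t * j%:R / n%:R)
          (cst 0, W (t * j.+1%:R / n%:R) w \- W (t * j%:R / n%:R) w)).2 x) \- (Z w).2))%:E)%E ->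
    (forall r : R, is_derive r 1 (k i) (k' i r)) -> continuous (k' i) ->
    {ae P, forall w, inner (pr (Z w)) (e i) = k i t * noise_path T w i t -
      \int[leb]_(r in `[0, t]) (noise_path T w i r * k' i r)}.
  move=> ppr mpr le_sq dk ck.
  pose lim w := k i t * noise_path T w i t - k i 0 * noise_path T w i 0
    - \int[leb]_(r in `[0, t]) (noise_path T w i r * k' i r).
  have H : {ae P, forall w, (lim w - inner (pr (Z w)) (e i)) ^+ 2 = 0}.
    apply: (@fatou_ae_eq0 _ _ _ P (fun n w => (noise_sum (k i) i t n w - inner (pr (Z w)) (e i)) ^+ 2)).
    - move=> n; apply: measurable_funX; apply: measurable_funB => //.
      exact: noise_sum_measurable.
    - by move=> n w; exact: sqr_ge0.
    - apply: filterS (noise_path_ae T0) => w /(_ i) [cb b0].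
      have c := noise_sum_cvg tT cb ck dk.
      rewrite expr2; under eq_fun do rewrite expr2.
      by apply: cvgM; apply: cvgB => //; exact: cvg_cst.
    - have S0 : (fun _ : nat => 0%E : \bar R) n @[n --> \oo] --> (0%E : \bar R) by exact: cvg_cst.
      apply: squeeze_cvge S0 cvgZ; apply: nearW => n.
      rewrite integral_ge0 => [|w _]; last by rewrite lee_fin sqr_ge0.
      by apply: le_integral_nonmeasurable => w; [rewrite lee_fin sqr_ge0|exact: le_sq].
  apply: filterS2 H (noise_path_ae T0) => w Hw /(_ i) [_ b0].
  move/eqP: Hw; rewrite sqrf_eq0 subr_eq0 => /eqP <-.
  by rewrite /lim b0 mulr0 subr0.
have mZ1 (i : 'I_N) : measurable_fun setT (fun w => inner (Z w).1 (e i)).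
  move=> _ B mB; rewrite setTI; apply: sZ1; apply: sub_sigma_algebra.
  by exists (e i), B.
have mZ2 (i : 'I_N) : measurable_fun setT (fun w => inner (Z w).2 (e i)).
  move=> _ B mB; rewrite setTI; apply: sZ2; apply: sub_sigma_algebra.
  by exists (e i), B.
have S1 n w := comb_sum n w fst k1 (fun s h => f_equal fst (wave_group_kick N (t - s) h)).
have S2 n w := comb_sum n w snd k2 (fun s h => f_equal snd (wave_group_kick N (t - s) h)).
have p1 w : in_Lp 2 (Z w).1 by have [] := pZ w.
have p2 w : in_Lp 2 (Z w).2 by have [] := pZ w.
have ae1 (i : 'I_N) := main fst k1 (fun i r => - cos ((t - r) * freq i)) i p1 (mZ1 i) _ (dk1 i).
have ae2 (i : 'I_N) := main snd k2 (fun i r => freq i * sin ((t - r) * freq i)) i p2 (mZ2 i) _ (dk2 i).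
have A1 (i : 'I_N) : {ae P, forall w, inner (Z w).1 (e i) = k1 i t * noise_path T w i t -
      \int[leb]_(r in `[0, t]) (noise_path T w i r * - cos ((t - r) * freq i))}.
  apply: ae1; last by move=> r; apply: cvgN; exact: ccos.
  move=> j n w; rewrite S1 S2 lee_fin; apply: le_trans (sq_le _ (fun i => noise_sum (k1 i) i t n w) j (p1 w)) _.
  by rewrite lerDl inner_ge0.
have A2 (i : 'I_N) : {ae P, forall w, inner (Z w).2 (e i) = k2 i t * noise_path T w i t -
      \int[leb]_(r in `[0, t]) (noise_path T w i r * (freq i * sin ((t - r) * freq i)))}.
  apply: ae2; last exact: csin.
  move=> j n w; rewrite S1 S2 lee_fin; apply: le_trans (sq_le _ (fun i => noise_sum (k2 i) i t n w) j (p2 w)) _.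
  by rewrite lerDr inner_ge0.
have FF : Filter (almost_everywhere P) by exact: ae_filter_ringOfSetsType.
have B1 := @filter_forall Omega _ _ (almost_everywhere P) FF A1; have B2 := @filter_forall Omega _ _ (almost_everywhere P) FF A2.
apply: filterS3 B1 B2 (noise_path_ae T0) => w H1 H2 Hc i.
have [cb _] := Hc i; rewrite H1 H2 /k1 /k2 subrr !mul0r sin0 cos0 mul0r mul0r mul1r sub0r; split.
  rewrite -mulN1r -RintegralZl//.
    by apply: eq_Rintegral => r _; ring.
  apply: integrable_continuous_itv => r; apply: cvgM; first exact: cb.
  by apply: cvgN; exact: ccos.
by congr (_ - _); rewrite /noise_path clamp_id.
Qed.

End stochastic_integral.

(** * Galerkin solutions as perturbed oscillators *)

Section galerkin_paths.
Context {R : realType} {d : nat}.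
Hypothesis hd : d = 1%N \/ d = 2%N.
Variables (lam : nat -> R) (e : nat -> fn R d).
Hypothesis hbasis : eigenbasis lam e.
Variables (c0 c1 c2 c3 : R) (f : R -> R).
Hypothesis hf : f = fun x => c3 * x ^+ 3 + c2 * x ^+ 2 + c1 * x + c0.
Context {dsp : measure_display} {Omega : measurableType dsp}.
Variables (P : probability Omega R) (Fil : R -> set (set Omega)).
Variables (W : R -> Omega -> fn R d) (Q : fn R d -> fn R d).
Hypotheses (hFil : filtration Fil) (hW : Q_wiener P Fil Q W).
Variables (u0 v0 : fn R d) (T : R) (N : nat) (u v : R -> Omega -> fn R d).
Hypothesis T0 : 0 <= T.
Hypothesis huv : galerkin_mild_solution P Fil lam e f u0 v0 T W N u v.
Local Notation leb := (@lebesgue_measure R).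
Local Notation freq := (freq lam).
Local Notation noise := (noise e W).
Local Notation noise_path := (noise_path e W T).

Let pe i : in_Lp 2 (e i). Proof. exact: (eigenbasis_L2 hbasis). Qed.

Let clamp_itv r : clamp T r \in `[0, T]%R.
Proof. by rewrite in_itv/=; exact: clamp_in. Qed.

Definition ucoord w (i : nat) t : R := inner (u (clamp T t) w) (e i).
Definition vcoord w (i : nat) t : R := inner (v (clamp T t) w) (e i).
Definition force_path w (i : nat) t : R := - inner (f \o u (clamp T t) w) (e i).

Lemma galerkin_path_continuous : {ae P, forall w, forall i, [/\ continuous (ucoord w i),
  continuous (vcoord w i) & continuous (force_path w i)]}.
Proof.
apply: filterS (galerkin_continuous huv) => w [cu cv] i.
have pu t : `[0, T]%classic t -> in_Lp 2 (u t w).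
  by move=> tT; have [[]] := galerkin_span huv w tT.
have pv t : `[0, T]%classic t -> in_Lp 2 (v t w).
  by move=> tT; have [_ []] := galerkin_span huv w tT.
have cU (j : nat) : continuous (ucoord w j) by exact: L2_continuous_inner T0 _ pu (pe j) cu.
split; [exact: cU|exact: L2_continuous_inner T0 _ pv (pe i) cv|] => t.
rewrite /force_path (_ : (fun t => _) = (fun t => - inner (f \o comb e (fun j : 'I_N => ucoord w j t)) (e i))).
  apply: cvgN.
  have p4 j : in_Lp 4 (e j) := eigen_in_L4 hd hbasis j.
  exact: (@cvg_inner_cubic _ _ _ _ _ _ _ hf _ _ _ N (fun j => ucoord w j) (fun j => ucoord w j t)
    (fun j : 'I_N => e j) (e i) (fun j => p4 j) (p4 i) (fun j => cU j t)).
apply/funext => r; have [su _] := galerkin_span huv w (clamp_itv r).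
by rewrite (force_span hbasis hf i su).
Qed.

Lemma Rintegral_comb (K : nat -> R -> R) t : (forall i, continuous (K i)) ->
  (fun x => \int[leb]_(r in `[0, t]) comb e (fun i : 'I_N => K i r) x) =
  comb e (fun i : 'I_N => \int[leb]_(r in `[0, t]) K i r).
Proof.
move=> cK; apply/funext => x; rewrite /comb.
have iK (i : nat) : leb.-integrable `[0, t] (EFin \o (fun r => K i r * e i x)).
  by apply: integrable_continuous_itv => r; apply: cvgM; [exact: cK|exact: cvg_cst].
have E i : (\int[leb]_(r in `[0, t]) K i r) * e i x = \int[leb]_(r in `[0, t]) (K i r * e i x).
  by rewrite RintegralZr//; exact: integrable_continuous_itv.
under [RHS]eq_bigr do rewrite E.
elim: (index_enum _) => [|i r IH].
  rewrite big_nil (@eq_Rintegral _ _ _ leb _ (cst 0)) => [|r _]; last by rewrite big_nil.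
  by rewrite Rintegral_cst// mul0r.
rewrite big_cons -IH -RintegralD//; first by apply: eq_Rintegral => y _; rewrite big_cons.
elim: r {IH} => [|j r IH].
  rewrite (_ : _ \o _ = cst 0%E); first exact: integrable0.
  by apply/funext => y; rewrite /= big_nil.
rewrite (_ : _ \o _ = (EFin \o (fun r => K j r * e j x)%R) \+ (EFin \o (fun y => \sum_(i <- r) K i y * e i x)%R))%E.
  exact: integrableD.
by apply/funext => y; rewrite /= big_cons.
Qed.

Lemma spectral_comb (g : R -> R) (z : fn R d) :
  spectral lam e g N z = comb e (fun i : 'I_N => g (lam i) * inner z (e i)).
Proof. by []. Qed.

Lemma combD (a b : 'I_N -> R) : comb e a \+ comb e b = comb e (fun i : 'I_N => a i + b i).
Proof.
by apply/funext => x; rewrite /= /comb -big_split/=; apply: eq_bigr => i _; rewrite mulrDl.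
Qed.

Lemma wave_group_coords t (x y : 'I_N -> R) :
  wave_group lam e N t (comb e x, comb e y) =
  (comb e (fun i : 'I_N => cos (t * freq i) * x i + sin (t * freq i) / freq i * y i),
   comb e (fun i : 'I_N => - (freq i * sin (t * freq i)) * x i + cos (t * freq i) * y i)).
Proof.
rewrite /wave_group !spectral_comb !combD.
by congr pair; congr comb; apply/funext => i; rewrite !(inner_comb_ord hbasis).
Qed.

Let x0 i := inner u0 (e i).
Let y0 i := inner v0 (e i).

Lemma galerkin_projE z : galerkin_proj lam e N z = comb e (fun i : 'I_N => inner z (e i)).
Proof. by rewrite /galerkin_proj spectral_comb; congr comb; apply/funext => i; rewrite mul1r. Qed.

Lemma inner_mild (z z1 z2 z' : fn R d) (a b : 'I_N -> R) (i : 'I_N) : in_Lp 2 z -> in_Lp 2 z' ->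
  z1 = comb e a -> z2 = comb e b -> eq_L z (fun x => z1 x - z2 x + z' x) ->
  inner z (e i) = a i - b i + inner z' (e i).
Proof.
move=> pz pz' -> -> E; have pa := comb_L2 hbasis a; have pb := comb_L2 hbasis b.
have pab : in_Lp 2 (comb e a \- comb e b) by apply: in_LpB; rewrite ?ler1n.
rewrite (inner_eq_L _ _ _ E).
- rewrite -[X in inner X _]/((comb e a \- comb e b) \+ z') innerDl// innerBl//.
  by rewrite !(inner_comb_ord hbasis).
- exact: in_Lp_measurable pz.
- by apply: (@in_Lp_measurable _ _ 2); apply: in_LpD; rewrite ?ler1n.
- exact: in_Lp_measurable (pe i).
Qed.

(** The mild formulation, tested against e_i, is the variation of constants
    formula of oscillator_mild. *)
Lemma mild_coords t : 0 <= t <= T -> {ae P, forall w, forall i : 'I_N,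
  ucoord w i t = cos (t * freq i) * x0 i + sin (t * freq i) / freq i * y0 i
        + \int[leb]_(r in `[0, t]) (sin ((t - r) * freq i) / freq i * force_path w i r)
        + \int[leb]_(r in `[0, t]) (noise_path w i r * cos ((t - r) * freq i)) /\
  vcoord w i t = - (freq i * sin (t * freq i)) * x0 i + cos (t * freq i) * y0 i
        + \int[leb]_(r in `[0, t]) (cos ((t - r) * freq i) * force_path w i r)
        - \int[leb]_(r in `[0, t]) (noise_path w i r * (freq i * sin ((t - r) * freq i)))
        + noise_path w i t}.
Proof.
move=> tT; have /andP[t0 t1] := tT.
have tin : t \in `[0, T]%R by rewrite in_itv.
have [Z hZ mild] := galerkin_mild huv tin.
have [pZ _ _ _] := hZ.
have := wiener_integral_coord hbasis hFil hW tT hZ.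
apply: filterS3 mild galerkin_path_continuous => w [Eu Ev] cw HZ i.
have [HZ1 HZ2] := HZ i.
have lin (om : R) : continuous (fun r : R => (t - r) * om).
  by move=> r; apply: cvgM; [apply: cvgB; [exact: cvg_cst|exact: cvg_id]|exact: cvg_cst].
have cs (j : nat) : continuous (fun r : R => sin ((t - r) * freq j) / freq j).
  move=> r; apply: cvgM; last exact: cvg_cst.
  by apply: (continuous_comp (lin (freq j) r)); exact: continuous_sin.
have cc (j : nat) : continuous (fun r : R => cos ((t - r) * freq j)).
  by move=> r; apply: (continuous_comp (lin (freq j) r)); exact: continuous_cos.
have drift (pr : fn R d * fn R d -> fn R d) (k : nat -> R -> R) :
    (forall i, continuous (k i)) ->
    (forall s h, pr (wave_group lam e N (t - s) (cst 0, h)) =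
       comb e (fun i : 'I_N => k i s * inner h (e i))) ->
    (fun x => \int[leb]_(r in `[0, t]) pr (wave_group lam e N (t - r) (cst 0, f \o u r w)) x) =
    comb e (fun i : 'I_N => - \int[leb]_(r in `[0, t]) (k i r * force_path w i r)).
  move=> ck prE.
  have cK j : continuous (fun r => k j r * - force_path w j r).
    by move=> r; apply: cvgM; [exact: ck|apply: cvgN; have [_ _ cf] := cw j; exact: cf].
  rewrite (_ : comb e _ = comb e (fun i : 'I_N => \int[leb]_(r in `[0, t]) (k i r * - force_path w i r))).
    rewrite -(@Rintegral_comb (fun j r => k j r * - force_path w j r) t cK).
    apply/funext => x; apply: eq_Rintegral => r.
    rewrite inE/= in_itv/= => /andP[r0 rt]; rewrite prE; congr (comb e _ x).
    apply/funext => j; rewrite /force_path opprK clamp_id//.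
    by rewrite r0 (le_trans rt).
  congr comb; apply/funext => j.
  under [RHS]eq_Rintegral do rewrite mulrN -mulN1r.
  rewrite RintegralZl ?mulN1r//.
  apply: integrable_continuous_itv => r; apply: cvgM; first exact: ck.
  by have [_ _ cf] := cw j; exact: cf.
have D1 := drift fst _ cs (fun s h => f_equal fst (wave_group_kick lam e N (t - s) h)).
have D2 := drift snd _ cc (fun s h => f_equal snd (wave_group_kick lam e N (t - s) h)).
rewrite !galerkin_projE in Eu Ev.
have X := wave_group_coords t (fun i : 'I_N => x0 i) (fun i : 'I_N => y0 i).
have [[pu _] [pv _]] := galerkin_span huv w tin.
have [p1 p2] := pZ w.
rewrite /ucoord /vcoord clamp_id// (inner_mild i pu p1 (f_equal fst X) D1 Eu) (inner_mild i pv p2 (f_equal snd X) D2 Ev) HZ1 HZ2.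
have -> : noise_path w i t = noise w i t by rewrite /noise_path clamp_id.
by rewrite !opprK; split=> //; ring.
Qed.

Lemma mild_coords_rat : {ae P, forall w, forall (q : rat) (i : 'I_N),
  let t := clamp T (ratr q) in
  ucoord w i t = cos (t * freq i) * x0 i + sin (t * freq i) / freq i * y0 i
        + \int[leb]_(r in `[0, t]) (sin ((t - r) * freq i) / freq i * force_path w i r)
        + \int[leb]_(r in `[0, t]) (noise_path w i r * cos ((t - r) * freq i)) /\
  vcoord w i t = - (freq i * sin (t * freq i)) * x0 i + cos (t * freq i) * y0 i
        + \int[leb]_(r in `[0, t]) (cos ((t - r) * freq i) * force_path w i r)
        - \int[leb]_(r in `[0, t]) (noise_path w i r * (freq i * sin ((t - r) * freq i)))
        + noise_path w i t}.
Proof.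
have H (n : nat) := mild_coords (clamp_in T0 (ratr (odflt 0%Q (unpickle n)))).
have := ae_foralln H; apply: filterS => w Hw q.
by have := Hw (pickle q); rewrite pickleK.
Qed.

(** oscillator_mild provides differentiable paths given by the same formula; they
    agree with the solution at rational times, hence by continuity at all
    times.  The second path is the velocity minus the noise. *)
Lemma galerkin_paths : {ae P, forall w, exists U V : 'I_N -> R -> R,
  [/\ forall i, U i 0 = x0 i /\ V i 0 + noise_path w i 0 = y0 i,
   forall i : 'I_N, continuous (noise_path w i),
   forall i t, 0 <= t <= T -> is_derive t 1 (U i) (V i t + noise_path w i t),
   forall i t, 0 <= t <= T -> is_derive t 1 (V i)
     (- (lam i * U i t) - inner (f \o (fun x => \sum_(j < N) U j t * e j x)) (e i)) &
   forall (i : 'I_N) t, 0 <= t <= T -> ucoord w i t = U i t /\ vcoord w i t = V i t + noise_path w i t]}.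
Proof.
apply: filterS3 mild_coords_rat galerkin_path_continuous (noise_path_ae hbasis hW T0) => w Hw cw bw.
have ex (i : 'I_N) : exists UV : (R -> R) * (R -> R),
   [/\ UV.1 0 = x0 i, UV.2 0 = y0 i,
    forall t, 0 <= t <= T -> is_derive t 1 UV.1 (UV.2 t + noise_path w i t),
    forall t, 0 <= t <= T -> is_derive t 1 UV.2 (- (lam i * UV.1 t) + force_path w i t) &
    forall t, 0 <= t <= T -> ucoord w i t = UV.1 t /\ vcoord w i t = UV.2 t + noise_path w i t].
  have [cu cv cf] := cw i; have [cb _] := bw i.
  have [U [V [U0 V0 dU dV UV]]] := oscillator_mild (x0 i) (y0 i) (freq_neq0 hbasis i) cf cb.
  have m1 (t : R) : 0 <= t -> -1 < t by move=> t0; apply: lt_le_trans t0; rewrite oppr_lt0 ltr01.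
  have cl t : 0 <= clamp T t by have /andP[] := clamp_in T0 t.
  have cUc : continuous (fun t => U (clamp T t)).
    move=> t; apply: (continuous_comp (f := clamp T)); first exact: clamp_continuous.
    exact: is_derive_continuous (dU _ (m1 _ (cl t))).
  have cVc : continuous (fun t => V (clamp T t) + noise_path w i t).
    move=> t; apply: cvgD; last exact: cb.
    apply: (continuous_comp (f := clamp T)); first exact: clamp_continuous.
    exact: is_derive_continuous (dV _ (m1 _ (cl t))).
  have clK t : clamp T (clamp T t) = clamp T t by rewrite clamp_id//; exact: clamp_in.
  have EU : ucoord w i =1 (fun t => U (clamp T t)).
    apply: continuous_eq_rat cu cUc _ => q.
    rewrite (UV _ (cl _)).1; have [<- _] := Hw q i.
    by rewrite /ucoord clK.
  have EV : vcoord w i =1 (fun t => V (clamp T t) + noise_path w i t).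
    apply: continuous_eq_rat cv cVc _ => q.
    rewrite (UV _ (cl _)).2; have [_] := Hw q i.
    by rewrite /vcoord /noise_path clK => ->.
  exists (U, V); split => //=.
  - by move=> t /andP[t0 _]; exact: dU _ (m1 _ t0).
  - move=> t /andP[t0 _]; have := dV _ (m1 _ t0).
    by rewrite sqr_sqrtr// ltW// (eigenvalue_gt0 hbasis).
  - by move=> t tT; rewrite EU EV clamp_id.
have [UV HUV] := choice ex.
exists (fun i => (UV i).1), (fun i => (UV i).2); split.
- by move=> i; have [-> -> _ _ _] := HUV i; have [_ ->] := bw i; rewrite addr0.
- by move=> i; have [] := bw i.
- by move=> i; have [_ _ H _ _] := HUV i; exact: H.
- move=> i t tT; have [_ _ _ H _] := HUV i.
  rewrite (_ : - inner _ _ = force_path w i t); first exact: H.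
  rewrite /force_path; have [su _] := galerkin_span huv w (clamp_itv t).
  rewrite (force_span hbasis hf i su); congr (- inner (f \o _) _).
  apply/funext => x; apply: eq_bigr => j _; congr (_ * _).
  by have [_ _ _ _ /(_ t tT)[<- _]] := HUV j.
- by move=> i t tT; have [_ _ _ _ H] := HUV i; exact: H.
Qed.

End galerkin_paths.

(** * Exponential moments of the energy *)

Lemma grid_in {R : realType} (s : R) (n k : nat) : 0 <= s -> (k <= n)%N -> 0 <= s * k%:R / n%:R <= s.
Proof.
move=> s0 kn; apply/andP; split; first by rewrite divr_ge0// mulr_ge0.
case: n kn => [|n] kn; first by rewrite invr0 mulr0.
by rewrite ler_pdivrMr ?ltr0n// ler_wpM2l// ler_nat.
Qed.

Lemma discount_total {R : realType} (s tr : R) n : (0 < n)%N ->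
  discount (s / n%:R) tr n = expR (- (4 * tr * s)).
Proof.
move=> n0; rewrite /discount; congr (expR (- _)).
by rewrite -[LHS]mulrA divfK// pnatr_eq0 -lt0n.
Qed.

Section path_limit.
Context {R : realType} {d : nat}.
Variables (c0 c1 c2 c3 : R) (f : R -> R).
Hypothesis hf : f = fun x => c3 * x ^+ 3 + c2 * x ^+ 2 + c1 * x + c0.
Variable F : fn R d -> R.
Hypothesis hF : potential f F.
Variables (N : nat) (lam : 'I_N -> R) (e : 'I_N -> fn R d).
Hypothesis pe : forall i, in_Lp 4 (e i).
Variables (u w b : 'I_N -> R -> R) (s : R).
Hypothesis s0 : 0 <= s.
Hypothesis cb : forall i, continuous (b i).
Hypothesis du : forall i t, 0 <= t <= s -> is_derive t 1 (u i) (w i t + b i t).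
Hypothesis dw : forall i t, 0 <= t <= s -> is_derive t 1 (w i)
  (- (lam i * u i t) - inner (f \o (fun x => \sum_(j < N) u j t * e j x)) (e i)).
Context {dsp : measure_display} {Omega : measurableType dsp}.
Variables (v xi : nat -> nat -> 'I_N -> Omega -> R) (omega : Omega) (C1 tr : R).
Local Notation energy := (wave_energy F lam e u w b).
Hypothesis vE : forall n k i, (k < n)%N -> v n k i omega =
  w i (s * k%:R / n%:R) + b i (s * k%:R / n%:R).
Hypothesis xiE : forall n k i, (k < n)%N -> xi n k i omega =
  b i (s * k.+1%:R / n%:R) - b i (s * k%:R / n%:R).
Hypothesis kinetic : forall t, 0 <= t <= s ->
  (\sum_(i < N) (w i t + b i t) ^+ 2) / 2 <= energy t + C1.
Local Notation running n := (accum (v n) (xi n) (energy 0 + C1)).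

Let accumE n k : (k <= n)%N -> running n k omega = energy_sum F lam e u w b s n k + C1.
Proof.
move=> kn; rewrite /accum /energy_sum addrAC; congr (_ + _ + _).
apply: eq_bigr => j _; apply: eq_bigr => i _.
have jn : (j < n)%N by exact: leq_trans (ltn_ord j) kn.
by rewrite vE// xiE.
Qed.

(** Along the path the energy and the accumulated sums become uniformly close
    as the mesh tends to 0, so that the control event is eventually realised. *)
Lemma weighted_cvg : weighted (v n) (xi n) (s / n%:R) tr (energy 0 + C1) n omega @[n --> \oo] -->
  expR (expR (- (4 * tr * s)) * (energy s + C1)).
Proof.
have [n0 close] := energy_sum_cvg hf hF pe s0 cb du dw ltr01.
have lim : expR (expR (- (4 * tr * s)) * (energy_sum F lam e u w b s n n + C1)) @[n --> \oo] -->
    expR (expR (- (4 * tr * s)) * (energy s + C1)).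
  apply: continuous_cvg; first exact: continuous_expR.
  apply: cvgM; first exact: cvg_cst.
  apply: cvgD; last exact: cvg_cst.
  apply/cvgrPdist_le => eps eps0.
  have [n1 H] := energy_sum_cvg hf hF pe s0 cb du dw eps0.
  exists n1.+1 => // n /= n1n; have := H n n (ltnW n1n) (leqnn n).
  by rewrite mulfK// pnatr_eq0 -lt0n (leq_ltn_trans _ n1n).
apply: cvg_trans lim; apply: near_eq_cvg; exists n0.+1 => // n /= n0n.
rewrite /weighted discount_total ?(leq_ltn_trans _ n0n)// accumE// controlled_eq1 ?mul1r// => j jn.
rewrite (eq_bigr (fun i => (w i (s * j%:R / n%:R) + b i (s * j%:R / n%:R)) ^+ 2)).
  apply: le_trans (kinetic (grid_in s0 (ltnW jn))) _.
  rewrite accumE ?(ltnW jn)// [leRHS]addrAC lerD2r -lerBlDl.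
  by apply: le_trans (ler_norm _) _; apply: close; exact: ltnW.
by move=> i _; rewrite vE.
Qed.

End path_limit.

Section energy_moment.
Context {R : realType} {d : nat}.
Hypothesis hd : d = 1%N \/ d = 2%N.
Variables (lam : nat -> R) (e : nat -> fn R d).
Hypothesis hbasis : eigenbasis lam e.
Variables (c0 c1 c2 c3 : R) (f : R -> R).
Hypothesis hf : f = fun x => c3 * x ^+ 3 + c2 * x ^+ 2 + c1 * x + c0.
Variable F : fn R d -> R.
Hypothesis hF : potential f F.
Variable C1 : R.
Hypothesis F_ge : forall z, in_Lp 4 z -> 0 <= F z + C1.
Context {dsp : measure_display} {Omega : measurableType dsp}.
Variables (P : probability Omega R) (Fil : R -> set (set Omega)).
Variables (W : R -> Omega -> fn R d) (Q : fn R d -> fn R d).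
Hypotheses (hFil : filtration Fil) (hW : Q_wiener P Fil Q W).
Variables (u0 v0 : fn R d) (T : R) (N : nat) (u v : R -> Omega -> fn R d).
Hypotheses (T0 : 0 <= T) (N0 : (0 < N)%N).
Hypothesis huv : galerkin_mild_solution P Fil lam e f u0 v0 T W N u v.
Variable tr : R.
Hypotheses (q0 : forall i, 0 < inner (Q (e i)) (e i))
  (qtr : \sum_(i < N) inner (Q (e i)) (e i) <= tr).

Let pe i : in_Lp 2 (e i). Proof. exact: (eigenbasis_L2 hbasis). Qed.

Definition initial_energy : R := (\sum_(i < N) lam i * inner u0 (e i) ^+ 2) / 2 +
  (\sum_(i < N) inner v0 (e i) ^+ 2) / 2 + F (comb e (fun i : 'I_N => inner u0 (e i))).

Let increments r t := [set A | exists h B, [/\ in_Lp 2 h, measurable B &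
  A = (fun w => inner ((W t w \- W r w) : fn R d) h) @^-1` (B : set R)]].

Let increments_measurable r t : 0 <= r -> 0 <= t -> <<s increments r t >> `<=` measurable.
Proof.
move=> r0 t0; apply: smallest_sub; first exact: sigma_algebra_measurable.
move=> _ [h [B [ph mB ->]]].
have mW x : 0 <= x -> measurable_fun setT (fun w => inner (W x w) h).
  move=> x0; apply: (measurable_wrt_Fil hFil x0).
  by apply: (adapted_inner (wiener_adapted hW)) => //; rewrite /= in_itv/= x0.
rewrite -[X in measurable X]setTI.
rewrite (_ : (fun w => inner _ h) = (fun w => inner (W t w) h - inner (W r w) h)).
  by apply: measurable_funB => //; exact: mW.
by apply/funext => w; rewrite innerBl//; exact: (wiener_L2 hW).
Qed.

Let measurable_wrt_le r t (X : Omega -> R) : 0 <= r -> r <= t ->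
  measurable_wrt (Fil r) X -> measurable_wrt (Fil t) X.
Proof.
move=> r0 rt mX B mB; have := mX B mB.
rewrite !(filtration_generated hFil) ?(le_trans r0)//.
by have [_ _ mono] := hFil; exact: mono.
Qed.

(** For each mesh, weighted_le bounds the expectation of the discounted
    exponential on the control event, and weighted_cvg identifies its almost sure
    limit; Fatou's lemma concludes. *)
Lemma energy_moment s : 0 <= s <= T ->
  (\int[P]_w (expR (V1 lam e F C1 (u s w) (v s w) / expR (4 * tr * s)))%:E <=
   (expR (initial_energy + C1 + 1 + 2 * tr * s))%:E)%E.
Proof.
move=> sT; have /andP[s0 s1] := sT.
pose t n k : R := s * k%:R / n%:R.
have t0 n k : 0 <= t n k by rewrite divr_ge0// mulr_ge0.
have tS n k : t n k <= t n k.+1 by rewrite ler_wpM2r ?invr_ge0// ler_wpM2l// ler_nat.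
(* vcoord is clamped at T: mesh points beyond s may exceed the horizon, and
   adaptedness is only known before T *)
pose vv n k (i : 'I_N) w := vcoord e T v w i (t n k).
pose xi n k (i : 'I_N) w := inner (W (t n k.+1) w \- W (t n k) w) (e i).
have xiE n k i w : xi n k i w = noise e W w i (t n k.+1) - noise e W w i (t n k).
  by rewrite /xi (wiener_increment hbasis hW).
have mxiA n k i : measurable_wrt (Fil (t n k.+1)) (xi n k i).
  rewrite (_ : xi n k i = fun w => noise e W w i (t n k.+1) - noise e W w i (t n k)); last first.
    by apply/funext => w; exact: xiE.
  have m1 := noise_adapted hbasis hW i (t0 n k.+1).
  have m2 := measurable_wrt_le (t0 n k) (tS n k) (noise_adapted hbasis hW i (t0 n k)).
  move=> B mB.
  have mm := measurable_funB (measurable_wrtP m1) (measurable_wrtP m2).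
  by have := mm measurableT B mB; rewrite setTI.
have mv n k i : measurable_wrt (Fil (t n k)) (vv n k i).
  have /andP[cl0 _] := clamp_in T0 (t n k).
  apply: (@measurable_wrt_le (clamp T (t n k))) => //.
    by rewrite /clamp ge_max t0 ge_min lexx.
  apply: (adapted_inner (galerkin_adapted huv).2) => //.
  by rewrite /= in_itv/=; exact: clamp_in.
have sA n k : <<s Fil (t n k) >> `<=` measurable.
  by rewrite (filtration_generated hFil)//; have [_ H _] := hFil; exact: H.
have AS n k : <<s Fil (t n k) >> `<=` <<s Fil (t n k.+1) >>.
  by rewrite !(filtration_generated hFil)//; have [_ _ H] := hFil; exact: H.
pose Y n w := weighted (vv n) (xi n) (s / n%:R) tr (initial_energy + C1) n w.
apply: (@fatou_ae _ _ _ P Y).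
- by move=> n; apply: (weighted_measurable (A := fun k => Fil (t n k))).
- by move=> n w; exact: weighted_ge0.
- apply: filterS (galerkin_paths hd hbasis hf hFil hW T0 huv) => w [U [V [init cb dU dV UV]]].
  have in_T r : 0 <= r <= s -> 0 <= r <= T by move=> /andP[-> rs]; exact: le_trans s1.
  have p4 (i : 'I_N) : in_Lp 4 (e i) := eigen_in_L4 hd hbasis i.
  have E0 : initial_energy = wave_energy F (fun i : 'I_N => lam i) (fun i : 'I_N => e i) U V
      (noise_path e W T w) 0.
    rewrite /initial_energy /wave_energy; congr (_ / 2 + _ / 2 + F _).
    + by apply: eq_bigr => i _; have [-> _] := init i.
    + by apply: eq_bigr => i _; have [_ ->] := init i.
    + by apply/funext => x; apply: eq_bigr => i _; have [-> _] := init i.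
  have ES : V1 lam e F C1 (u s w) (v s w) = wave_energy F (fun i : 'I_N => lam i)
      (fun i : 'I_N => e i) U V (noise_path e W T w) s + C1.
    have sin : s \in `[0, T]%R by rewrite in_itv.
    have [su sv] := galerkin_span huv w sin.
    have cu (i : 'I_N) : coords e (u s w) i = U i s.
      by have [<- _] := UV i s sT; rewrite /ucoord clamp_id.
    have cv (i : 'I_N) : coords e (v s w) i = V i s + noise_path e W T w i s.
      by have [_ <-] := UV i s sT; rewrite /vcoord clamp_id.
    rewrite (V1_coords hd hbasis hf hF C1 su sv) /wave_energy; congr (_ / 2 + _ / 2 + F _ + _).
    + by apply: eq_bigr => i _; rewrite cu.
    + by apply: eq_bigr => i _; rewrite cv.
    + by apply/funext => x; apply: eq_bigr => i _; rewrite cu.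
  rewrite ES /Y E0 [X in expR X]mulrC -expRN.
  apply: (weighted_cvg hf hF p4 s0 cb (fun i r rs => dU i r (in_T r rs))
    (fun i r rs => dV i r (in_T r rs))).
  + move=> n k i kn; rewrite /vv -(UV i _ (in_T _ (grid_in s0 (ltnW kn)))).2 //.
  + move=> n k i kn; rewrite xiE /noise_path !clamp_id//; apply: in_T; apply: grid_in => //.
    exact: ltnW.
  + move=> r rs; rewrite /wave_energy.
    have le4 (a k g c : R) : 0 <= a -> 0 <= g + c -> k <= a + k + g + c by lra.
    apply: le4; last by rewrite F_ge//; apply: in_Lp_sum; rewrite ?ler1n.
    rewrite divr_ge0// sumr_ge0// => i _.
    by rewrite mulr_ge0 ?sqr_ge0// ltW// (eigenvalue_gt0 hbasis).
- by move=> w; exact: expR_ge0.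
- near=> n.
  have n0 : 0 < n%:R :> R by rewrite ltr0n; near: n; exact: nbhs_infty_gt.
  have -> : initial_energy + C1 + 1 + 2 * tr * s =
      initial_energy + C1 + 1 + 2 * tr * (s / n%:R) * n%:R.
    by congr (_ + _); rewrite -[RHS]mulrA divfK// gt_eqF.
  (* the past is Fil at time t_k, the future is generated by the next increment *)
  apply: (@weighted_le _ _ _ P (fun k => Fil (t n k)) (fun k => increments (t n k) (t n k.+1))
    (sA n) _ (AS n) _ N (vv n) (xi n) (fun i : 'I_N => inner (Q (e i)) (e i))) => //.
  + by move=> k; exact: increments_measurable.
  + move=> k X Y0; rewrite (filtration_generated hFil)// => FX SY.
    exact: (wiener_independent hW (t0 n k) (tS n k)).
  + move=> k i B mB; apply: sub_sigma_algebra.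
    by exists (e i), B.
  + by rewrite divr_ge0.
  + rewrite mulrA ler_pdivrMr// mul1r; near: n; exact: nbhs_infty_ger.
  + move=> k i B mB; rewrite (wiener_gaussian hW (t0 n k) (tS n k) (pe i) mB).
    congr (gaussian (_ * _) B); rewrite /t -mulrBl -mulrBr -natr1.
    by rewrite addrAC subrr add0r mulr1.
Unshelve. all: by end_near. Qed.

End energy_moment.

(** * The initial energy, uniformly in the number of modes *)

Section initial_bounds.
Context {R : realType} {d : nat}.
Hypothesis hd : d = 1%N \/ d = 2%N.
Variables (lam : nat -> R) (e : nat -> fn R d).
Hypothesis hbasis : eigenbasis lam e.

Lemma sum_le_nneseries (a : nat -> R) : (forall i, 0 <= a i) ->
  (\sum_(0 <= i <oo) (a i)%:E < +oo)%E ->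
  forall N, \sum_(i < N) a i <= fine (\sum_(0 <= i <oo) (a i)%:E)%E.
Proof.
move=> a0 fin N; rewrite -lee_fin fineK.
  rewrite -sumEFin -(big_mkord xpredT (fun i => (a i)%:E)).
  by apply: nneseries_lim_ge => i _ _; rewrite lee_fin.
by rewrite ge0_fin_numE//; apply: nneseries_ge0 => i _ _; rewrite lee_fin.
Qed.

Lemma eigenvalue_ge i : lam 0%N <= lam i.
Proof. by elim: i => // i IH; apply: le_trans IH (eigenbasis_le hbasis i). Qed.

Lemma hdot1_partial u N : (hdot_sqnorm lam e 1 u < +oo)%E ->
  \sum_(i < N) lam i * inner u (e i) ^+ 2 <= fine (hdot_sqnorm lam e 1 u).
Proof.
have -> : hdot_sqnorm lam e 1 u = (\sum_(0 <= i <oo) (lam i * inner u (e i) ^+ 2)%:E)%E.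
  by apply: eq_eseriesr => i _; rewrite powRr1// ltW// (eigenvalue_gt0 hbasis).
move=> fin; apply: (@sum_le_nneseries (fun i => lam i * inner u (e i) ^+ 2)) fin N => i.
by rewrite mulr_ge0 ?sqr_ge0// ltW// (eigenvalue_gt0 hbasis).
Qed.

Lemma hdot0_partial u N : (hdot_sqnorm lam e (1 - 1) u < +oo)%E ->
  \sum_(i < N) inner u (e i) ^+ 2 <= fine (hdot_sqnorm lam e (1 - 1) u).
Proof.
have -> : hdot_sqnorm lam e (1 - 1) u = (\sum_(0 <= i <oo) (inner u (e i) ^+ 2)%:E)%E.
  by apply: eq_eseriesr => i _; rewrite subrr powRr0 mul1r.
move=> fin; apply: (@sum_le_nneseries (fun i => inner u (e i) ^+ 2)) fin N => i.
exact: sqr_ge0.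
Qed.

(** The right-hand side does not depend on N: the Parseval sums over the first N
    modes increase to the norms of u0 and v0, lam 0 is the spectral gap, and
    comb_L4 bounds the potential energy. *)
Lemma initial_energy_le (F : fn R d -> R) (a2 b2 : R) u0 v0 N : 0 < a2 ->
  (forall u, in_Lp 4 u -> F u <= a2 * L4_norm u ^+ 4 + b2) ->
  (hdot_sqnorm lam e 1 u0 < +oo)%E -> (hdot_sqnorm lam e (1 - 1) v0 < +oo)%E ->
  forall A, A = fine (hdot_sqnorm lam e 1 u0) ->
  initial_energy lam e F u0 v0 N <=
    A / 2 + fine (hdot_sqnorm lam e (1 - 1) v0) / 2 + (a2 * (4 * (A / lam 0%N) * A) + b2).
Proof.
move=> a2_gt0 Fle finu finv A AE; rewrite /initial_energy.
have SA := hdot1_partial N finu; have SB := hdot0_partial N finv.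
rewrite -AE in SA.
have l0 : 0 < lam 0%N := eigenvalue_gt0 hbasis 0.
have [p4 L4] := comb_L4 hd hbasis (fun i : 'I_N => inner u0 (e i)).
have S2 : \sum_(i < N) inner u0 (e i) ^+ 2 <= A / lam 0%N.
  rewrite ler_pdivlMr// mulr_suml; apply: le_trans SA; apply: ler_sum => i _.
  by rewrite mulrC ler_wpM2r ?sqr_ge0// eigenvalue_ge.
have S20 : 0 <= \sum_(i < N) inner u0 (e i) ^+ 2.
  by apply: sumr_ge0 => i _; exact: sqr_ge0.
have SA0 : 0 <= \sum_(i < N) lam i * inner u0 (e i) ^+ 2.
  by apply: sumr_ge0 => i _; rewrite mulr_ge0 ?sqr_ge0// ltW// (eigenvalue_gt0 hbasis).
apply: lerD; first by apply: lerD; rewrite ler_pM2r ?invr_gt0.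
apply: le_trans (Fle _ p4) _; rewrite lerD2r ler_pM2l//; apply: le_trans L4 _.
apply: ler_pM => //; first by rewrite mulr_ge0.
by rewrite ler_pM2l.
Qed.

End initial_bounds.

Theorem lemma3p2 (R : realType) (d : nat) (hd : d = 1%N \/ d = 2%N)
    (lam : nat -> R) (e : nat -> fn R d) (hbasis : eigenbasis lam e)
    (c0 c1 c2 c3 : R) (hc3 : 0 < c3) (f : R -> R)
    (hf : f = fun x => c3 * x ^+ 3 + c2 * x ^+ 2 + c1 * x + c0)
    (F : fn R d -> R) (hF : potential f F)
    (a1 a2 b1 b2 : R) (ha1 : 0 < a1) (ha2 : 0 < a2) (hb1 : 0 < b1)
    (hb2 : 0 < b2)
    (hFbound : forall u : fn R d, in_Lp 4 u ->
       a1 * L4_norm u ^+ 4 - b1 <= F u <= a2 * L4_norm u ^+ 4 + b2)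
    (C1 : R) (hC1 : b1 <= C1)
    (Q sqrtQ : fn R d -> fn R d) (hQ : bounded_operator Q)
    (hQsym : symmetric_operator Q) (hQpos : positive_definite Q)
    (hQtr : (trace e Q < +oo)%E)
    (hsqrtQ : square_root Q sqrtQ) (hsqrtQ_HS : hilbert_schmidt e sqrtQ)
    (u0 v0 : fn R d) (hX0 : in_H lam e 1 (u0, v0)) (T : R) (hT : 0 < T) :
  exists alpha C : R, [/\ (trace e Q <= alpha%:E)%E, 0 < C &
    forall (dsp : measure_display) (Omega : measurableType dsp)
      (P : probability Omega R) (Fil : R -> set (set Omega))
      (W : R -> Omega -> fn R d),
    filtration Fil -> Q_wiener P Fil Q W ->
    forall N : nat, (0 < N)%N ->
    forall u v : R -> Omega -> fn R d,
    galerkin_mild_solution P Fil lam e f u0 v0 T W N u v ->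
    (ereal_sup [set 'E_P[(fun w =>
        expR (V1 lam e F C1 (u s w) (v s w) / expR (alpha * s)))]
      | s in `[0%R, T]] <= C%:E)%E].
Proof.
have [[pu0 finu] [pv0 finv]] := hX0.
have pe i : in_Lp 2 (e i) := eigenbasis_L2 hbasis i.
have q0 i : 0 < inner (Q (e i)) (e i).
  apply: hQpos => // e0; have := eigenbasis_orthonormal hbasis i i.
  rewrite eqxx (inner_eq_L _ _ _ e0); [|exact: in_Lp_measurable (pe i)|exact: measurable_cst|
    exact: in_Lp_measurable (pe i)].
  by rewrite inner0l => /eqP; rewrite eq_sym oner_eq0.
pose tr := fine (trace e Q).
have tr0 : (0 <= trace e Q)%E by apply: nneseries_ge0 => i _ _; rewrite lee_fin ltW.
have trE : trace e Q = tr%:E by rewrite fineK// ge0_fin_numE.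
have tr_ge0 : 0 <= tr by exact: fine_ge0.
have F_ge z : in_Lp 4 z -> 0 <= F z + C1.
  move=> pz; have /andP[Fz _] := hFbound z pz.
  have L0 : 0 <= a1 * L4_norm z ^+ 4.
    by rewrite mulr_ge0 ?(ltW ha1)// (exprM _ 2 2) sqr_ge0.
  by rewrite -lerBlDr sub0r; apply: le_trans Fz; rewrite -[leLHS]add0r lerD// lerN2.
pose A := fine (hdot_sqnorm lam e 1 u0).
pose M := A / 2 + fine (hdot_sqnorm lam e (1 - 1) v0) / 2 + (a2 * (4 * (A / lam 0%N) * A) + b2).
exists (4 * tr), (expR (M + C1 + 1 + 2 * tr * T)); split.
- by rewrite trE lee_fin ler_peMl// ler1n.
- exact: expR_gt0.
move=> dsp Omega P Fil W hFil hW N N0 u v huv.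
apply: ge_ereal_sup => _ [s sT <-]; rewrite unlock.
have {}sT : 0 <= s <= T by move: sT; rewrite /= in_itv.
have qtr : \sum_(i < N) inner (Q (e i)) (e i) <= tr.
  by apply: (@sum_le_nneseries _ (fun i => inner (Q (e i)) (e i))) => // i; exact: ltW.
apply: le_trans (energy_moment hd hbasis hf hF F_ge hFil hW (ltW hT) N0 huv q0 qtr sT) _.
rewrite lee_fin ler_expR; have /andP[_ s1] := sT.
apply: lerD; last by rewrite ler_wpM2l// mulr_ge0.
rewrite !lerD2r; apply: (initial_energy_le hd hbasis) => // z pz.
by have /andP[] := hFbound z pz.
Qed.
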